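(* Let $M$ be a finitely generated conical refinement monoid. Then there is an adaptable separated graph $(E,C)$ such that $$M\cong\mathrm{Typ}(\mathcal G_{tight}(S(E,C))).$$ In particular, all finitely generated conical refinement monoids arise as type semigroups of ample Hausdorff groupoids.
   Context: **Monoids.** All monoids are commutative. $M$ is conical if $x+y=0$ implies $x=y=0$. $M$ is a refinement monoid if whenever $a+b=c+d$ there are $w,x,y,z\in M$ with $a=w+x$, $b=y+z$, $c=w+y$, $d=x+z$. **Adaptable separated graphs.** $\mathbb N=\{1,2,\dots\}$. For a directed graph $E=(E^0,E^1,s,r)$, paths are $e_1\cdots e_n$ with $r(e_i)=s(e_{i+1})$; vertices are paths of length $0$. A separated graph $(E,C)$ is a directed graph $E$ with $C=\bigsqcup_{v\in E^0}C_v$, where $C_v$ is a partition of $s^{-1}(v)$ into nonempty subsets ($C_v=\emptyset$ if $v$ is a sink). It is finitely separated if all sets in $C$ are finite. Put $v\le w$ if there is a path from $w$ to $v$; let $(I,\le)$ be the antisymmetrization of $(E^0,\le)$, whose elements are the transitive components. A finitely separated graph $(E,C)$ is adaptable if $I$ is finite and there are a partition $I=I_{free}\sqcup I_{reg}$ and subgraphs $(E_p)_{p\in I}$, with $E_p^0$ the vertex set of the component $p$, such that: (1) $E^0=\bigsqcup_p E_p^0$; $E_p$ is a transitive (any two vertices joined by a directed path) row-finite graph if $p\in I_{reg}$; $E_p^0=\{v^p\}$ if $p\in I_{free}$. (2) For $p\in I_{reg}$, $w\in E_p^0$: $|C_w|=1$, $|s_{E_p}^{-1}(w)|\ge 2$,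 and every edge with source $w$ lies in $E_p$ or has range in $E_q^0$ with $q<p$. (3) For $p\in I_{free}$: $s^{-1}(v^p)=\emptyset$ iff $p$ is minimal in $I$ (then put $k(p)=0$). If $p$ is not minimal, $C_{v^p}=\{X_1^{(p)},\dots,X_{k(p)}^{(p)}\}$ is finite with $X_i^{(p)}=\{\alpha(p,i),\beta(p,i,1),\dots,\beta(p,i,g(p,i))\}$, $g(p,i)\ge1$, $\alpha(p,i)$ a loop at $v^p$, $r(\beta(p,i,t))\in E_q^0$ with $q<p$; and $E_p^1=\{\alpha(p,1),\dots,\alpha(p,k(p))\}$. **The inverse semigroup $S(E,C)$.** It is the $*$-semigroup with $0$ ($*$-semigroup: $s^{**}=s$, $(st)^*=t^*s^*$) generated by $E^0\cup E^1\cup\{(t_i^v)^{\pm1}: i\in\mathbb N,v\in E^0\}$ with relations: (R1) $vw=\delta_{v,w}v$, $v^*=v$ for $v,w\in E^0$; (R2) $e=s(e)e=er(e)$ for $e\in E^1$, and $e^*f=\delta_{e,f}r(e)$ for $e,f$ in the same set $X\in C$; (R3) for $p\in I_{free}$, $i\ne j$: $\alpha(p,i)\alpha(p,j)=\alpha(p,j)\alpha(p,i)$, $\alpha(p,i)\alpha(p,j)^*=\alpha(p,j)^*\alpha(p,i)$; (R4) for $p\in I_{free}$: $\beta(p,i,s)^*\beta(p,j,t)=0$ if $(i,s)\neq(j,t)$; (R5) for each $v$ the elements $(t_i^v)^{\pm1}$ commute mutually, $vt_i^v=t_i^v=t_i^vv$, $t_i^v(t_i^v)^{-1}=v=(t_i^v)^{-1}t_i^v$,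 $(t_i^v)^*=(t_i^v)^{-1}$; (R6) $t_i^{s(e)}e=e\,t_i^{r(e)}$ if $s(e)\in E_p^0$, $p\in I_{reg}$; (R7) for $p\in I_{free}$: $(t_i^{v^p})^{\pm1}\beta(p,j,s)=\beta(p,j,s)(t^{r(\beta(p,j,s))}_{i+k(p)-1})^{\pm1}$; (R8) for $p\in I_{free}$, $i\ne j$: $\alpha(p,i)\beta(p,j,s)=\beta(p,j,s)t^{r(\beta(p,j,s))}_{\sigma_j^p(i)}$ and $\alpha(p,i)^*\beta(p,j,s)=\beta(p,j,s)(t^{r(\beta(p,j,s))}_{\sigma_j^p(i)})^{-1}$, where $\sigma_j^p$ is the increasing bijection $\{1,\dots,k(p)\}\setminus\{j\}\to\{1,\dots,k(p)-1\}$; (R9) for $p\in I_{free}$: $t_i^{v^p}$ commutes with $\alpha(p,j)$ and $\alpha(p,j)^*$. $S(E,C)$ is an inverse semigroup; $\mathcal E$ is its semilattice of idempotents ($e\le f$ iff $ef=e$). **Tight groupoid.** A filter on $\mathcal E$ is a nonempty $\eta\subseteq\mathcal E$ with $0\notin\eta$, closed under products and upward closed. Filters are topologized as a subspace of $\{0,1\}^{\mathcal E}$. A finite cover of $\mathcal F_e=\{f\in\mathcal E:f\le e\}$ is a finite $Z\subseteq\mathcal F_e$ such that every $0\ne f\in\mathcal F_e$ has $fz\neq0$ for some $z\in Z$. A filter $\eta$ is tight if $e\in\eta$ implies $Z\cap\eta\ne\emptyset$ for every finite cover $Z$ of $\mathcal F_e$; $\widehat{\mathcal E}_{tight}$ is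 the space of tight filters. For $e\in\mathcal E$ let $D_e=\{\eta\in\widehat{\mathcal E}_{tight}: e\in\eta\}$; $s\in S(E,C)$ acts by $\alpha_s\colon D_{s^*s}\to D_{ss^*}$, $\alpha_s(\eta)=\{f\in\mathcal E: s^*fs\in\eta\}$. $\mathcal G_{tight}(S(E,C))$ is the groupoid of germs $[s,x]$, $x\in D_{s^*s}$, where $[s,x]=[s',y]$ iff $x=y$ and $sf=s'f$ for some $f\in\mathcal E$ with $f\in x$; source $x$, range $\alpha_s(x)$, $[s,\alpha_t(x)][t,x]=[st,x]$, $[s,x]^{-1}=[s^*,\alpha_s(x)]$. Its topology is generated by $\Theta(s,U)=\{[s,x]:x\in U\}$, $U\subseteq D_{s^*s}$ open. **Type semigroup.** For an ample groupoid $\mathcal G$ with locally compact Hausdorff unit space, $\mathrm{Typ}(\mathcal G)$ is the commutative monoid generated by symbols $[A]$, $A\subseteq\mathcal G^{(0)}$ compact open, with relations $[\emptyset]=0$; $[s(W)]=[r(W)]$ for every compact open bisection $W$; $[A\sqcup B]=[A]+[B]$ for disjoint $A,B$. *)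

(* Defs.v *)
From HB Require Import structures.
From mathcomp Require Import all_boot all_order all_algebra.
From mathcomp Require Import all_classical.
From mathcomp Require Import topology_structure separation_axioms compact.
From mathcomp Require Import bool_topology product_topology initial_topology.
From mathcomp Require Import subtype_topology function_spaces.

Set Implicit Arguments.
Unset Strict Implicit.
Unset Printing Implicit Defensive.

Import GRing.Theory.
Local Open Scope classical_set_scope.
Local Open Scope quotient_scope.

Section CommutativeMonoids.
Local Open Scope ring_scope.

Definition monoid_fg (M : nmodType) : Prop :=
  exists (n : nat) (g : 'I_n -> M),
    forall x : M, exists c : 'I_n -> nat, x = \sum_(i < n) g i *+ c i.

Definition monoid_conical (M : nmodType) : Prop :=
  forall x y : M, x + y = 0 -> x = 0 /\ y = 0.

Definition monoid_refinement (M : nmodType) : Prop :=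
  forall a b c d : M, a + b = c + d ->
    exists w x y z : M, [/\ a = w + x, b = y + z, c = w + y & d = x + z].

Definition monoid_iso (M N : nmodType) : Prop :=
  exists f : {additive M -> N}, bijective f.

End CommutativeMonoids.

Record sepGraph := SepGraph {
  vertex : Type;
  edge : Type;
  esrc : edge -> vertex;
  erng : edge -> vertex;
  sep : vertex -> set (set edge);
  sep_partition : forall v, partition (sep v) id (esrc @^-1` [set v])
}.

Section SeparatedGraphs.
Variable E : sepGraph.
Implicit Types (v w : vertex E) (e : edge E).

Definition finitely_separated : Prop :=
  forall v (X : set (edge E)), sep v X -> finite_set X.

(* [gpath D v s w]: [s] is a path from [v] to [w] all of whose edges are in
   [D]; the empty sequence is the path of length 0 at each vertex. *)
Fixpoint gpath (D : set (edge E)) v (s : seq (edge E)) w : Prop :=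
  if s is e :: s' then [/\ D e, esrc e = v & gpath D (erng e) s' w] else v = w.

Definition vle v w : Prop := exists s, gpath setT w s v.

Definition transitive_comp v : set (vertex E) := [set w | vle v w /\ vle w v].

(* The antisymmetrization I, each element being given as its set of vertices *)
Definition component : Type := set_type (range transitive_comp).

Definition comp_verts (p : component) : set (vertex E) := set_val p.

Definition comp_le (p q : component) : Prop :=
  exists v w, [/\ comp_verts p v, comp_verts q w & vle v w].

Definition comp_lt (p q : component) : Prop := comp_le p q /\ p <> q.

Definition comp_minimal (p : component) : Prop :=
  forall q, comp_le q p -> q = p.

Definition free_block e n (b : 'I_n -> edge E) : set (edge E) :=
  [set e] `|` range b.

End SeparatedGraphs.

(* Components outside [ad_free] form I_reg.  E_p has vertex set
   [comp_verts p] and edge set [ad_sub p].  Indices of alpha(p,i) and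
   beta(p,i,t) are shifted to start at 0.  The families k, g, alpha, beta are
   unconstrained on regular components, where nothing refers to them. *)
Record adaptable (E : sepGraph) := Adaptable {
  ad_free : set (component E);
  ad_sub : component E -> set (edge E);
  ad_k : component E -> nat;
  ad_g : forall p : component E, 'I_(ad_k p) -> nat;
  ad_alpha : forall p : component E, 'I_(ad_k p) -> edge E;
  ad_beta : forall (p : component E) (i : 'I_(ad_k p)), 'I_(ad_g i) -> edge E;

  ad_finitely_separated : finitely_separated E;
  ad_finite : finite_set [set: component E];
  ad_subgraph : forall p e, ad_sub p e ->
    comp_verts p (esrc e) /\ comp_verts p (erng e);

  ad_reg_transitive : forall p, ~ ad_free p ->
    forall v w, comp_verts p v -> comp_verts p w ->
      exists s, gpath (ad_sub p) v s w;
  ad_reg_row_finite : forall p, ~ ad_free p -> forall v, comp_verts p v ->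
    finite_set (ad_sub p `&` @esrc E @^-1` [set v]);
  ad_free_vertex : forall p, ad_free p -> exists v, comp_verts p = [set v];

  ad_reg_sep : forall p, ~ ad_free p -> forall w, comp_verts p w ->
    exists X, sep w = [set X];
  ad_reg_two : forall p, ~ ad_free p -> forall w, comp_verts p w ->
    exists e f, [/\ e <> f, ad_sub p e, ad_sub p f, esrc e = w & esrc f = w];
  ad_reg_edge : forall p, ~ ad_free p -> forall e, comp_verts p (esrc e) ->
    ad_sub p e \/ exists q, comp_lt q p /\ comp_verts q (erng e);

  ad_free_sink : forall p, ad_free p -> forall v, comp_verts p v ->
    @esrc E @^-1` [set v] = set0 <-> comp_minimal p;
  ad_free_minimal : forall p, ad_free p -> comp_minimal p -> ad_k p = 0%N;
  ad_free_sep : forall p, ad_free p -> ~ comp_minimal p ->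
    forall v, comp_verts p v ->
      sep v = range (fun i => free_block (ad_alpha i) (@ad_beta p i));
  ad_free_X_inj : forall p, ad_free p ->
    injective (fun i => free_block (ad_alpha i) (@ad_beta p i));
  ad_free_beta_inj : forall p (i : 'I_(ad_k p)), ad_free p ->
    injective (@ad_beta p i);
  ad_free_g_gt0 : forall p (i : 'I_(ad_k p)), ad_free p -> (0 < ad_g i)%N;
  ad_free_alpha : forall p (i : 'I_(ad_k p)), ad_free p ->
    forall v, comp_verts p v -> esrc (ad_alpha i) = v /\ erng (ad_alpha i) = v;
  ad_free_beta : forall p (i : 'I_(ad_k p)) (t : 'I_(ad_g i)), ad_free p ->
    exists q, comp_lt q p /\ comp_verts q (erng (ad_beta t));
  ad_free_sub : forall p, ad_free p -> ad_sub p = range (@ad_alpha p)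
}.

Local Open Scope group_scope.

HB.mixin Record Semigroup_hasStarZero S of Semigroup S := {
  szero : S;
  star : S -> S;
  mul0s : left_zero szero *%g;
  muls0 : right_zero szero *%g;
  starK : involutive star;
  starM : forall x y : S, star (x * y) = star y * star x
}.

#[short(type="starSemigroupType")]
HB.structure Definition StarSemigroup :=
  {S of Semigroup_hasStarZero S & Semigroup S}.

Arguments szero {s}.
Local Notation "x ^*" := (star x) : group_scope.

Definition inverse_law (S : starSemigroupType) : Prop :=
  forall s : S, [/\ s * s^* * s = s, s^* * s * s^* = s^*
    & forall t : S, s * t * s = s -> t * s * t = t -> t = s^*].

HB.mixin Record StarSemigroup_isInverse S of StarSemigroup S := {
  inverseP : inverse_law S
}.

#[short(type="inverseSemigroupType")]
HB.structure Definition InverseSemigroup :=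
  {S of StarSemigroup_isInverse S & StarSemigroup S}.

Definition idem (S : starSemigroupType) (e : S) : Prop := e * e = e.

(* [GenT true i v] is t_(i+1)^v and [GenT false i v] is its inverse: the
   indices of the t's are shifted to start at 0, like those of alpha, beta. *)
Inductive sgen (E : sepGraph) : Type :=
| GenV of vertex E
| GenE of edge E
| GenT of bool & nat & vertex E.

Inductive sterm (E : sepGraph) : Type :=
| TZero
| TGen of sgen E
| TMul of sterm E & sterm E
| TStar of sterm E.

Arguments TZero {E}.

Section Presentation.
Variables (E : sepGraph) (A : adaptable E).

Local Notation "x ** y" := (TMul x y) (at level 40, left associativity).
Local Notation V v := (TGen (GenV v)).
Local Notation Ed e := (TGen (GenE e)).
Local Notation T b i v := (TGen (GenT b i v)).

(* With indices starting at 0, i + k(p) - 1 in (R7) is unchanged, and the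
   increasing bijection sigma_j^p of (R8) is [unbump j]. *)
Inductive srel : sterm E -> sterm E -> Prop :=
| srel_refl x : srel x x
| srel_sym x y : srel x y -> srel y x
| srel_trans x y z : srel x y -> srel y z -> srel x z
| srel_mul x x' y y' : srel x x' -> srel y y' -> srel (x ** y) (x' ** y')
| srel_star x x' : srel x x' -> srel (TStar x) (TStar x')
| srel_mulA x y z : srel (x ** (y ** z)) (x ** y ** z)
| srel_mul0l x : srel (TZero ** x) TZero
| srel_mul0r x : srel (x ** TZero) TZero
| srel_starK x : srel (TStar (TStar x)) x
| srel_starM x y : srel (TStar (x ** y)) (TStar y ** TStar x)
| srel_R1_idem v : srel (V v ** V v) (V v)
| srel_R1_orth v w : v <> w -> srel (V v ** V w) TZero
| srel_R1_star v : srel (TStar (V v)) (V v)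
| srel_R2_src e : srel (V (esrc e) ** Ed e) (Ed e)
| srel_R2_rng e : srel (Ed e ** V (erng e)) (Ed e)
| srel_R2_same v X e : sep v X -> X e ->
    srel (TStar (Ed e) ** Ed e) (V (erng e))
| srel_R2_diff v X e f : sep v X -> X e -> X f -> e <> f ->
    srel (TStar (Ed e) ** Ed f) TZero
| srel_R3 p (i j : 'I_(ad_k A p)) : ad_free A p -> i <> j ->
    srel (Ed (ad_alpha i) ** Ed (ad_alpha j))
         (Ed (ad_alpha j) ** Ed (ad_alpha i))
| srel_R3_star p (i j : 'I_(ad_k A p)) : ad_free A p -> i <> j ->
    srel (Ed (ad_alpha i) ** TStar (Ed (ad_alpha j)))
         (TStar (Ed (ad_alpha j)) ** Ed (ad_alpha i))
| srel_R4 p (u w : {i : 'I_(ad_k A p) & 'I_(ad_g i)}) : ad_free A p -> u <> w ->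
    srel (TStar (Ed (ad_beta (tagged u))) ** Ed (ad_beta (tagged w))) TZero
| srel_R5_comm b c i j v : srel (T b i v ** T c j v) (T c j v ** T b i v)
| srel_R5_left i v : srel (V v ** T true i v) (T true i v)
| srel_R5_right i v : srel (T true i v ** V v) (T true i v)
| srel_R5_inv b i v : srel (T b i v ** T (~~ b) i v) (V v)
| srel_R5_star i v : srel (TStar (T true i v)) (T false i v)
| srel_R6 p i e : ~ ad_free A p -> comp_verts p (esrc e) ->
    srel (T true i (esrc e) ** Ed e) (Ed e ** T true i (erng e))
| srel_R7 p v (j : 'I_(ad_k A p)) (s : 'I_(ad_g j)) b i :
    ad_free A p -> comp_verts p v ->
    srel (T b i v ** Ed (ad_beta s))
         (Ed (ad_beta s) ** T b (i + ad_k A p - 1)%N (erng (ad_beta s)))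
| srel_R8 p (i j : 'I_(ad_k A p)) (s : 'I_(ad_g j)) : ad_free A p -> i <> j ->
    srel (Ed (ad_alpha i) ** Ed (ad_beta s))
         (Ed (ad_beta s) ** T true (unbump j i) (erng (ad_beta s)))
| srel_R8_star p (i j : 'I_(ad_k A p)) (s : 'I_(ad_g j)) :
    ad_free A p -> i <> j ->
    srel (TStar (Ed (ad_alpha i)) ** Ed (ad_beta s))
         (Ed (ad_beta s) ** T false (unbump j i) (erng (ad_beta s)))
| srel_R9 p v (j : 'I_(ad_k A p)) i : ad_free A p -> comp_verts p v ->
    srel (T true i v ** Ed (ad_alpha j)) (Ed (ad_alpha j) ** T true i v)
| srel_R9_star p v (j : 'I_(ad_k A p)) i : ad_free A p -> comp_verts p v ->
    srel (T true i v ** TStar (Ed (ad_alpha j)))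
         (TStar (Ed (ad_alpha j)) ** T true i v).

Let pterm := {classic (sterm E)}.

Definition srelb : rel pterm := fun x y => `[< srel x y >].

Lemma srelb_refl : reflexive srelb.
Proof. by move=> x; apply/asboolP; exact: srel_refl. Qed.

Lemma srelb_sym : symmetric srelb.
Proof. by move=> x y; apply/asboolP/asboolP => /srel_sym. Qed.

Lemma srelb_trans : transitive srelb.
Proof.
by move=> y x z /asboolP xy /asboolP yz; apply/asboolP; exact: srel_trans yz.
Qed.

Canonical srel_equiv := EquivRel srelb srelb_refl srelb_sym srelb_trans.

Definition SEC : Type := {eq_quot srel_equiv}.

HB.instance Definition _ := Choice.on SEC.
HB.instance Definition _ := EqQuotient.on SEC.

Lemma SEC_eq (x y : sterm E) : srel x y <-> \pi_SEC x = \pi_SEC y.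
Proof.
split=> [xy|/eqP]; first by apply/eqP; rewrite piE; apply/asboolP.
by rewrite piE => /asboolP.
Qed.

Lemma SEC_repr (x : sterm E) : srel (repr (\pi_SEC x)) x.
Proof. by apply/SEC_eq; rewrite reprK. Qed.

Definition SEC_mul (x y : SEC) : SEC := \pi_SEC (repr x ** repr y).
Definition SEC_star (x : SEC) : SEC := \pi_SEC (TStar (repr x)).
Definition SEC_zero : SEC := \pi_SEC TZero.

Lemma SEC_mulE x y : SEC_mul (\pi_SEC x) (\pi_SEC y) = \pi_SEC (x ** y).
Proof. by apply/SEC_eq/srel_mul; exact: SEC_repr. Qed.

Lemma SEC_starE x : SEC_star (\pi_SEC x) = \pi_SEC (TStar x).
Proof. by apply/SEC_eq/srel_star; exact: SEC_repr. Qed.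

Lemma SEC_mulA : associative SEC_mul.
Proof.
elim/quotW=> x; elim/quotW=> y; elim/quotW=> z.
rewrite (SEC_mulE y) (SEC_mulE x y) (SEC_mulE x) (SEC_mulE (x ** y)).
by apply/SEC_eq; exact: srel_mulA.
Qed.

HB.instance Definition _ := isSemigroup.Build SEC SEC_mulA.

Lemma SEC_mul0s : left_zero SEC_zero SEC_mul.
Proof. by elim/quotW=> x; rewrite SEC_mulE; exact/SEC_eq/srel_mul0l. Qed.

Lemma SEC_muls0 : right_zero SEC_zero SEC_mul.
Proof. by elim/quotW=> x; rewrite SEC_mulE; exact/SEC_eq/srel_mul0r. Qed.

Lemma SEC_starK : involutive SEC_star.
Proof.
elim/quotW=> x; rewrite (SEC_starE x) (SEC_starE (TStar x)).
by apply/SEC_eq; exact: srel_starK.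
Qed.

Lemma SEC_starM x y :
  SEC_star (SEC_mul x y) = SEC_mul (SEC_star y) (SEC_star x).
Proof.
elim/quotW: x => x; elim/quotW: y => y.
by rewrite (SEC_mulE x y) (SEC_starE x) (SEC_starE y)
  (SEC_mulE (TStar y)) (SEC_starE (x ** y)); apply/SEC_eq; exact: srel_starM.
Qed.

HB.instance Definition _ := Semigroup_hasStarZero.Build SEC
  SEC_mul0s SEC_muls0 SEC_starK SEC_starM.

Definition SEC_inverse (h : inverse_law SEC) : inverseSemigroupType :=
  HB.pack SEC (StarSemigroup_isInverse.Build SEC h).

End Presentation.

Section TightFilters.
Variable S : starSemigroupType.
Implicit Types (e f : S) (eta : set S).

Definition is_filter eta : Prop :=
  [/\ eta `<=` @idem S, eta !=set0, ~ eta szero,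
      forall e f, eta e -> eta f -> eta (e * f)
    & forall e f, eta e -> idem f -> e * f = e -> eta f].

(* [Z] is a finite cover of the set of idempotents below [e]. *)
Definition finite_cover e (Z : set S) : Prop :=
  [/\ finite_set Z, forall z, Z z -> idem z /\ z * e = z
    & forall f, idem f -> f * e = f -> f <> szero ->
        exists2 z, Z z & f * z <> szero].

Definition is_tight eta : Prop :=
  forall e, eta e -> forall Z, finite_cover e Z -> Z `&` eta !=set0.

Definition tight_space : Type :=
  set_type [set eta : set S | is_filter eta /\ is_tight eta].

HB.instance Definition _ := Choice.on tight_space.

(* The inclusion of the tight filters in {0,1}^(idempotents of S) *)
Definition tight_indicator (x : tight_space) :
    prod_topology (fun _ : {e : S | idem e} => bool) :=
  fun u => `[< set_val x (sval u) >].

HB.instance Definition _ :=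
  Topological.copy tight_space (initial_topology tight_indicator).

Definition tight_dom (e : S) : set tight_space := [set x | set_val x e].

End TightFilters.

Section InverseSemigroupTheory.
Variable S : inverseSemigroupType.
Implicit Types (s t e f : S) (x : tight_space S) (eta : set S).

Lemma mulsVs s : s * s^* * s = s.
Proof. by have [] := @inverseP S s. Qed.

Lemma mulVsV s : s^* * s * s^* = s^*.
Proof. by have [] := @inverseP S s. Qed.

Lemma star_unique s t : s * t * s = s -> t * s * t = t -> t = s^*.
Proof. by have [_ _] := @inverseP S s; apply. Qed.

Lemma idem_star e : idem e -> e^* = e.
Proof. by move=> ee; apply/esym/star_unique; rewrite ee ee. Qed.

Lemma idemM e f : idem e -> idem f -> idem (e * f).
Proof.
move=> ee ff; set x := (e * f)^*.
have x1 : (e * f) * x * (e * f) = e * f by exact: mulsVs.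
have x2 : x * (e * f) * x = x by exact: mulVsV.
have fxe : f * x * e = x.
  apply: star_unique.
    have -> : e * f * (f * x * e) * (e * f) = e * (f * f) * x * ((e * e) * f).
      by rewrite !mulgA.
    by rewrite ee ff.
  have -> : f * x * e * (e * f) * (f * x * e)
      = f * (x * ((e * e) * (f * f)) * x) * e by rewrite !mulgA.
  by rewrite ee ff x2.
have xx : idem x.
  rewrite /idem -{1 2}fxe.
  have -> : f * x * e * (f * x * e) = f * (x * (e * f) * x) * e.
    by rewrite !mulgA.
  by rewrite x2.
have := idem_star xx; rewrite /x starK => efx.
by rewrite /idem efx; exact: xx.
Qed.

Lemma idemC e f : idem e -> idem f -> e * f = f * e.
Proof.
move=> ee ff; have ef := idemM ee ff; have fe := idemM ff ee.
rewrite -(idem_star ef); apply/esym/star_unique.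
  have -> : e * f * (f * e) * (e * f) = e * (f * f) * (e * e) * f.
    by rewrite !mulgA.
  by rewrite ee ff -mulgA ef.
have -> : f * e * (e * f) * (f * e) = f * (e * e) * (f * f) * e.
  by rewrite !mulgA.
by rewrite ee ff -mulgA fe.
Qed.

Lemma idemVs s : idem (s^* * s).
Proof. by rewrite /idem mulgA mulVsV. Qed.

Lemma idemsV s : idem (s * s^*).
Proof. by rewrite /idem mulgA mulsVs. Qed.

Lemma idem_mulsC s f : idem f -> s * (s^* * f * s) = f * s.
Proof.
move=> ff; have -> : s * (s^* * f * s) = (s * s^*) * f * s by rewrite !mulgA.
by rewrite (idemC (idemsV s) ff) -mulgA mulsVs.
Qed.

Lemma idem_mulVC s f : idem f -> (s^* * f * s) * s^* = s^* * f.
Proof.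
move=> ff; have -> : (s^* * f * s) * s^* = s^* * (f * (s * s^*)).
  by rewrite !mulgA.
by rewrite (idemC ff (idemsV s)) !mulgA mulVsV.
Qed.

Lemma conjM s f g : idem f ->
  (s^* * f * s) * (s^* * g * s) = s^* * (f * g) * s.
Proof.
move=> ff; have -> : (s^* * f * s) * (s^* * g * s)
    = (s^* * f * s) * s^* * g * s by rewrite !mulgA.
by rewrite idem_mulVC // !mulgA.
Qed.

Lemma idem_conj s f : idem f -> idem (s^* * f * s).
Proof. by move=> ff; rewrite /idem conjM // ff. Qed.

Lemma idem_conjV s f : idem f -> idem (s * f * s^*).
Proof. by move=> ff; have := idem_conj s^* ff; rewrite starK. Qed.

Lemma tight_filter x : is_filter (set_val x).
Proof. by have [] := set_mem (valP x). Qed.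

Lemma tight_tight x : is_tight (set_val x).
Proof. by have [] := set_mem (valP x). Qed.

Lemma tight_idem x e : set_val x e -> idem e.
Proof. by have [+ _ _ _ _] := tight_filter x; apply. Qed.

Lemma tightM x e f : set_val x e -> set_val x f -> set_val x (e * f).
Proof. by have [_ _ _ + _] := tight_filter x; apply. Qed.

Lemma tightS x e f : set_val x e -> idem f -> e * f = e -> set_val x f.
Proof. by have [_ _ _ _ +] := tight_filter x; apply. Qed.

Definition act_set s eta : set S := [set f | idem f /\ eta (s^* * f * s)].

Lemma act_filter s x :
  tight_dom (s^* * s) x -> is_filter (act_set s (set_val x)).
Proof.
move=> xs; split=> [f [] //|||e f [ee xe] [ff xf]|e f [ee xe] ff ef].
- exists (s * s^*); split; first exact: idemsV.
  by rewrite !mulgA mulVsV.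
- move=> [_]; rewrite muls0 mul0s.
  by have [_ _ + _ _] := tight_filter x.
- by split; [exact: idemM|rewrite -conjM //; exact: tightM].
- split=> //; apply: (tightS xe); first exact: idem_conj.
  by rewrite conjM // ef.
Qed.

Lemma act_tight s x : tight_dom (s^* * s) x -> is_tight (act_set s (set_val x)).
Proof.
move=> xs e [ee xe] Z [finZ Zle Zcov].
have cov : finite_cover (s^* * e * s) [set s^* * z * s | z in Z].
  split=> [|_ [z Zz <-]|h hh hle hn0]; first exact: finite_image.
    have [zz ze] := Zle _ Zz; split; first exact: idem_conj.
    by rewrite conjM // ze.
  have hss : h * (s^* * s) = h.
    by rewrite -hle -!mulgA [s * (s^* * s)]mulgA mulsVs.
  have shs : s^* * (s * h * s^*) * s = h.
    have -> : s^* * (s * h * s^*) * s = (s^* * s) * h * (s^* * s).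
      by rewrite !mulgA.
    by rewrite (idemC (idemVs s) hh) -mulgA idemVs.
  have kk : idem (s * h * s^*) by exact: idem_conjV.
  have [||z Zz kz] := Zcov (s * h * s^*) kk.
  + have -> : s * h * s^* * e = s * (h * (s^* * e)) by rewrite !mulgA.
    rewrite -(idem_mulVC s ee).
    have -> : s * (h * (s^* * e * s * s^*)) = s * (h * (s^* * e * s)) * s^*.
      by rewrite !mulgA.
    by rewrite hle.
  + by move=> k0; apply: hn0; rewrite -shs k0 muls0 mul0s.
  exists (s^* * z * s); first by exists z.
  have [zz _] := Zle _ Zz.
  move=> hz0; apply: kz.
  have -> : s * h * s^* * z = s * (h * (s^* * z)) by rewrite !mulgA.
  rewrite -(idem_mulVC s zz).
  have -> : s * (h * (s^* * z * s * s^*)) = s * (h * (s^* * z * s)) * s^*.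
    by rewrite !mulgA.
  by rewrite hz0 muls0 mul0s.
have [_ [[z Zz <-] xz]] := tight_tight xe cov.
by exists z; split=> //; split=> //; have [] := Zle _ Zz.
Qed.

Definition act s x (xs : tight_dom (s^* * s) x) : tight_space S :=
  exist _ (act_set s (set_val x))
    (mem_set (conj (act_filter xs) (act_tight xs))).

Lemma tight_space_inj x y : set_val x = set_val y -> x = y.
Proof. exact: val_inj. Qed.

Lemma actP s x (xs : tight_dom (s^* * s) x) f :
  set_val (act xs) f <-> idem f /\ set_val x (s^* * f * s).
Proof. by []. Qed.

End InverseSemigroupTheory.

Section Germs.
Variable S : inverseSemigroupType.
Implicit Types (s t e f : S) (x : tight_space S).

Record pregerm := Pregerm {
  pg_elt : S;
  pg_pt : tight_space S;
  pg_dom : tight_dom (pg_elt^* * pg_elt) pg_pt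
}.

HB.instance Definition _ := gen_eqMixin pregerm.
HB.instance Definition _ := gen_choiceMixin pregerm.

Definition germ_eq (a b : pregerm) : Prop :=
  pg_pt a = pg_pt b /\
  exists f, [/\ idem f, set_val (pg_pt a) f & pg_elt a * f = pg_elt b * f].

Definition germ_eqb : rel pregerm := fun a b => `[< germ_eq a b >].

Lemma germ_eqb_refl : reflexive germ_eqb.
Proof.
move=> [s x xs]; apply/asboolP; split=> //=; exists (s^* * s); split=> //.
exact: idemVs.
Qed.

Lemma germ_eqb_sym : symmetric germ_eqb.
Proof.
by move=> a b; apply/asboolP/asboolP => -[ab [f [ff fx e]]]; split;
  rewrite // -?ab; exists f.
Qed.

Lemma germ_eqb_trans : transitive germ_eqb.
Proof.
move=> b a c /asboolP[ab [f [ff fx e]]] /asboolP[bc [g [gg gx e']]].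
apply/asboolP; split; first by rewrite ab.
exists (f * g); split; [exact: idemM|by apply: tightM => //; rewrite ab|].
by rewrite mulgA e -mulgA (idemC ff gg) mulgA e' -!mulgA.
Qed.

Canonical germ_equiv :=
  EquivRel germ_eqb germ_eqb_refl germ_eqb_sym germ_eqb_trans.

Definition germ : Type := {eq_quot germ_equiv}.

HB.instance Definition _ := Choice.on germ.
HB.instance Definition _ := EqQuotient.on germ.

(* The germ [s, x] *)
Definition mkgerm s x (xs : tight_dom (s^* * s) x) : germ :=
  \pi_germ (Pregerm xs).

(* Theta(s, U) *)
Definition germ_set s (U : set (tight_space S)) : set germ :=
  [set g | exists x (xs : tight_dom (s^* * s) x), U x /\ g = mkgerm xs].

Definition germ_subbase : set (set germ) :=
  [set W | exists s (U : set (tight_space S)),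
    [/\ open U, U `<=` tight_dom (s^* * s) & W = germ_set s U]].

HB.instance Definition _ := isSubBaseTopological.Build germ germ_subbase id.

End Germs.

(* The record imposes no continuity: see [topological_groupoid]. *)
Record groupoid := Groupoid {
  gunit : topologicalType;
  garrow : topologicalType;
  gsrc : garrow -> gunit;
  grng : garrow -> gunit;
  gid : gunit -> garrow;
  gmul : forall g h : garrow, gsrc g = grng h -> garrow;
  ginv : garrow -> garrow;
  gsrc_id : forall x, gsrc (gid x) = x;
  grng_id : forall x, grng (gid x) = x;
  gsrc_mul : forall g h (c : gsrc g = grng h), gsrc (gmul c) = gsrc h;
  grng_mul : forall g h (c : gsrc g = grng h), grng (gmul c) = grng g;
  gmulA : forall g h k (c1 : gsrc g = grng h) (c2 : gsrc h = grng k)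
    (c3 : gsrc g = grng (gmul c2)) (c4 : gsrc (gmul c1) = grng k),
    gmul c3 = gmul c4;
  gmulg1 : forall g (c : gsrc g = grng (gid (gsrc g))), gmul c = g;
  gmul1g : forall g (c : gsrc (gid (grng g)) = grng g), gmul c = g;
  gsrc_inv : forall g, gsrc (ginv g) = grng g;
  grng_inv : forall g, grng (ginv g) = gsrc g;
  gmulgV : forall g (c : gsrc g = grng (ginv g)), gmul c = gid (grng g);
  gmulVg : forall g (c : gsrc (ginv g) = grng g), gmul c = gid (gsrc g)
}.

Section TightGroupoid.
Variable S : inverseSemigroupType.
Implicit Types (s t e f : S) (x y : tight_space S) (g h k : germ S).

Lemma mkgerm_eq s x (xs : tight_dom (s^* * s) x)
    t y (yt : tight_dom (t^* * t) y) :
  mkgerm xs = mkgerm yt <->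
  x = y /\ exists f, [/\ idem f, set_val x f & s * f = t * f].
Proof.
rewrite /mkgerm; split=> [/eqP|xy].
  by rewrite piE => /asboolP.
by apply/eqP; rewrite piE; apply/asboolP.
Qed.

Lemma germ_repr g : mkgerm (pg_dom (repr g)) = g.
Proof. by rewrite -[RHS]reprK /mkgerm; case: (repr g). Qed.

Definition germ_src g : tight_space S := pg_pt (repr g).

Definition germ_rng g : tight_space S := act (pg_dom (repr g)).

Lemma germ_srcE s x (xs : tight_dom (s^* * s) x) : germ_src (mkgerm xs) = x.
Proof. by have /mkgerm_eq[] := germ_repr (mkgerm xs). Qed.

Lemma act_eq s t x f :
  idem f -> set_val x f -> s * f = t * f ->
  act_set s (set_val x) `<=` act_set t (set_val x).
Proof.
move=> ff xf e h [hh xh]; split=> //.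
apply: (tightS (tightM (tightM xf xh) xf)); first exact: idem_conj.
have -> : f * (s^* * h * s) * f = (f * s^*) * h * (s * f) by rewrite !mulgA.
have fs : f * s^* = f * t^* by rewrite -(idem_star ff) -!starM e.
rewrite fs e.
have hc := idem_conj t hh; set c := t^* * h * t in hc.
have -> : f * t^* * h * (t * f) = f * (c * f) by rewrite /c !mulgA.
move: hc; rewrite {}/c; move: (t^* * h * t) => c hc.
by rewrite -!mulgA (idemC ff hc) [c * (c * f)]mulgA hc.
Qed.

Lemma germ_rngE s x (xs : tight_dom (s^* * s) x) :
  germ_rng (mkgerm xs) = act xs.
Proof.
rewrite /germ_rng; case: (repr _) (germ_repr (mkgerm xs)) => t y yt /=.
case/mkgerm_eq => yx [f [ff xf e]]; subst y.
by apply: tight_space_inj; apply/seteqP; split;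
  [exact: act_eq ff xf e|exact: (act_eq ff xf (esym e))].
Qed.

Lemma germ_mul_dom s t x (xt : tight_dom (t^* * t) x) :
  tight_dom (s^* * s) (act xt) -> tight_dom ((s * t)^* * (s * t)) x.
Proof. by case=> _; rewrite /tight_dom /= starM !mulgA. Qed.

Lemma germ_mul_proof g h (c : germ_src g = germ_rng h) :
  tight_dom (((pg_elt (repr g)) * pg_elt (repr h))^*
             * (pg_elt (repr g) * pg_elt (repr h))) (pg_pt (repr h)).
Proof.
apply: (germ_mul_dom (xt := pg_dom (repr h))).
by rewrite -[act _]c; exact: pg_dom.
Qed.

Definition germ_mul g h (c : germ_src g = germ_rng h) : germ S :=
  mkgerm (germ_mul_proof c).

(* [s, alpha_t(x)] [t, x] = [st, x] *)
Lemma germ_mulE s t x (xt : tight_dom (t^* * t) x)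
    (xs : tight_dom (s^* * s) (act xt))
    (c : germ_src (mkgerm xs) = germ_rng (mkgerm xt)) :
  germ_mul c = mkgerm (germ_mul_dom xs).
Proof.
apply/mkgerm_eq; move: (germ_mul_proof c) => _.
case: (repr _) (germ_repr (mkgerm xs)) => s' y ys /=.
case/mkgerm_eq => -> [f [ff [_ xf] es]].
case: (repr _) (germ_repr (mkgerm xt)) => t' z zt /=.
case/mkgerm_eq => zx [h [hh zh et]]; split=> //.
have cc := idem_conj t ff.
have key r : r * t * (h * (t^* * f * t)) = r * f * t * h.
  have -> : r * t * (h * (t^* * f * t)) = r * (t * (h * (t^* * f * t))).
    by rewrite !mulgA.
  by rewrite (idemC hh cc) [t * _]mulgA idem_mulsC // !mulgA.
exists (h * (t^* * f * t)); split; first exact: idemM.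
  by apply: tightM => //; rewrite zx.
rewrite key -es -[RHS]key.
have -> : s' * t' * (h * (t^* * f * t)) = s' * (t' * h) * (t^* * f * t).
  by rewrite !mulgA.
by rewrite et !mulgA.
Qed.

(* The unit at x is the germ [e, x] of any idempotent e in x. *)
Definition tight_elt x : S :=
  let: And5 _ xn0 _ _ _ := tight_filter x in sval (cid xn0).

Lemma tight_eltP x : set_val x (tight_elt x).
Proof. by rewrite /tight_elt; case: tight_filter => ? xn0 *; case: cid. Qed.

Lemma idem_dom e x : set_val x e -> tight_dom (e^* * e) x.
Proof.
move=> xe; have ee := tight_idem xe.
by rewrite /tight_dom /= (idem_star ee) ee.
Qed.

Definition germ_id x : germ S := mkgerm (idem_dom (tight_eltP x)).

Lemma germ_idE e x (xe : set_val x e) : germ_id x = mkgerm (idem_dom xe).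
Proof.
have xe' := tight_eltP x.
have ee := tight_idem xe; have ee' := tight_idem xe'.
apply/mkgerm_eq; split=> //; exists (e * tight_elt x).
split; [exact: idemM|exact: tightM|].
by rewrite (idemC ee ee') mulgA ee' -(idemC ee ee') mulgA ee.
Qed.

Lemma germ_inv_dom s x (xs : tight_dom (s^* * s) x) :
  tight_dom ((s^*)^* * s^*) (act xs).
Proof.
rewrite /tight_dom /= starK; apply/actP; split; first exact: idemsV.
by rewrite !mulgA mulVsV.
Qed.

Definition germ_inv g : germ S := mkgerm (germ_inv_dom (pg_dom (repr g))).

(* [s, x]^-1 = [s^*, alpha_s(x)] *)
Lemma germ_invE s x (xs : tight_dom (s^* * s) x) :
  germ_inv (mkgerm xs) = mkgerm (germ_inv_dom xs).
Proof.
apply/mkgerm_eq; split; first exact: germ_rngE.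
case: (repr _) (germ_repr (mkgerm xs)) => t y yt /=.
case/mkgerm_eq => yx [f [ff yf e]].
have fs : f * s^* = f * t^* by rewrite -(idem_star ff) -!starM e.
exists (t * f * t^*); split; first exact: idem_conjV.
  apply/actP; split; first exact: idem_conjV.
  have -> : t^* * (t * f * t^*) * t = (t^* * t) * f * (t^* * t).
    by rewrite !mulgA.
  by apply: tightM => //; apply: tightM.
have vs r : r^* * (r * f * r^*) = f * r^*.
  have -> : r^* * (r * f * r^*) = (r^* * r) * f * r^* by rewrite !mulgA.
  by rewrite (idemC (idemVs r) ff) -mulgA mulVsV.
by rewrite vs e -(mulgA s) -fs (mulgA s) vs.
Qed.

Lemma germP g : exists s x (xs : tight_dom (s^* * s) x), g = mkgerm xs.
Proof.
by exists (pg_elt (repr g)), (pg_pt (repr g)), (pg_dom _); rewrite germ_repr.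
Qed.

Lemma germ_composable g h : germ_src g = germ_rng h ->
  exists s t x (xt : tight_dom (t^* * t) x) (xs : tight_dom (s^* * s) (act xt)),
    g = mkgerm xs /\ h = mkgerm xt.
Proof.
have [s [y [ys ->]]] := germP g; have [t [x [xt ->]]] := germP h.
rewrite germ_srcE germ_rngE => yx; subst y.
by exists s, t, x, xt, ys.
Qed.

Lemma germ_mul_irr g g' h h' (c : germ_src g = germ_rng h)
  (c' : germ_src g' = germ_rng h') :
  g = g' -> h = h' -> germ_mul c = germ_mul c'.
Proof. by move=> eg eh; subst g' h'; rewrite (Prop_irrelevance c c'). Qed.

Lemma germ_src_id x : germ_src (germ_id x) = x.
Proof. exact: germ_srcE. Qed.

Lemma act_idem e x (xe : tight_dom (e^* * e) x) : idem e -> act xe = x.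
Proof.
move=> ee; have xe' : set_val x e.
  by move: xe; rewrite /tight_dom /= (idem_star ee) ee.
apply: tight_space_inj; apply/seteqP; split=> f /=.
  case=> ff; rewrite (idem_star ee) => xf.
  apply: (tightS xf) => //.
  by rewrite -!mulgA (idemC ee ff) [f * (f * e)]mulgA ff.
move=> xf; have ff := tight_idem xf; split=> //; rewrite (idem_star ee).
by apply: tightM => //; apply: tightM.
Qed.

Lemma germ_rng_id x : germ_rng (germ_id x) = x.
Proof. by rewrite germ_rngE act_idem //; exact/tight_idem/tight_eltP. Qed.

Lemma germ_src_mul g h (c : germ_src g = germ_rng h) :
  germ_src (germ_mul c) = germ_src h.
Proof. exact: germ_srcE. Qed.

Lemma act_mul s t x (xt : tight_dom (t^* * t) x)
    (xs : tight_dom (s^* * s) (act xt)) :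
  act (germ_mul_dom xs) = act xs.
Proof.
apply: tight_space_inj; apply/seteqP; split=> f /=.
  case=> ff; rewrite starM !mulgA => xf; split=> //; split.
    exact: idem_conj.
  by rewrite !mulgA.
case=> ff [_]; rewrite !mulgA => xf; split=> //.
by rewrite starM !mulgA.
Qed.

Lemma germ_rng_mul g h (c : germ_src g = germ_rng h) :
  germ_rng (germ_mul c) = germ_rng g.
Proof.
have [s [t [x [xt [xs [eg eh]]]]]] := germ_composable c.
by subst g h; rewrite germ_mulE !germ_rngE act_mul.
Qed.

Lemma mkgerm_eqs s s' x (xs : tight_dom (s^* * s) x)
    (xs' : tight_dom (s'^* * s') x) : s = s' -> mkgerm xs = mkgerm xs'.
Proof. by move=> e; subst s'; rewrite (Prop_irrelevance xs xs'). Qed.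

Lemma mkgerm_eqp s x s' x' (xs : tight_dom (s^* * s) x)
    (xs' : tight_dom (s'^* * s') x') :
  s = s' -> x = x' -> mkgerm xs = mkgerm xs'.
Proof. by move=> e ex; subst s' x'; rewrite (Prop_irrelevance xs xs'). Qed.

Lemma germ_mulA g h k
    (c1 : germ_src g = germ_rng h) (c2 : germ_src h = germ_rng k)
    (c3 : germ_src g = germ_rng (germ_mul c2))
    (c4 : germ_src (germ_mul c1) = germ_rng k) :
  germ_mul c3 = germ_mul c4.
Proof.
have [t [u [x [xu [xt [eh ek]]]]]] := germ_composable c2.
subst h k; have [s [y [xs eg]]] := germP g; subst g.
have yt := c1; rewrite germ_srcE germ_rngE in yt; subst y.
have xs' : tight_dom (s^* * s) (act (germ_mul_dom xt)) by rewrite act_mul.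
have c3' : germ_src (mkgerm xs') = germ_rng (mkgerm (germ_mul_dom xt)).
  by rewrite germ_srcE germ_rngE.
have -> : germ_mul c3 = germ_mul c3'.
  apply: germ_mul_irr; last exact: germ_mulE.
  by apply: mkgerm_eqp => //; rewrite act_mul.
have c4' : germ_src (mkgerm (germ_mul_dom xs)) = germ_rng (mkgerm xu).
  by rewrite germ_srcE germ_rngE.
have -> : germ_mul c4 = germ_mul c4'.
  by apply: germ_mul_irr => //; exact: germ_mulE.
by rewrite !germ_mulE; apply: mkgerm_eqs; rewrite mulgA.
Qed.

Lemma germ_mul1 g (c : germ_src g = germ_rng (germ_id (germ_src g))) :
  germ_mul c = g.
Proof.
have [s [x [xs eg]]] := germP g; subst g.
have xe : set_val x (s^* * s) by [].
have xs' : tight_dom (s^* * s) (act (idem_dom xe)).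
  by rewrite act_idem //; exact: idemVs.
have c' : germ_src (mkgerm xs') = germ_rng (mkgerm (idem_dom xe)).
  by rewrite germ_srcE germ_rngE.
have -> : germ_mul c = germ_mul c'.
  apply: germ_mul_irr; last by rewrite germ_srcE; exact: germ_idE.
  by apply: mkgerm_eqp => //; rewrite act_idem //; exact: idemVs.
by rewrite germ_mulE; apply: mkgerm_eqs; rewrite mulgA mulsVs.
Qed.

Lemma germ_1mul g (c : germ_src (germ_id (germ_rng g)) = germ_rng g) :
  germ_mul c = g.
Proof.
have [s [x [xs eg]]] := germP g; subst g.
have xe : set_val (act xs) (s * s^*).
  by apply/actP; split; [exact: idemsV|rewrite !mulgA mulVsV].
have c' : germ_src (mkgerm (idem_dom xe)) = germ_rng (mkgerm xs).
  by rewrite germ_srcE germ_rngE.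
have -> : germ_mul c = germ_mul c'.
  by apply: germ_mul_irr => //; rewrite germ_rngE; exact: germ_idE.
by rewrite germ_mulE; apply: mkgerm_eqs; rewrite mulsVs.
Qed.

Lemma germ_src_inv g : germ_src (germ_inv g) = germ_rng g.
Proof. exact: germ_srcE. Qed.

Lemma act_inv s x (xs : tight_dom (s^* * s) x) : act (germ_inv_dom xs) = x.
Proof.
apply: tight_space_inj; apply/seteqP; split=> f /=.
  case=> ff [_]; rewrite starK => xf; apply: (tightS xf) => //.
  have -> : s^* * (s * f * s^*) * s * f = (s^* * s) * f * ((s^* * s) * f).
    by rewrite !mulgA.
  have -> : s^* * (s * f * s^*) * s = (s^* * s) * f * (s^* * s).
    by rewrite !mulgA.
  have := idemVs s; move: (s^* * s) => d dd.
  by rewrite -!mulgA (idemC dd ff) [f * (f * d)]mulgA ff.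
move=> xf; have ff := tight_idem xf; split=> //; split.
  by rewrite starK; exact: idem_conjV.
rewrite starK.
have -> : s^* * (s * f * s^*) * s = (s^* * s) * f * (s^* * s).
  by rewrite !mulgA.
by apply: tightM => //; apply: tightM.
Qed.

Lemma germ_rng_inv g : germ_rng (germ_inv g) = germ_src g.
Proof. by rewrite germ_rngE act_inv. Qed.

Lemma germ_mulV g (c : germ_src g = germ_rng (germ_inv g)) :
  germ_mul c = germ_id (germ_rng g).
Proof.
have [s [x [xs eg]]] := germP g; subst g.
have xs' : tight_dom (s^* * s) (act (germ_inv_dom xs)) by rewrite act_inv.
have c' : germ_src (mkgerm xs') = germ_rng (mkgerm (germ_inv_dom xs)).
  by rewrite germ_srcE germ_rngE.
have -> : germ_mul c = germ_mul c'.
  apply: germ_mul_irr; last exact: germ_invE.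
  by apply: mkgerm_eqp => //; rewrite act_inv.
have xe : set_val (act xs) (s * s^*).
  by apply/actP; split; [exact: idemsV|rewrite !mulgA mulVsV].
by rewrite germ_mulE germ_rngE (germ_idE xe); exact: mkgerm_eqs.
Qed.

Lemma germ_Vmul g (c : germ_src (germ_inv g) = germ_rng g) :
  germ_mul c = germ_id (germ_src g).
Proof.
have [s [x [xs eg]]] := germP g; subst g.
have c' : germ_src (mkgerm (germ_inv_dom xs)) = germ_rng (mkgerm xs).
  by rewrite germ_srcE germ_rngE.
have -> : germ_mul c = germ_mul c'.
  by apply: germ_mul_irr => //; exact: germ_invE.
have xe : set_val x (s^* * s) by [].
by rewrite germ_mulE germ_srcE (germ_idE xe); exact: mkgerm_eqs.
Qed.

Definition Gtight : groupoid := Groupoid germ_src_id germ_rng_id germ_src_mul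
  germ_rng_mul germ_mulA germ_mul1 germ_1mul germ_src_inv germ_rng_inv
  germ_mulV germ_Vmul.

End TightGroupoid.

Section AmpleGroupoids.
Variable G : groupoid.

Definition composable : set (garrow G * garrow G) :=
  [set z | gsrc z.1 = grng z.2].

Definition gmul_pair (z : composable) : garrow G :=
  gmul (set_mem (valP z) : gsrc (val z).1 = grng (val z).2).

Definition topological_groupoid : Prop :=
  [/\ continuous (@gsrc G), continuous (@grng G), continuous (@gid G),
      continuous (@ginv G) & continuous gmul_pair].

Definition local_homeomorphism (X Y : topologicalType) (f : X -> Y) : Prop :=
  forall x, exists U : set X,
    [/\ open U, U x, set_inj U f, {in U, continuous f}
      & forall V, open V -> V `<=` U -> open (f @` V)].

Definition etale : Prop :=
  topological_groupoid /\ local_homeomorphism (@gsrc G).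

Definition compact_open (X : topologicalType) (A : set X) : Prop :=
  compact A /\ open A.

Definition compact_open_bisection (W : set (garrow G)) : Prop :=
  [/\ compact_open W, set_inj W (@gsrc G) & set_inj W (@grng G)].

(* Ample, with locally compact Hausdorff unit space; the arrow space is not
   required to be Hausdorff. *)
Definition ample : Prop :=
  [/\ etale, hausdorff_space (gunit G), locally_compact [set: gunit G]
    & forall (g : garrow G) (U : set (garrow G)), open U -> U g ->
        exists W, [/\ compact_open_bisection W, W g & W `<=` U]].

Definition ample_hausdorff : Prop := ample /\ hausdorff_space (garrow G).

End AmpleGroupoids.

Section TypeSemigroup.
Variable G : groupoid.

Definition cosets_unit : Type :=
  set_type [set A : set (gunit G) | compact_open A].

HB.instance Definition _ := Choice.on cosets_unit.

Local Notation cpt := cosets_unit.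
Implicit Types (A B C : cpt) (a b : seq cpt).

(* The sequence [:: A1; ...; An] stands for [A1] + ... + [An]. *)
Inductive typ_rel : seq cpt -> seq cpt -> Prop :=
| typ_refl a : typ_rel a a
| typ_sym a b : typ_rel a b -> typ_rel b a
| typ_trans a b c : typ_rel a b -> typ_rel b c -> typ_rel a c
| typ_cat a a' b b' :
    typ_rel a a' -> typ_rel b b' -> typ_rel (a ++ b) (a' ++ b')
| typ_comm a b : typ_rel (a ++ b) (b ++ a)
| typ_empty A : set_val A = set0 -> typ_rel [:: A] [::]
| typ_bisection (W : set (garrow G)) A B : compact_open_bisection W ->
    set_val A = @gsrc G @` W -> set_val B = @grng G @` W ->
    typ_rel [:: A] [:: B]
| typ_disjoint A B C : set_val A `&` set_val B = set0 ->
    set_val C = set_val A `|` set_val B -> typ_rel [:: C] [:: A; B].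

Definition typ_relb : rel (seq cpt) := fun a b => `[< typ_rel a b >].

Lemma typ_relb_refl : reflexive typ_relb.
Proof. by move=> x; apply/asboolP; exact: typ_refl. Qed.

Lemma typ_relb_sym : symmetric typ_relb.
Proof. by move=> x y; apply/asboolP/asboolP => /typ_sym. Qed.

Lemma typ_relb_trans : transitive typ_relb.
Proof.
by move=> y x z /asboolP xy /asboolP yz; apply/asboolP; exact: typ_trans yz.
Qed.

Canonical typ_equiv :=
  EquivRel typ_relb typ_relb_refl typ_relb_sym typ_relb_trans.

Definition Typ : Type := {eq_quot typ_equiv}.

HB.instance Definition _ := Choice.on Typ.
HB.instance Definition _ := EqQuotient.on Typ.

Lemma Typ_eq (a b : seq cpt) : typ_rel a b <-> \pi_Typ a = \pi_Typ b.
Proof.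
split=> [ab|/eqP]; first by apply/eqP; rewrite piE; apply/asboolP.
by rewrite piE => /asboolP.
Qed.

Definition Typ_add (x y : Typ) : Typ := \pi_Typ (repr x ++ repr y).
Definition Typ_zero : Typ := \pi_Typ [::].

Lemma Typ_addE a b : Typ_add (\pi_Typ a) (\pi_Typ b) = \pi_Typ (a ++ b).
Proof. by apply/Typ_eq/typ_cat; apply/Typ_eq; rewrite reprK. Qed.

Lemma Typ_addA : associative Typ_add.
Proof.
elim/quotW=> a; elim/quotW=> b; elim/quotW=> c.
by rewrite (Typ_addE b) (Typ_addE a b) (Typ_addE a) Typ_addE catA.
Qed.

Lemma Typ_addC : commutative Typ_add.
Proof.
by elim/quotW=> a; elim/quotW=> b; rewrite !Typ_addE; exact/Typ_eq/typ_comm.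
Qed.

Lemma Typ_add0 : left_id Typ_zero Typ_add.
Proof. by elim/quotW=> a; rewrite Typ_addE. Qed.

HB.instance Definition _ :=
  GRing.isNmodule.Build Typ Typ_addA Typ_addC Typ_add0.

End TypeSemigroup.

(* Main.v *)
(* Elements of M are sums of primes, and up to mutual divisibility there are
   finitely many of these.  A prime p is free when 2p does not divide p; the
   elements equivalent to a regular prime form a group.  One vertex per free
   prime and countably many vertices per regular one present M: at a free p the
   relations [p = p + x] run over generators [x] of the submonoid absorbed by p
   (finitely generated by Dickson's lemma), at a regular vertex v a relation
   [v = v + x] adds a list whose sum [x] the group absorbs.  By refinement these
   relations imply all others.  Each relation is one set of the separation.

   In S(E,C) the product [x^* y] of two paths is zero or given by their least
   common right multiple, so every element is [x y^*] with [x], [y] paths in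
   the edges and t's; hence the inverse law.  Acting on normal forms of paths
   shows that vertices are nonzero and that paths are right cancellative, hence
   S(E,C) is E*-unitary and its tight groupoid is Hausdorff.

   A nonzero idempotent is equivalent to exactly one vertex v; give its cylinder
   the weight val v in M.  In a partition of the cylinder of v into smaller
   ones, some set X of the separation at v is such that every part lies in the
   cylinder of an edge of X: at a free vertex the paths without beta-edge
   pairwise meet, and any other path lies below an edge of each X.  By
   induction on the number of parts the weight is additive, so it defines a
   homomorphism from the type semigroup to M; its inverse exists because the
   classes of the vertices satisfy the relations that present M. *)

Require Import Defs.
From HB Require Import structures.
From mathcomp Require Import finmap.
From mathcomp Require Import all_boot all_order all_algebra zify.
From mathcomp Require Import all_classical.
From mathcomp Require Import topology_structure separation_axioms compact.
From mathcomp Require Import discrete_topology bool_topology product_topology.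
From mathcomp Require Import initial_topology.
From mathcomp Require Import supremum_topology subspace_topology.
From mathcomp Require Import subtype_topology function_spaces.

Set Implicit Arguments.
Unset Strict Implicit.
Unset Printing Implicit Defensive.

Import GRing.Theory.
Local Open Scope classical_set_scope.

(** * Finitely generated refinement monoids as graph monoids *)

(** A regular vertex carries one set of the separation, hence one relation, while the group at a
    regular prime may need many. Adaptability bounds the number of components, not of vertices, so a
    regular class gets enough vertices to list all its relations. Every element of the group is the
    value of a vertex, so inverses are available without a presentation of the group. The presented
    monoid is never built; what is used of it is that maps on vertices satisfying the relations
    factor through M.

    A presentation of S(E,C) proves equations but no inequation. That vertices are nonzero, that
    words acting alike are equal and that the vertex of an idempotent is unique all come from the
    action on normal forms. The tight filters are not described explicitly either: disjoint unions
    of cylinders are recorded by counting functions of finite lists of idempotents. This is possible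
    because the complement of one cylinder in another is a finite disjoint union of cylinders, which
    fails in general inverse semigroups; it yields common refinements and a basis of cylinders. *)

Lemma dickson (n : nat) (A : set (nat -> nat)) :
  exists B : set (nat -> nat), [/\ finite_set B, B `<=` A
    & forall a, A a -> exists2 b, B b & forall i, (i < n)%N -> (b i <= a i)%N].
Proof.
elim: n A => [|n IH] A.
  have [[a Aa]|A0] := pselect (exists a, A a).
    by exists [set a]; split=> [|_ -> //|a' _]; [exact: finite_set1|exists a].
  by exists set0; split=> // a Aa; case: A0; exists a.
have [B0 [finB0 B0A B0P]] := IH A.
(* [B0] ignores the last coordinate. It serves the vectors with [a n] at least [N]; the others lie
   in finitely many slices [Am m], and the induction hypothesis applies to each slice. *)
have [N NP] : exists N, forall b, B0 b -> (b n <= N)%N.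
  have /finite_seqP[s sE] := finite_image (fun b => b n) finB0.
  exists (\max_(m <- s) m) => b Bb.
  have : [set` s] (b n) by rewrite -sE; exists b.
  by move=> /= bs; apply: (@leq_bigmax_seq _ s xpredT id).
pose Am m := [set a | A a /\ a n = m].
have [Bm BmP] := choice (fun m => IH (Am m)).
exists (B0 `|` \bigcup_(m in [set m | (m <= N)%N]) Bm m); split.
- rewrite finite_setU; split=> //; apply: bigcup_finite => [|m _].
    by apply: (sub_finite_set _ (finite_II N.+1)) => m /=.
  by have [] := BmP m.
- move=> b [/B0A//|[m _ Bb]]; have [_ /(_ _ Bb)[] //] := BmP m.
move=> a Aa; have [Na|aN] := leqP N (a n).
  have [b Bb ba] := B0P _ Aa; exists b; first by left.
  move=> i; rewrite ltnS leq_eqVlt => /orP[/eqP->|/ba//].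
  by apply: leq_trans Na; exact: NP.
have [_ BA /(_ a)[//|b Bb ba]] := BmP (a n).
have [_ bn] := BA _ Bb.
exists b; first by right; exists (a n) => //=; exact: ltnW.
by move=> i; rewrite ltnS leq_eqVlt => /orP[/eqP->|/ba//]; rewrite bn.
Qed.

Local Open Scope ring_scope.

(** Interface between the monoid and the graph: an entry [X] of [grels v] is at once the relation
    that makes [v] the sum of [X] and the list of ranges of the edges in one set of the separation
    at [v]. The axioms are those of adaptability, with [gcls] as the component. *)
Record graphData := GraphData {
  gvert : choiceType;
  gfree : pred gvert;
  grels : gvert -> seq (seq gvert);
  gncls : nat;
  gcls : gvert -> 'I_gncls;
  glt : rel 'I_gncls;
  glt_irr : irreflexive glt;
  glt_trans : transitive glt;
  gfree_cls : forall v w, gcls v = gcls w -> gfree v = gfree w;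
  gfree_uniq : forall v w, gfree v -> gcls w = gcls v -> w = v;
  gfree_rel : forall v X, gfree v -> X \in grels v -> exists b,
    [/\ X = v :: b, b != [::] & forall w, w \in b -> glt (gcls w) (gcls v)];
  greg_rel : forall v, ~~ gfree v -> exists w X,
    [/\ grels v = [:: [:: v, w & X]], gcls w = gcls v
      & forall u, u \in X -> gcls u = gcls v \/ glt (gcls u) (gcls v)];
  greg_path : forall v w, ~~ gfree v -> gcls w = gcls v ->
    exists2 s, path (fun x y => (y \in flatten (grels x)) && (gcls y == gcls x)) v s
      & last v s = w
}.

(** Such a [c] amounts to a homomorphism to [T] from the monoid presented by [grels]. *)
Definition grels_sat (D : graphData) (T : nmodType) (c : gvert D -> T) :=
  forall v X, X \in grels v -> c v = \sum_(w <- X) c w.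

(** * The divisibility preorder and its primes *)

Section RefinementMonoid.
Variable M : nmodType.
Hypotheses (conicalM : monoid_conical M) (refM : monoid_refinement M).
Implicit Types x y z p q : M.

Definition mle x y := exists z, y = x + z.
Definition mlt x y := mle x y /\ ~ mle y x.
Definition meq x y := mle x y /\ mle y x.
Definition mprime p := p <> 0 /\
  forall a b, mle p (a + b) -> mle p a \/ mle p b.

Lemma mlexx x : mle x x. Proof. by exists 0; rewrite addr0. Qed.

Lemma mle_trans y x z : mle x y -> mle y z -> mle x z.
Proof. by move=> [a ->] [b ->]; exists (a + b); rewrite addrA. Qed.

Lemma mle_addr x y : mle x (x + y). Proof. by exists y. Qed.

Lemma mle_addl x y : mle x (y + x). Proof. by exists y; rewrite addrC. Qed.

Lemma mleD x y z t : mle x y -> mle z t -> mle (x + z) (y + t).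
Proof. by move=> [a ->] [b ->]; exists (a + b); rewrite addrACA. Qed.

Lemma mle_lt_trans y x z : mle x y -> mlt y z -> mlt x z.
Proof.
move=> xy [yz zy]; split; first exact: mle_trans yz.
by move=> zx; apply: zy; exact: mle_trans xy.
Qed.

Lemma mle0 x : mle x 0 -> x = 0.
Proof. by case=> z /esym/conicalM[]. Qed.

Lemma mle_add_split p a b : mle p (a + b) ->
  exists u v, [/\ p = u + v, mle u a & mle v b].
Proof.
case=> z /refM[w [x [y [t [-> -> -> _]]]]].
by exists w, y; split=> //; exact: mle_addr.
Qed.

Lemma mle_sum (l : seq M) p : p \in l -> mle p (\sum_(x <- l) x).
Proof.
elim: l => // a l IH; rewrite inE big_cons => /orP[/eqP->|/IH pl].
  exact: mle_addr.
by apply: mle_trans pl _; exact: mle_addl.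
Qed.

Lemma mprime_sum (I : eqType) (f : I -> M) (l : seq I) p : mprime p ->
  mle p (\sum_(i <- l) f i) -> exists2 i, i \in l & mle p (f i).
Proof.
move=> [p0 pp]; elim: l => [|a l IH].
  by rewrite big_nil => /mle0.
rewrite big_cons => /pp[pa|/IH[i il pi]].
  by exists a; rewrite ?mem_head.
by exists i; rewrite // inE il orbT.
Qed.

Section Generated.
Variables (n : nat) (g : 'I_n -> M).
Hypothesis gen : forall x, exists c : 'I_n -> nat, x = \sum_(i < n) g i *+ c i.

Definition mcomb (c : nat -> nat) : M := \sum_(i < n) g i *+ c i.

Lemma mcomb_surj x : exists c, x = mcomb c.
Proof.
have [c ->] := gen x.
exists (fun j => if insub j is Some i then c i else 0%N).
by apply: eq_bigr => i _; rewrite valK.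
Qed.

Lemma mcombB b c : (forall i, (i < n)%N -> (b i <= c i)%N) ->
  mcomb c = mcomb b + mcomb (fun i => c i - b i)%N.
Proof.
move=> bc; rewrite /mcomb -big_split; apply: eq_bigr => i _ /=.
by rewrite -mulrnDr subnKC // bc.
Qed.

(* Dickson's lemma, applied to coefficient vectors. *)
Lemma mlt_wf : well_founded mlt.
Proof.
apply: contrapT => nwf.
have [x0 nx0] : exists x, ~ Acc mlt x by apply/existsNP.
have [B [/finite_seqP[s ->] BA BP]] := dickson n [set c | ~ Acc mlt (mcomb c)].
(* Let [y] be inaccessible with no combination from [s] strictly below it. An inaccessible [z] below
   [y] would have coefficients above those of some member of [s], a contradiction. Such a [y] is
   found by running through [s] and replacing [y] by each member strictly below it. *)
suff: forall s' : seq (nat -> nat), {subset s' <= s} -> exists2 y,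
    ~ Acc mlt y & forall c, c \in s' -> ~ mlt (mcomb c) y.
  move=> /(_ s (fun _ => id))[y ny yP]; apply: ny; constructor=> z zy.
  apply: contrapT => nz; have [c zE] := mcomb_surj z; subst z.
  have [b bs /mcombB cE] := BP _ nz; apply: (yP _ bs).
  by apply: mle_lt_trans zy; rewrite cE; exact: mle_addr.
elim=> [_|b s' IH ss]; first by exists x0.
have [|y ny yP] := IH; first by move=> c cs; apply: ss; rewrite inE cs orbT.
have [yb|nyb] := pselect (mlt (mcomb b) y); last first.
  by exists y => // c; rewrite inE => /orP[/eqP->|/yP].
exists (mcomb b); first by apply: BA; apply: ss; rewrite mem_head.
move=> c; rewrite inE => /orP[/eqP-> [_]|/yP yc cb].
  by apply; exact: mlexx.
by apply: yc; apply: mle_lt_trans yb; case: cb.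
Qed.

(** If [x] divides a + b but neither summand, refinement splits it into a divisor of a and a divisor
    of b; neither part is divisible by [x]. *)
Lemma mnonprime x : x <> 0 -> ~ mprime x ->
  exists a b, [/\ x = a + b, mlt a x & mlt b x].
Proof.
move=> x0 npx; apply: contrapT => nex; apply: npx; split=> // a b xab.
have [u [v [xE ua vb]]] := mle_add_split xab.
apply: contrapT => /not_orP[nxa nxb]; apply: nex; exists u, v; split=> //.
  split=> [|xu]; first by rewrite xE; exact: mle_addr.
  by apply: nxa; exact: mle_trans ua.
split=> [|xv]; first by rewrite xE; exact: mle_addl.
by apply: nxb; exact: mle_trans vb.
Qed.

Lemma mprime_gen x :
  exists l : seq M, (forall p, p \in l -> mprime p) /\ x = \sum_(p <- l) p.
Proof.
elim/(well_founded_ind mlt_wf): x => x IH.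
have [->|x0] := pselect (x = 0); first by exists [::]; rewrite big_nil.
have [px|npx] := pselect (mprime x).
  by exists [:: x]; rewrite big_seq1; split=> // p; rewrite inE => /eqP->.
have [a [b [xE /IH[la [pa aE]] /IH[lb [pb bE]]]]] := mnonprime x0 npx.
exists (la ++ lb); rewrite big_cat xE aE bE; split=> // p.
by rewrite mem_cat => /orP[/pa|/pb].
Qed.

(** The prime summands of the generators suffice: a prime p divides some generator occurring in p,
    hence a prime summand q of that generator, and q divides the generator and so p. *)
Lemma mprime_classes : exists ps : seq M, [/\ uniq ps,
  forall p, p \in ps -> mprime p,
  forall p q, p \in ps -> q \in ps -> meq p q -> p = q
  & forall p, mprime p -> exists2 q, q \in ps & meq p q].
Proof.
have [l lP] := choice (fun i => mprime_gen (g i)).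
have [ps0 [pps0 ps0P]] : exists ps : seq M, (forall p, p \in ps -> mprime p) /\
    forall p, mprime p -> exists2 q, q \in ps & meq p q.
  exists (flatten [seq l i | i <- enum 'I_n]); split=> [p|p pp].
    by move=> /flatten_mapP[i _ pl]; have [+ _] := lP i; apply.
  have [c pE] := gen p.
  have: mle p (\sum_(i <- enum 'I_n) g i *+ c i).
    by rewrite big_enum /= {1}pE; exact: mlexx.
  case/(mprime_sum pp) => i iI; case ci: (c i) => [|k].
    by rewrite mulr0n => /mle0 p0; case: pp.
  have: forall m, mle p (g i *+ m) -> mle p (g i).
    elim=> [/mle0 p0|m IH]; first by case: pp.
    by rewrite mulrS; case: pp => _ pp /pp[|/IH].
  move=> /[apply]; have [pl gE] := lP i; rewrite gE.
  case/(mprime_sum pp) => q ql pq; exists q; first by apply/flatten_mapP; exists i.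
  split=> //; rewrite pE (bigD1 i) //= ci mulrS -addrA.
  apply: mle_trans (mle_addr _ _); rewrite gE; exact: mle_sum.
suff [ps [u ps_pr inj psP]] : exists ps : seq M, [/\ uniq ps,
    forall p, p \in ps -> mprime p,
    forall p q, p \in ps -> q \in ps -> meq p q -> p = q
    & forall p, p \in ps0 -> exists2 q, q \in ps & meq p q].
  exists ps; split=> // p /ps0P[q /psP[r rps [qr rq]] [pq qp]].
  by exists r => //; split; [apply: mle_trans qr|apply: mle_trans qp].
elim: ps0 pps0 {ps0P} => [_|p ps0 IH pps0]; first by exists [::]; split.
have [|ps [u pps inj psP]] := IH.
  by move=> q qps; apply: pps0; rewrite inE qps orbT.
have [[q qps pq]|np] := pselect (exists2 q, q \in ps & meq p q).
  exists ps; split=> // r; rewrite inE => /orP[/eqP->|/psP//].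
  by exists q.
exists (p :: ps); split.
- rewrite /= u andbT; apply/negP => pps'; apply: np; exists p => //.
  by split; exact: mlexx.
- move=> q; rewrite inE => /orP[/eqP->|/pps//].
  by apply: pps0; rewrite mem_head.
- move=> q r; rewrite !inE => /orP[/eqP->|qps] /orP[/eqP->|rps] // qr.
  + by case: np; exists r.
  + by case: np; exists q => //; case: qr.
  + exact: inj.
- move=> q; rewrite inE => /orP[/eqP->|/psP[r rps qr]].
    by exists p; rewrite ?mem_head //; split; exact: mlexx.
  by exists r; rewrite // inE rps orbT.
Qed.

End Generated.
End RefinementMonoid.

(** * Vertices and relations attached to the primes *)

Section GraphOfMonoid.
Variable M : nmodType.
Hypotheses (conicalM : monoid_conical M) (refM : monoid_refinement M).
Variables (n : nat) (g : 'I_n -> M).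
Hypothesis gen : forall x, exists c : 'I_n -> nat, x = \sum_(i < n) g i *+ c i.
Variables (r : nat) (pr : 'I_r -> M).
Hypothesis pr_prime : forall i, mprime (pr i).
Hypothesis pr_inj : forall i j, meq (pr i) (pr j) -> i = j.
Hypothesis pr_surj : forall p : M, mprime p -> exists i, meq p (pr i).
Implicit Types (i j : 'I_r) (x y : M).

Local Definition is_free i : bool := `[< ~ mle (pr i + pr i) (pr i) >].

Local Definition cls_lt i j : bool := `[< mle (pr i) (pr j) >] && (i != j).

Local Lemma regP i : ~~ is_free i -> mle (pr i + pr i) (pr i).
Proof. by move=> /asboolPn/contrapT. Qed.

Local Lemma meqD i x y : ~~ is_free i -> meq x (pr i) -> mle y (pr i) -> meq (x + y) (pr i).
Proof.
move=> /regP ii [xi ix] yi; split.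
  by apply: mle_trans ii; exact: mleD.
by apply: mle_trans ix _; exact: mle_addr.
Qed.

(** This makes the class of a regular prime a group: x + y is again in the class, so it divides
    y. *)
Local Lemma meq_diff i x y : ~~ is_free i -> meq x (pr i) -> meq y (pr i) ->
  exists2 z, meq z (pr i) & y = x + z.
Proof.
move=> ri xi yi; have [xyi _] := meqD ri xi yi.1.
have [w yE] : mle (x + y) y by apply: mle_trans xyi yi.2.
exists (y + w); last by rewrite addrA.
split; last by apply: mle_trans yi.2 _; exact: mle_addr.
by apply: mle_trans yi.1; exists x; rewrite {1}yE -addrA addrC.
Qed.

(** For a regular prime this is the neutral element of its group, for a free one the prime itself;
    [null] then has one definition for both kinds. *)
Local Lemma absorber_ex i : exists e, [/\ meq e (pr i), (is_free i -> e = pr i)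
  & ~~ is_free i -> forall x, meq x (pr i) -> e + x = x].
Proof.
have prr j : meq (pr j) (pr j) by split; exact: mlexx.
have [fi|ri] := boolP (is_free i).
  by exists (pr i); split=> // ri; rewrite fi in ri.
have [e ei eE] := meq_diff ri (prr i) (prr i).
exists e; split=> // _ x xi; have [z _ ->] := meq_diff ri (prr i) xi.
by rewrite addrA [e + _]addrC -eE.
Qed.

Local Definition absorber := projT1 (choice absorber_ex).
Local Lemma absorberP i : [/\ meq (absorber i) (pr i), (is_free i -> absorber i = pr i)
  & ~~ is_free i -> forall x, meq x (pr i) -> absorber i + x = x].
Proof. exact: projT2 (choice absorber_ex) i. Qed.

Local Lemma inv_ex i x : ~~ is_free i -> meq x (pr i) ->
  exists2 y, meq y (pr i) & x + y = absorber i.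
Proof.
by move=> ri xi; have [ei _ _] := absorberP i; have [z zi eE] := meq_diff ri xi ei; exists z.
Qed.

Local Definition gen_enum (k : nat) : M :=
  if unpickle k is Some s then mcomb g (nth 0%N s) else 0.

Local Lemma gen_enum_surj x : exists k, x = gen_enum k.
Proof.
have [c ->] := mcomb_surj gen x; exists (pickle (mkseq c n)).
rewrite /gen_enum pickleK; apply: eq_bigr => i _.
by rewrite nth_mkseq.
Qed.

(* A free class carries the single vertex [(i, false, 0)], a regular one the
   vertices [a_k = (i, false, k)] and [b_k = (i, true, k)]. *)
Local Definition vert_pred (x : 'I_r * bool * nat) : bool :=
  is_free x.1.1 ==> (x.1.2 == false) && (x.2 == 0%N).

Local Notation vert := {x : 'I_r * bool * nat | vert_pred x}.

Local Lemma vert0_proof i : vert_pred (i, false, 0%N).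
Proof. by rewrite /vert_pred /= implybT. Qed.

(** On a free class the default of [insubd] sends all indices to its single vertex. *)
Local Definition vtx i b k : vert := insubd (exist _ (i, false, 0%N) (vert0_proof i)) (i, b, k).

Local Definition cls (v : vert) : 'I_r := (val v).1.1.

Local Definition vfree (v : vert) : bool := is_free (cls v).

(** At a regular class the default [pr] replaces the enumerated elements outside the group, so each
    of the families [a_k] and [b_k] takes every value in the group. *)
Local Definition vval (v : vert) : M :=
  if vfree v then pr (cls v)
  else if `[< meq (gen_enum (val v).2) (pr (cls v)) >] then gen_enum (val v).2
  else pr (cls v).

Local Definition vsum (l : seq vert) : M := \sum_(v <- l) vval v.

Local Lemma cls_vtx i b k : cls (vtx i b k) = i.
Proof. by rewrite /cls /vtx val_insubd; case: ifP. Qed.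

Local Lemma val_vtx i b k : ~~ is_free i -> val (vtx i b k) = (i, b, k).
Proof. by move=> ri; rewrite val_insubd /vert_pred /= (negPf ri). Qed.

Local Lemma vtxE (v : vert) : v = vtx (cls v) (val v).1.2 (val v).2.
Proof.
apply: val_inj; rewrite val_insubd /cls.
by case: v => -[[i b] k] /= vp; rewrite vp.
Qed.

Local Lemma vtx_free (v w : vert) : vfree v -> cls w = cls v -> w = v.
Proof.
case: v w => -[[i b] k] vp [[[j b'] k'] wp]; rewrite /vfree /cls /= => fi ji.
subst j; apply: val_inj => /=; move: vp wp; rewrite /vert_pred /= fi /=.
by move=> /andP[/eqP-> /eqP->] /andP[/eqP-> /eqP->].
Qed.

Local Lemma vval_cls (v : vert) : meq (vval v) (pr (cls v)).
Proof.
rewrite /vval; case: ifP => _; first by split; exact: mlexx.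
by case: asboolP => // _; split; exact: mlexx.
Qed.

Local Lemma vval_surj i b x : ~~ is_free i -> meq x (pr i) -> exists k, vval (vtx i b k) = x.
Proof.
move=> ri xi; have [k xE] := gen_enum_surj x; exists k.
rewrite /vval /vfree cls_vtx (negPf ri) val_vtx //=.
by case: asboolP => //; rewrite -xE.
Qed.

Local Lemma vval_free (v : vert) : vfree v -> vval v = pr (cls v).
Proof. by rewrite /vval => ->. Qed.

(** A prime x equivalent to a free [pr i] is pr i + b with b strictly smaller: were b divisible by
    x, 2 pr i would divide x and hence pr i. A prime in a regular class is itself the value of a
    vertex. *)
Local Lemma vsum_surj x : exists l, x = vsum l.
Proof.
elim/(well_founded_ind (mlt_wf gen)): x => x IH.
have [->|x0] := pselect (x = 0); first by exists [::]; rewrite /vsum big_nil.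
have [px|npx] := pselect (mprime x); last first.
  have [a [b [xE /IH[la aE] /IH[lb bE]]]] := mnonprime refM x0 npx.
  by exists (la ++ lb); rewrite /vsum big_cat xE aE bE.
have [i xi] := pr_surj px; have [fi|ri] := boolP (is_free i); last first.
  have [k <-] := vval_surj false ri xi.
  by exists [:: vtx i false k]; rewrite /vsum big_seq1.
case: (xi) => xpi [b xE].
have [|l bE] := IH b.
  split=> [|xb]; first by rewrite xE; exact: mle_addl.
  move/asboolP: fi; apply; apply: mle_trans xpi; rewrite xE.
  apply: mleD; first exact: mlexx.
  by apply: mle_trans xb; case: xi.
exists (vtx i false 0 :: l).
by rewrite /vsum big_cons vval_free /vfree ?cls_vtx // xE {1}bE.
Qed.

Local Definition null i (l : seq vert) := absorber i + vsum l = absorber i.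

Local Lemma null_lower i l v : null i l -> v \in l ->
  mle (pr (cls v)) (pr i) /\ mle (absorber i + vval v) (absorber i).
Proof.
move=> il vl; have [ei _ _] := absorberP i.
have vsl : mle (vval v) (vsum l).
  by rewrite /vsum -(big_map vval xpredT id); apply: mle_sum; exact: map_f.
split; last by rewrite -[X in mle _ X]il; apply: mleD => //; exact: mlexx.
apply: mle_trans ei.1; rewrite -il; apply: mle_trans (mle_addl _ _).
by apply: mle_trans vsl; case: (vval_cls v).
Qed.

Local Lemma null_lt i l v : is_free i -> null i l -> v \in l -> cls_lt (cls v) i.
Proof.
move=> fi il vl; have [vi ivi] := null_lower il vl; rewrite /cls_lt asboolT //=.
apply/eqP => ci; move: ivi; have [_ -> // _] := absorberP i.
move/asboolP: (fi) => + h; apply; apply: mle_trans h.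
apply: mleD; first exact: mlexx.
by rewrite -{1}ci; case: (vval_cls v).
Qed.

Local Lemma null_cls i l v : null i l -> v \in l -> cls v = i \/ cls_lt (cls v) i.
Proof.
move=> il vl; have [vi _] := null_lower il vl.
by rewrite /cls_lt asboolT //=; case: eqP; [left|right].
Qed.

(* The finite generation comes again from Dickson's lemma. *)
Local Lemma free_null_ex i : exists ls : seq (seq vert), is_free i ->
  (forall l, l \in ls -> null i l /\ l != [::]) /\
  forall x, pr i + x = pr i -> exists2 L : seq (seq vert),
    {subset L <= ls} & x = \sum_(l <- L) vsum l.
Proof.
have [|_] := boolP (is_free i); last by exists [::].
move=> fi; have [_ /(_ fi) eE _] := absorberP i.
pose A := [set c | pr i + mcomb g c = pr i /\ mcomb g c <> 0].
have [B [/finite_seqP[s ->] BA BP]] := dickson n A.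
have [L LP] := choice (fun c => vsum_surj (mcomb g c)).
exists [seq L c | c <- s] => _; split=> [l /mapP[c cs ->]|x].
  have [ic c0] := BA c cs; rewrite /null eE -LP; split=> //.
  by apply/eqP => L0; apply: c0; rewrite LP L0 /vsum big_nil.
have [c ->] := mcomb_surj gen x.
have [m] := ubnP (\sum_(u < n) c u)%N; elim: m c => // m IH c cm ic.
have [->|c0] := pselect (mcomb g c = 0).
  by exists [::]; rewrite ?big_nil.
(* As [pr i] absorbs the combination of b, it also absorbs that of c - b, whose total is smaller
   because [mcomb g b] is nonzero. *)
have [b bs bc] := BP c (conj ic c0); have [ib b0] := BA b bs.
have cE := mcombB g bc.
have [||K Ks KE] := IH (fun u => c u - b u)%N.
- rewrite ltnS in cm; apply: leq_trans cm.
  rewrite [X in (_ < X)%N](eq_bigr (fun u : 'I_n => (c u - b u) + b u)%N) => [|u _]; last first.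
    by rewrite subnK // bc.
  rewrite big_split /= -addn1 leq_add2l lt0n; apply/negP.
  rewrite sum_nat_eq0 => /forallP bz; apply: b0; rewrite /mcomb big1 // => u _.
  by have /eqP-> := bz u.
- by rewrite -[in LHS]ib -addrA -cE.
exists (L b :: K); last by rewrite big_cons -KE -LP.
move=> l; rewrite inE => /orP[/eqP->|/Ks//]; exact: map_f.
Qed.

Local Definition fnull := projT1 (choice free_null_ex).
Local Lemma fnullP i : is_free i ->
  (forall l, l \in fnull i -> null i l /\ l != [::]) /\
  forall x, pr i + x = pr i -> exists2 L : seq (seq vert),
    {subset L <= fnull i} & x = \sum_(l <- L) vsum l.
Proof. exact: projT2 (choice free_null_ex) i. Qed.

(** The last entry is an inverse, in the group of the class, of the sum of the other three. *)
Local Lemma null_completion_ex (ik : 'I_r * nat) : exists y : vert, cls y = ik.1 /\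
  (~~ is_free ik.1 -> null ik.1 [:: vtx ik.1 false 0; vtx ik.1 false ik.2.+1;
                               vtx ik.1 true ik.2; y]).
Proof.
case: ik => i k /=; have [fi|ri] := boolP (is_free i).
  by exists (vtx i false 0); rewrite cls_vtx; split=> // ri; rewrite fi in ri.
set s := [:: vtx i false 0%N; vtx i false k.+1; vtx i true k].
have vi b l : meq (vval (vtx i b l)) (pr i).
  by rewrite -[X in pr X](cls_vtx i b l); exact: vval_cls.
have si : meq (vsum s) (pr i).
  rewrite /vsum /s !big_cons big_nil addr0 addrA.
  apply: meqD => //; last by case: (vi true k).
  by apply: meqD => //; case: (vi false k.+1).
have [y yi syE] := inv_ex ri si; have [l lE] := vval_surj false ri yi.
exists (vtx i false l); split=> [|_]; first exact: cls_vtx.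
have [ei _ /(_ ri) eE] := absorberP i.
rewrite /null -[RHS](eE _ ei); congr (_ + _).
by rewrite -syE -lE /vsum /s !big_cons !big_nil !addr0 !addrA.
Qed.

Local Definition null_completion i k := projT1 (choice null_completion_ex) (i, k).
Local Lemma null_completionP i k : cls (null_completion i k) = i /\
  (~~ is_free i -> null i [:: vtx i false 0; vtx i false k.+1; vtx i true k; null_completion i k]).
Proof. exact: projT2 (choice null_completion_ex) (i, k). Qed.

Local Definition connecting i k :=
  [:: vtx i false 0; vtx i false k.+1; vtx i true k; null_completion i k].

Local Definition enum_null i k : seq vert :=
  if unpickle k is Some l then if `[< null i l >] then l else [::] else [::].

Local Lemma null_enum_null i k : null i (enum_null i k).
Proof.
rewrite /enum_null; case: (unpickle k : option (seq vert)) => [l|].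
  by case: asboolP => // _; rewrite /null /vsum big_nil addr0.
by rewrite /null /vsum big_nil addr0.
Qed.

(* The null list [connecting i k] makes the class [i] transitive; the relation
   at [b_k] records moreover the [k]-th null list. *)
Local Definition vrel (v : vert) : seq (seq vert) :=
  if vfree v then [seq v :: l | l <- fnull (cls v)] else
  [:: v :: connecting (cls v) (val v).2 ++
       if (val v).1.2 then enum_null (cls v) (val v).2 else [::]].

Local Lemma cls_lt_irr : irreflexive cls_lt. Proof. by move=> i; rewrite /cls_lt eqxx andbF. Qed.

Local Lemma cls_lt_trans : transitive cls_lt.
Proof.
move=> j i k /andP[/asboolP ij nij] /andP[/asboolP jk njk].
rewrite /cls_lt (asboolT (mle_trans ij jk)) /=; apply/eqP => ik; subst k.
by move/eqP: nij; apply; exact: pr_inj.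
Qed.

Local Definition conn (v w : vert) := exists2 s,
  path (fun a b : vert => (b \in flatten (vrel a)) && (cls b == cls a)) v s & last v s = w.

Local Lemma conn_trans v w u : conn v w -> conn w u -> conn v u.
Proof.
move=> [s vs sw] [t wt tu]; exists (s ++ t); last by rewrite last_cat sw.
by rewrite cat_path vs sw.
Qed.

Local Lemma conn1 i b k w : ~~ is_free i -> cls w = i -> w \in connecting i k -> conn (vtx i b k) w.
Proof.
move=> ri wi wc; exists [:: w] => //=; rewrite cls_vtx wi eqxx !andbT.
rewrite /vrel /vfree cls_vtx (negPf ri) val_vtx //.
by apply/flattenP; eexists; [exact: mem_head|rewrite in_cons mem_cat wc orbT].
Qed.

Local Lemma reg_conn v w : ~~ vfree v -> cls w = cls v -> conn v w.
Proof.
rewrite (vtxE v) (vtxE w) /vfree !cls_vtx.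
move: (cls v) => i; move: (val v).1.2 (val v).2 (val w).1.2 (val w).2.
move=> b k b' k' ri ->.
apply: (@conn_trans _ (vtx i false 0%N)).
  by apply: conn1; rewrite ?cls_vtx // /connecting mem_head.
(* The list [connecting i k] leads from index k back to [a_0], and from [a_k] on to the next [a] and
   to [b_k]; so all [a_m] are reached by climbing from [a_0]. *)
have h m : conn (vtx i false 0%N) (vtx i false m).
  elim: m => [|m IH]; first by exists [::].
  by apply: conn_trans IH _; apply: conn1; rewrite ?cls_vtx // /connecting !inE eqxx orbT.
case: b' => //; apply: conn_trans (h k') _.
by apply: conn1; rewrite ?cls_vtx // /connecting !inE eqxx !orbT.
Qed.

Local Lemma vrel_free v X : vfree v -> X \in vrel v -> exists b,
    [/\ X = v :: b, b != [::] & forall w, w \in b -> cls_lt (cls w) (cls v)].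
Proof.
move=> fv; rewrite /vrel fv => /mapP[l ll ->]; exists l.
have [/(_ l ll)[nl l0] _] := fnullP fv.
by split=> // w; exact: null_lt.
Qed.

Local Lemma connecting_cls i k u : u \in connecting i k -> cls u = i.
Proof.
rewrite !inE => /or4P[] /eqP->; rewrite ?cls_vtx //.
by have [] := null_completionP i k.
Qed.

Local Lemma vrel_reg v : ~~ vfree v -> exists w X,
    [/\ vrel v = [:: [:: v, w & X]], cls w = cls v
      & forall u, u \in X -> cls u = cls v \/ cls_lt (cls u) (cls v)].
Proof.
move=> rv; rewrite /vrel (negPf rv); set k := (val v).2.
exists (vtx (cls v) false 0%N).
exists (behead (connecting (cls v) k) ++ if (val v).1.2 then enum_null (cls v) k else [::]).
split=> //; first exact: cls_vtx.
move=> u; rewrite mem_cat => /orP[uc|].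
  by left; apply: (@connecting_cls _ k); rewrite inE uc orbT.
by case: ifP => // _; exact: (null_cls (null_enum_null _ _)).
Qed.

Definition monoid_graph : graphData := @GraphData vert vfree vrel r cls cls_lt
  cls_lt_irr cls_lt_trans (fun v w e => congr1 is_free e) vtx_free vrel_free vrel_reg reg_conn.

Definition monoid_graph_val : gvert monoid_graph -> M := vval.

Local Lemma reg_absorb v x : ~~ vfree v -> absorber (cls v) + x = absorber (cls v) ->
  vval v + x = vval v.
Proof.
move=> rv ex; have [_ _ /(_ rv)/(_ _ (vval_cls v)) <-] := absorberP (cls v).
by rewrite addrAC ex.
Qed.

Lemma monoid_graph_sat : grels_sat monoid_graph_val.
Proof.
move=> v X; rewrite /grels /= /vrel /monoid_graph_val; case: ifP => [fv|/negbT rv].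
  move=> /mapP[l ll ->]; have [/(_ l ll)[nl _] _] := fnullP fv.
  rewrite big_cons vval_free //.
  by move: nl; rewrite /null; have [_ -> //] := absorberP (cls v).
rewrite inE => /eqP->; rewrite big_cons big_cat addrA -!/(vsum _).
have h l : null (cls v) l -> vval v + vsum l = vval v by exact: reg_absorb.
have nc : null (cls v) (connecting (cls v) (val v).2).
  by have [_] := null_completionP (cls v) (val v).2; apply.
rewrite (h _ nc); case: ifP => _; first by rewrite h //; exact: null_enum_null.
by rewrite /vsum big_nil addr0.
Qed.

Lemma monoid_graph_surj x :
  exists l : seq (gvert monoid_graph), x = \sum_(v <- l) monoid_graph_val v.
Proof. exact: vsum_surj. Qed.

(** * The chosen relations imply all others *)

Section Completeness.
Variables (T : nmodType) (c : gvert monoid_graph -> T).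
Hypothesis csat : grels_sat c.

Local Definition csum (l : seq vert) : T := \sum_(v <- l) c v.

Local Definition good v := forall l, vval v = vsum l -> c v = csum l.

Local Lemma vsum_cat l l' : vsum (l ++ l') = vsum l + vsum l'.
Proof. by rewrite /vsum big_cat. Qed.

Local Lemma csum_cat l l' : csum (l ++ l') = csum l + csum l'.
Proof. by rewrite /csum big_cat. Qed.

Section Lower.
Variable D : vert -> Prop.
Hypothesis D_good : forall v, D v -> good v.
Hypothesis D_le : forall v w, D v -> mle (vval w) (vval v) -> D w.

Local Lemma D_lower l v : (D v) -> mle (vsum l) (vval v) -> forall w, w \in l -> D w.
Proof.
move=> Dv lv w wl; apply: D_le Dv _; apply: mle_trans lv.
by rewrite /vsum -(big_map vval xpredT id); apply: mle_sum; exact: map_f.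
Qed.

(** The equality is refined entry by entry: an entry [w] splits as a + a', and goodness of [w]
    replaces [c w] by the lists chosen for a and a'. [Q] stays in [D] because [D] is closed
    downwards. *)
Local Lemma csum_split l x y : (forall v, v \in l -> D v) -> x + y = vsum l ->
  exists P Q, [/\ vsum P = x, vsum Q = y, csum l = csum P + csum Q
    & forall v, v \in Q -> D v].
Proof.
elim: l x y => [|w l IH] x y Dl.
  rewrite /vsum big_nil => /conicalM[-> ->]; exists [::], [::].
  by rewrite /csum !big_nil addr0.
rewrite {1}/vsum big_cons => /refM[a [b [a' [b' [xE yE wE lE]]]]].
have [|P [Q [PE QE lPQ DQ]]] := IH b b' _ (esym lE).
  by move=> v vl; apply: Dl; rewrite inE vl orbT.
have [A aE] := vsum_surj a; have [A' a'E] := vsum_surj a'.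
have Dw : D w by apply: Dl; rewrite mem_head.
exists (A ++ P), (A' ++ Q); split.
- by rewrite vsum_cat PE -aE -xE.
- by rewrite vsum_cat QE -a'E -yE.
- rewrite !csum_cat {1}/csum big_cons -/(csum l) lPQ addrACA; congr (_ + _).
  by rewrite -csum_cat; apply: (D_good Dw); rewrite vsum_cat -aE -a'E.
- move=> v; rewrite mem_cat => /orP[|/DQ//]; apply: (D_lower Dw).
  by rewrite wE -a'E; exact: mle_addl.
Qed.

(** Splitting [l'] along the first entry [v] of [l] gives a list with the value of [v], settled by
    goodness of [v], and a remainder for the induction. *)
Local Lemma csum_eq l l' : (forall v, v \in l -> D v) -> (forall v, v \in l' -> D v) ->
  vsum l = vsum l' -> csum l = csum l'.
Proof.
elim: l l' => [|v l IH] l' Dl Dl'.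
  rewrite /vsum big_nil => /esym; case: l' Dl' => [//|w l' _].
  rewrite big_cons => /conicalM[w0 _]; have [_ ww] := vval_cls w.
  by have [+ _] := pr_prime (cls w); rewrite (mle0 conicalM (x := pr (cls w))) // -w0.
rewrite {1}/vsum big_cons => /(csum_split Dl')[P [Q [PE QE -> DQ]]].
rewrite /csum big_cons -!/(csum _); congr (_ + _).
  by apply: D_good => //; apply: Dl; rewrite mem_head.
by apply: IH => // w wl; apply: Dl; rewrite inE wl orbT.
Qed.

End Lower.

Local Lemma lt_mle i j k : mle (pr k) (pr i) -> cls_lt i j -> cls_lt k j.
Proof.
move=> ki /andP[/asboolP ij nij]; rewrite /cls_lt (asboolT (mle_trans ki ij)) /=.
by apply/eqP => kj; subst k; move/eqP: nij; apply; exact: pr_inj.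
Qed.

Local Lemma cls_mle v w : mle (vval w) (vval v) -> mle (pr (cls w)) (pr (cls v)).
Proof.
have [_ ww] := vval_cls w; have [vv _] := vval_cls v.
by move=> wv; apply: mle_trans vv; apply: mle_trans wv.
Qed.

Local Lemma conn_c v w : conn v w -> exists z, c v = c w + z.
Proof.
move=> [s]; elim: s v => [|u s IH] v /=.
  by move=> _ ->; exists 0; rewrite addr0.
move=> /andP[/andP[/flattenP[X Xv uX] _] us] sw.
have [z uz] := IH u us sw; rewrite (csat Xv) (big_rem u) //= uz -addrA.
by eexists.
Qed.

(** The reason for two families of vertices: the relation at [a_k] shows that the connecting list is
    absorbed, and the relation at [b_k], which adds the connecting list followed by [l], then shows
    it for [l]. Both facts pass to [v] because [c] of any vertex of the class divides [c v]. *)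
Local Lemma reg_absorb_c v l : ~~ vfree v -> null (cls v) l ->
  c v + csum l = c v.
Proof.
move=> rv nl; have ri : ~~ is_free (cls v) by []; set k := pickle l.
have wE : enum_null (cls v) k = l by rewrite /enum_null pickleK asboolT.
have ca b : exists z, c v = c (vtx (cls v) b k) + z.
  by apply/conn_c/reg_conn; rewrite ?cls_vtx.
have vn : c v + csum (connecting (cls v) k) = c v.
  have [z ->] := ca false; rewrite addrAC; congr (_ + _).
  rewrite [RHS](csat (X := vtx (cls v) false k :: connecting (cls v) k ++ [::])).
    by rewrite cats0 big_cons.
  by rewrite /= /vrel /vfree cls_vtx (negPf ri) val_vtx //= mem_head.
rewrite -[in LHS]vn; have [z ->] := ca true; rewrite !(addrAC _ z); congr (_ + _).
rewrite [RHS](csat (X := vtx (cls v) true k :: connecting (cls v) k ++ l)).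
  by rewrite big_cons big_cat addrA.
by rewrite /= /vrel /vfree cls_vtx (negPf ri) val_vtx //= wE mem_head.
Qed.

(** The list [l] may be exchanged for lists from [fnull], since all vertices involved are lower and
    hence good; each list from [fnull] occurs in a relation at [v]. *)
Local Lemma free_absorb_c v l : vfree v ->
  (forall w, cls_lt (cls w) (cls v) -> good w) -> null (cls v) l ->
  c v + csum l = c v.
Proof.
move=> fv gl nl; have [_ /(_ fv) eE _] := absorberP (cls v).
have [fn /(_ (vsum l))[|L Ls lE]] := fnullP fv; first by rewrite -eE.
have lL : vsum l = vsum (flatten L).
  by rewrite lE /vsum big_flatten.
rewrite (csum_eq gl _ _ _ lL); last 3 first.
- move=> u w uv wu; apply: lt_mle uv; exact: cls_mle.
- by move=> w; exact: null_lt.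
- move=> w /flattenP[m /Ls /fn[nm _]]; exact: null_lt.
elim: L Ls {lE lL} => [|m L IH] Ls; first by rewrite /csum big_nil addr0.
rewrite csum_cat addrA -[in LHS]/(csum m).
have -> : c v + csum m = c v.
  rewrite [RHS](csat (X := v :: m)) ?big_cons //= /vrel fv map_f //.
  by apply: Ls; rewrite mem_head.
by apply: IH => w wL; apply: Ls; rewrite inE wL orbT.
Qed.

(** As [pr (cls v)] is prime, [l] contains some [w] of the class of [v]. In the free case w = v and
    the rest is absorbed. In the regular case let z be inverse to v: both v + z and l + z are
    neutral, so c v = c v + c l + c z = c l. *)
Local Lemma vert_good v : good v.
Proof.
move: {2}(pr (cls v)) (erefl (pr (cls v))) => x; move: v.
elim/(well_founded_ind (mlt_wf gen)): x => x IH v vx l vl.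
have gl w : cls_lt (cls w) (cls v) -> good w.
  move=> wv; apply: IH (erefl _); rewrite -vx; case/andP: (wv) => /asboolP wv' _.
  split=> // vw; have := lt_mle vw wv; by rewrite cls_lt_irr.
have [vv1 vv2] := vval_cls v.
have [w wl vw] : exists2 w, w \in l & mle (pr (cls v)) (vval w).
  by apply: (mprime_sum conicalM (pr_prime _)); rewrite -/(vsum l) -vl.
have wv : cls w = cls v.
  apply: pr_inj; split; last by apply: mle_trans vw _; case: (vval_cls w).
  apply: cls_mle; rewrite vl /vsum -(big_map vval xpredT id).
  by apply: mle_sum; exact: map_f.
have lE : vsum l = vval w + vsum (rem w l) by rewrite /vsum (big_rem w).
have clE : csum l = c w + csum (rem w l) by rewrite /csum (big_rem w).
rewrite clE; have [fv|rv] := boolP (vfree v).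
  have {}wv := vtx_free fv wv; subst w; rewrite free_absorb_c //.
  by rewrite /null; have [_ -> //] := absorberP (cls v); rewrite -(vval_free fv) -lE.
have [ei _ /(_ rv) eE] := absorberP (cls v).
have rw : ~~ vfree w by rewrite /vfree wv.
have inv u : cls u = cls v -> exists y : vert, vval u + vval y = absorber (cls v).
  move=> uv; have ui : meq (vval u) (pr (cls v)) by rewrite -uv; exact: vval_cls.
  have [y yi <-] := inv_ex rv ui; have [k yE] := vval_surj false rv yi.
  by exists (vtx (cls v) false k); rewrite yE.
have [y wy] := inv w wv; have [z vz] := inv v erefl.
have nvz : null (cls v) [:: v; z] by rewrite /null /vsum !big_cons big_nil addr0 vz eE.
have nwz : null (cls v) (w :: rcons (rem w l) z).
  rewrite /null; have -> : vsum (w :: rcons (rem w l) z) = vsum l + vval z.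
    by rewrite lE /vsum big_cons big_rcons /= addrA.
  by rewrite -vl vz eE.
have nwv : null (cls w) [:: v; z] by rewrite wv.
rewrite -(reg_absorb_c rv nwz) -[in RHS](reg_absorb_c rw nwv).
rewrite /csum !big_cons big_rcons big_nil addr0 /=.
by rewrite addrCA -!addrA [c z + _]addrC.
Qed.

Lemma monoid_graph_eq (l l' : seq (gvert monoid_graph)) :
  \sum_(v <- l) monoid_graph_val v = \sum_(v <- l') monoid_graph_val v ->
  \sum_(v <- l) c v = \sum_(v <- l') c v.
Proof. by apply: (csum_eq (D := fun _ => True)) => // v _; exact: vert_good. Qed.

End Completeness.
End GraphOfMonoid.

(** The last clause stands for an isomorphism with the presented monoid: every [c] compatible with
    the relations factors through [val]. *)
Theorem monoid_graph_presentation (M : nmodType) :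
  monoid_fg M -> monoid_conical M -> monoid_refinement M ->
  exists (D : graphData) (val : gvert D -> M), [/\ grels_sat val,
    forall x, exists l, x = \sum_(v <- l) val v
    & forall (T : nmodType) (c : gvert D -> T), grels_sat c -> forall l l',
      \sum_(v <- l) val v = \sum_(v <- l') val v ->
      \sum_(v <- l) c v = \sum_(v <- l') c v].
Proof.
move=> [n [g gen]] conM refM.
have [ps [u ps_pr inj surj]] := mprime_classes conM refM gen.
pose pr (i : 'I_(size ps)) := nth 0 ps i.
have pr_prime i : mprime (pr i) by apply: ps_pr; exact: mem_nth.
have pr_inj i j : meq (pr i) (pr j) -> i = j.
  move=> /inj e; apply/val_inj/eqP; rewrite /= -(nth_uniq 0 _ _ u) //.
  by rewrite -/(pr i) -/(pr j) e // mem_nth.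
have pr_surj p : mprime p -> exists i, meq p (pr i).
  move=> /surj[q qps pq]; have qi : (index q ps < size ps)%N by rewrite index_mem.
  by exists (Ordinal qi); rewrite /pr /= nth_index.
exists (monoid_graph refM gen pr_inj pr_surj).
exists (@monoid_graph_val _ refM _ _ gen _ _ pr_inj pr_surj).
split; first exact: monoid_graph_sat.
- exact: monoid_graph_surj.
- by move=> T c csat l l'; exact: (monoid_graph_eq conM pr_prime csat).
Qed.

Local Close Scope ring_scope.

(** * The adaptable separated graph *)

Section SeparatedGraphOfData.
Variable D : graphData.
Local Notation V := (gvert D).
Implicit Types (v w : V) (i t : nat).

Definition grow v i : seq V := nth [::] (grels v) i.

(* The edge [(v, i, t)] belongs to the [i]-th block at [v] and its range is
   the [t]-th entry of the corresponding relation; [t = 0] gives a loop. *)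
Definition edge_pred (x : V * nat * nat) : bool :=
  (x.1.2 < size (grels x.1.1))%N && (x.2 < size (grow x.1.1 x.1.2))%N.

Definition gedge := {x : V * nat * nat | edge_pred x}.
HB.instance Definition _ := Choice.on gedge.
HB.instance Definition _ := SubChoice.on gedge.

Implicit Types e f : gedge.

Definition gsource e : V := (val e).1.1.
Definition gblock e : nat := (val e).1.2.
Definition gpos e : nat := (val e).2.
Definition grange e : V := nth (gsource e) (grow (gsource e) (gblock e)) (gpos e).

Definition Gedge v i t (p : edge_pred (v, i, t)) : gedge := exist _ (v, i, t) p.

Lemma gedge_eq e f : gsource e = gsource f -> gblock e = gblock f ->
  gpos e = gpos f -> e = f.
Proof.
case: e f => -[[v i] t] p [[[w j] s] q]; rewrite /gsource /gblock /gpos /=.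
by move=> vw ij ts; subst w j s; apply: val_inj.
Qed.

Lemma gedgeE e : (gsource e, gblock e, gpos e) = val e.
Proof. by rewrite /gsource /gblock /gpos; case: (val e) => -[]. Qed.

Lemma gblock_lt e : (gblock e < size (grels (gsource e)))%N.
Proof. by case: e => -[[v i] t] p; case/andP: (p). Qed.

Lemma gpos_lt e : (gpos e < size (grow (gsource e) (gblock e)))%N.
Proof. by case: e => -[[v i] t] p; case/andP: (p). Qed.

Lemma grange_mem e : grange e \in grow (gsource e) (gblock e).
Proof. exact/mem_nth/gpos_lt. Qed.

Lemma grow_head v i : (i < size (grels v))%N ->
  exists b, grow v i = v :: b /\ b != [::].
Proof.
move=> iv; have [fv|rv] := boolP (gfree v).
  by have [b [bE b0 _]] := gfree_rel fv (mem_nth [::] iv); exists b.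
have [w [X [rE _ _]]] := greg_rel rv; exists (w :: X).
by rewrite /grow; move: iv; rewrite rE ltnS leqn0 => /eqP->.
Qed.

Lemma grow_size v i : (i < size (grels v))%N -> (1 < size (grow v i))%N.
Proof. by move=> /grow_head[[|w b] [-> //]]. Qed.

Lemma grange_loop e : gpos e = 0%N -> grange e = gsource e.
Proof.
by move=> e0; rewrite /grange e0; have [b [-> _]] := grow_head (gblock_lt e).
Qed.

Lemma grange_lower e : gfree (gsource e) -> gpos e != 0%N ->
  glt (gcls (grange e)) (gcls (gsource e)).
Proof.
move=> fv; have [b [rE _ bP]] := gfree_rel fv (mem_nth [::] (gblock_lt e)).
have := gpos_lt e; rewrite /grange /grow rE.
by case: (gpos e) => // t /= tb _; apply: bP; exact: mem_nth.
Qed.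

Lemma grange_cls e : gcls (grange e) = gcls (gsource e) \/
  glt (gcls (grange e)) (gcls (gsource e)).
Proof.
have [fv|rv] := boolP (gfree (gsource e)).
  by have [/grange_loop->|/(grange_lower fv)] := eqVneq (gpos e) 0%N; [left|right].
have [w [X [rE wv XP]]] := greg_rel rv.
have := grange_mem e; rewrite /grow; have := gblock_lt e.
rewrite rE ltnS leqn0 => /eqP->; rewrite !inE => /or3P[/eqP->|/eqP->|/XP//].
- by left.
- by left.
Qed.

Definition gblock_set v i : set gedge := [set e | gsource e = v /\ gblock e = i].

Definition gsep v : set (set gedge) :=
  [set gblock_set v i | i in [set i | (i < size (grels v))%N]].

Lemma edge_pred0 v i : (i < size (grels v))%N -> edge_pred (v, i, 0%N).
Proof. by move=> iv; rewrite /edge_pred /= iv; apply: ltnW; exact: grow_size. Qed.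

Lemma gsep_partition v : partition (gsep v) id (gsource @^-1` [set v]).
Proof.
split.
- rewrite eqEsubset; split=> e; first by move=> [_ [i iv <-] [ev _]].
  move=> ev; exists (gblock_set v (gblock e)); last by split.
  by exists (gblock e) => //=; rewrite -[v]ev; exact: gblock_lt.
- by move=> _ _ [i _ <-] [j _ <-] [e [[_ ei] [_ ej]]]; rewrite -ei -ej.
- by move=> _ [i iv <-]; exists (Gedge (edge_pred0 iv)).
Qed.

Definition data_graph : sepGraph := SepGraph grange gsep_partition.

Lemma gblock_set_inj v i j : (i < size (grels v))%N ->
  gblock_set v i = gblock_set v j -> i = j.
Proof.
move=> iv ij; have : gblock_set v i (Gedge (edge_pred0 iv)) by [].
by rewrite ij => -[].
Qed.

Local Notation comp := (component data_graph).

Lemma vle_cls v w : @vle data_graph v w ->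
  gcls v = gcls w \/ glt (gcls v) (gcls w).
Proof.
case=> s; elim: s w => [|e s IH] w /=; first by move=> ->; left.
move=> [_ <- /IH h]; case: h (grange_cls e) => [->|ve] //.
by case=> [<-|/(glt_trans ve)]; [right|right].
Qed.

Definition loop_edges v : set gedge := [set e | gsource e = v /\ gpos e = 0%N].
Definition class_edges v : set gedge :=
  [set e | gcls (gsource e) = gcls v /\ gcls (grange e) = gcls v].

Lemma class_path v w w' : ~~ gfree v -> gcls w = gcls v -> gcls w' = gcls v ->
  exists s, @gpath data_graph (class_edges v) w s w'.
Proof.
move=> rv wv w'v; have rw : ~~ gfree w by rewrite (gfree_cls wv).
have [|s ws <-] := @greg_path _ w w' rw; first by rewrite wv.
elim: s w wv {rw} ws => [|u s IH] w wv /=; first by exists [::].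
move=> /andP[/andP[/flattenP[X Xw uX] /eqP uw] /IH[|s' us']]; first by rewrite uw.
have p : edge_pred (w, index X (grels w), index u X).
  by rewrite /edge_pred /= index_mem Xw /grow nth_index // index_mem.
exists (Gedge p :: s') => /=.
have rE : grange (Gedge p) = u.
  by rewrite /grange /gsource /gblock /gpos /= /grow !nth_index.
by split=> //=; rewrite ?rE //; split=> //; rewrite rE uw.
Qed.

(** Along a path the class can only stay or drop, and inside a regular class [greg_path] joins any
    two vertices. *)
Lemma transitive_compE v :
  @transitive_comp data_graph v = [set w | gcls w = gcls v].
Proof.
rewrite eqEsubset; split=> w /=.
  case=> /vle_cls[//|vw] /vle_cls[//|wv].
  by have := glt_trans vw wv; rewrite glt_irr.
move=> wv; have [fv|rv] := boolP (gfree v).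
  by have -> := gfree_uniq fv wv; split; exists [::].
have gpathT (P : set gedge) x s y : @gpath data_graph P x s y ->
    @gpath data_graph setT x s y.
  by elim: s x => //= e s IH x [_ ex /IH].
by split; [have [s /gpathT] := class_path rv wv erefl
  |have [s /gpathT] := class_path rv erefl wv]; exists s.
Qed.

Lemma comp_ex (p : comp) : exists v, comp_verts p = [set w | gcls w = gcls v].
Proof.
have [v _ vp] := set_mem (valP p).
by exists v; rewrite /comp_verts -transitive_compE vp.
Qed.

Definition comp_vx (p : comp) : V := projT1 (cid (comp_ex p)).

Lemma comp_vertsE (p : comp) w : comp_verts p w <-> gcls w = gcls (comp_vx p).
Proof. by rewrite (projT2 (cid (comp_ex p))). Qed.

Lemma comp_vx_mem (p : comp) : comp_verts p (comp_vx p).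
Proof. exact/comp_vertsE. Qed.

Lemma comp_inj (p q : comp) : gcls (comp_vx p) = gcls (comp_vx q) -> p = q.
Proof.
move=> pq; apply: val_inj; rewrite eqEsubset.
by split=> w /comp_vertsE wp; apply/comp_vertsE; rewrite wp.
Qed.

Definition vcomp v : comp :=
  exist _ (@transitive_comp data_graph v) (mem_set (ex_intro2 _ _ v I erefl)).

Lemma vcompP v : comp_verts (vcomp v) v.
Proof.
by rewrite /comp_verts -[set_val _]/(@transitive_comp data_graph v) transitive_compE.
Qed.

Lemma comp_vx_cls v : gcls (comp_vx (vcomp v)) = gcls v.
Proof. by apply/esym/comp_vertsE; exact: vcompP. Qed.

Lemma comp_vx_free v : gfree v -> comp_vx (vcomp v) = v.
Proof. by move=> fv; apply: gfree_uniq => //; exact: comp_vx_cls. Qed.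

Lemma comp_lt_edge (p : comp) e : comp_verts p (gsource e) ->
  glt (gcls (grange e)) (gcls (gsource e)) ->
  exists q, comp_lt q p /\ comp_verts q (grange e).
Proof.
move=> pe rs; exists (vcomp (grange e)); split; last exact: vcompP.
split; last first.
  move=> /(congr1 (fun q => gcls (comp_vx q))) h; move: rs.
  by rewrite -(comp_vx_cls (grange e)) h (iffLR (comp_vertsE _ _) pe) glt_irr.
exists (grange e), (gsource e); split=> //; first exact: vcompP.
by exists [:: e].
Qed.

Definition dfree : set comp := [set p | gfree (comp_vx p)].
Definition dsub (p : comp) : set gedge :=
  if gfree (comp_vx p) then loop_edges (comp_vx p) else class_edges (comp_vx p).
Definition dk (p : comp) : nat := size (grels (comp_vx p)).
Definition dg (p : comp) (i : 'I_(dk p)) : nat := (size (grow (comp_vx p) i)).-1.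
Definition dalpha (p : comp) (i : 'I_(dk p)) : gedge :=
  Gedge (edge_pred0 (ltn_ord i)).

Lemma dbeta_proof (p : comp) (i : 'I_(dk p)) (t : 'I_(dg i)) :
  edge_pred (comp_vx p, i : nat, t.+1).
Proof.
rewrite /edge_pred /= (ltn_ord i) /=; have := grow_size (ltn_ord i).
by case: t => t /=; rewrite /dg; case: (size _).
Qed.

Definition dbeta (p : comp) (i : 'I_(dk p)) (t : 'I_(dg i)) : gedge :=
  Gedge (dbeta_proof t).

Lemma free_comp (p : comp) v : dfree p -> comp_verts p v -> v = comp_vx p.
Proof. by move=> fp /comp_vertsE; exact: gfree_uniq. Qed.

Lemma free_blockE (p : comp) (i : 'I_(dk p)) :
  free_block (dalpha i : edge data_graph) (@dbeta p i) = gblock_set (comp_vx p) i.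
Proof.
rewrite eqEsubset; split=> e.
  by move=> [->|[t _ <-]].
move=> [ev ei]; have [e0|e0] := eqVneq (gpos e) 0%N.
  by left; apply: gedge_eq.
right; have tg : ((gpos e).-1 < dg i)%N.
  rewrite /dg; have := gpos_lt e; rewrite ev ei.
  by case: (gpos e) e0 => // t _; case: (size _).
exists (Ordinal tg) => //; apply: gedge_eq => //=.
by rewrite /gpos /= prednK // lt0n.
Qed.

Lemma comp_minimalP (p : comp) : dfree p -> comp_minimal p <-> grels (comp_vx p) = [::].
Proof.
move=> fp; split=> [minp|r0 q]; last first.
  move=> [v [w [/comp_vertsE vq wp [s ws]]]].
  have we : w = comp_vx p by exact: free_comp.
  subst w; case: s ws => [|e s] /= ws; first by apply: comp_inj; rewrite -vq ws.
  by case: ws => _ es _; have := gblock_lt e; rewrite [gsource e]es r0.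
case rE: (grels (comp_vx p)) => [//|X r]; exfalso.
have i0 : (0 < size (grels (comp_vx p)))%N by rewrite rE.
have ep : edge_pred (comp_vx p, 0%N, 1%N) by rewrite /edge_pred /= i0 grow_size.
have [|q [[qp nqp] _]] := @comp_lt_edge p (Gedge ep) (comp_vx_mem p).
  exact: grange_lower.
by apply: nqp; exact: minp.
Qed.

(** Closed with [Defined]: the relations of the semigroup are later used with [ad_alpha], [ad_beta]
    and [ad_k] computing to [dalpha], [dbeta] and [dk]. *)
Definition data_adaptable : adaptable data_graph.
Proof.
apply: (@Adaptable data_graph dfree dsub dk dg dalpha dbeta).
- move=> v X [i iv <-].
  pose e0 := Gedge (edge_pred0 iv).
  apply: (@sub_finite_set _ _ [set insubd e0 (v, i, t) | t in `I_(size (grow v i))]).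
    move=> e [ev ei]; exists (gpos e); first by rewrite /= -ev -ei; exact: gpos_lt.
    by rewrite -ev -ei gedgeE; apply: val_inj; rewrite val_insubd (valP e).
  exact/finite_image/finite_II.
- have [[p0 _]|np] := pselect (exists p : comp, True); last first.
    by apply: (@sub_finite_set _ _ set0) => // p _; case: np; exists p.
  (* A component is determined by its class, so picking one for each of the finitely many classes
     reaches all; [p0] fills in for classes without vertices. *)
  apply: (@sub_finite_set _ _
    [set xget p0 [set p | gcls (comp_vx p) = i] | i in [set: 'I_(gncls D)]]).
    move=> p _; exists (gcls (comp_vx p)) => //.
    by case: xgetP => [q _ /= /comp_inj //|/(_ p) []].
  exact/finite_image/finite_finset.
- move=> p e; rewrite /dsub; case: ifP => fp [es er].
    by rewrite /= grange_loop // es; split; exact: comp_vx_mem.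
  by split; apply/comp_vertsE.
- move=> p /negP fp v w /comp_vertsE vp /comp_vertsE wp.
  by rewrite /dsub (negPf fp); exact: class_path.
- move=> p /negP fp v /comp_vertsE vp.
  have rv : ~~ gfree v by rewrite (gfree_cls vp).
  have [w [X [rE _ _]]] := greg_rel rv.
  have i0 : (0 < size (grels v))%N by rewrite rE.
  pose e0 := Gedge (edge_pred0 i0).
  apply: (@sub_finite_set _ _ [set insubd e0 (v, 0%N, t) | t in `I_(size (grow v 0))]).
    move=> e [_ /= ev]; have ei : gblock e = 0%N.
      by have := gblock_lt e; rewrite ev rE ltnS leqn0 => /eqP.
    exists (gpos e); first by rewrite /= -ev -{1}ei; exact: gpos_lt.
    by rewrite -ev -ei gedgeE; apply: val_inj; rewrite val_insubd (valP e).
  exact/finite_image/finite_II.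
- move=> p fp; exists (comp_vx p); rewrite eqEsubset.
  by split=> v; [exact: free_comp|move=> ->; exact: comp_vx_mem].
- move=> p /negP fp v /comp_vertsE vp.
  have rv : ~~ gfree v by rewrite (gfree_cls vp).
  have [w [X [rE _ _]]] := greg_rel rv; exists (gblock_set v 0).
  rewrite /= /gsep rE eqEsubset; split=> Y.
    by move=> [i]; rewrite /= ltnS leqn0 => /eqP-> <-.
  by move=> ->; exists 0%N.
- move=> p /negP fp v /comp_vertsE vp.
  have rv : ~~ gfree v by rewrite (gfree_cls vp).
  have [w [X [rE wv _]]] := greg_rel rv.
  have p0 : edge_pred (v, 0%N, 0%N) by rewrite /edge_pred /grow /= rE.
  have p1 : edge_pred (v, 0%N, 1%N) by rewrite /edge_pred /grow /= rE.
  exists (Gedge p0), (Gedge p1); split=> //; rewrite /dsub (negPf fp).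
    by split=> //=; rewrite grange_loop.
  by split=> //=; rewrite /grange /grow /gsource /gblock /gpos /= rE /= wv.
- move=> p /negP fp e /comp_vertsE ep; rewrite /dsub (negPf fp).
  have [re|re] := grange_cls e; first by left; split=> //; rewrite re.
  by right; apply: comp_lt_edge => //; exact/comp_vertsE.
- move=> p fp v /(free_comp fp)->; rewrite comp_minimalP //; split=> [e0|r0].
    case rE: (grels (comp_vx p)) => [//|X r]; exfalso.
    have i0 : (0 < size (grels (comp_vx p)))%N by rewrite rE.
    have : (@esrc data_graph @^-1` [set comp_vx p]) (Gedge (edge_pred0 i0)) by [].
    by rewrite e0.
  rewrite -subset0 => e /= es; have := gblock_lt e; by rewrite [gsource e]es r0.
- by move=> p fp /(comp_minimalP fp) r0; rewrite /dk r0.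
- move=> p fp _ v /(free_comp fp)->; rewrite /= /gsep eqEsubset; split=> X.
    by move=> [i ik <-]; exists (Ordinal ik) => //; rewrite free_blockE.
  by move=> [i _ <-]; exists i; rewrite /= ?free_blockE // ltn_ord.
- move=> p fp i j; rewrite !free_blockE => /gblock_set_inj ij.
  by apply: val_inj; exact: ij.
- by move=> p i fp s t /(congr1 gpos)[st]; apply: val_inj.
- by move=> p i fp; rewrite /dg; have := grow_size (ltn_ord i); case: (size _) => [|[]].
- by move=> p i fp v /(free_comp fp)->; split=> //=; exact: grange_loop.
- move=> p i t fp; apply: (comp_lt_edge (e := dbeta t)); first exact: comp_vx_mem.
  exact: grange_lower.
- move=> p fp; rewrite /dsub fp eqEsubset; split=> e.
    move=> [ev e0]; have ei : (gblock e < dk p)%N by rewrite /dk -ev; exact: gblock_lt.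
    by exists (Ordinal ei) => //; apply: gedge_eq.
  by move=> [i _ <-].
Defined.

End SeparatedGraphOfData.

Local Open Scope group_scope.
Local Notation "x ^*" := (star x) : group_scope.

(** * Topology of the tight groupoid *)

Section TightSpace.
Variable S : inverseSemigroupType.
Implicit Types (e f z : S) (x y : tight_space S).

Lemma tight_cvg (F : set_system (tight_space S)) (FF : Filter F) x :
  (forall e, set_val x e -> F (tight_dom e)) ->
  (forall e, idem e -> ~ set_val x e -> F (~` tight_dom e)) -> F --> x.
Proof.
move=> Fin Fout W [U [[B oB <-] Bx UW]].
suff cv : (@tight_indicator S) @ F --> tight_indicator x.
  by apply: filterS UW _; apply: cv; apply: open_nbhs_nbhs.
apply/cvg_sup => u; apply/cvg_image.
  rewrite eqEsubset; split=> [//|b _].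
  by exists (fun=> b).
move=> A; rewrite nbhs_simpl /= => Ax; exists [set p | A (p u)]; last first.
  rewrite eqEsubset; split=> [b [p Ap <-] //|b Ab]; by exists (fun=> b).
have {}Ax : A (tight_indicator x u) by exact: nbhs_singleton.
case: (boolP (tight_indicator x u)) => [/asboolP xu|/asboolPn xu].
  apply: filterS (Fin _ xu) => y yu /=.
  by rewrite -[X in A X](_ : tight_indicator x u = _) // /tight_indicator !asboolT.
apply: filterS (Fout _ (svalP u) xu) => y yu /=.
by rewrite -[X in A X](_ : tight_indicator x u = _) // /tight_indicator !asboolF.
Qed.

Lemma tight_dom_idem e x : tight_dom e x -> idem e.
Proof. exact: tight_idem. Qed.

Lemma tight_indicator_nbhs x (u : {e : S | idem e}) :
  nbhs x [set y | tight_indicator y u = tight_indicator x u].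
Proof.
have /cvg_sup/(_ u) h := @initial_continuous _ _ (@tight_indicator S) x.
suff : (@tight_indicator S @ nbhs x) [set p | p u = tight_indicator x u] by [].
apply: h => /=; first by apply: fmap_filter; exact: nbhs_filter.
exists [set p | p u = tight_indicator x u]; split=> //.
exists [set tight_indicator x u] => //.
exact: discrete_open.
Qed.

Lemma tight_dom_open e : open (@tight_dom S e).
Proof.
rewrite openE => x xe; have ee := tight_idem xe.
apply: filterS (tight_indicator_nbhs x (exist _ e ee)) => y /=.
by rewrite /tight_indicator /= [RHS]asboolT // => /asboolP.
Qed.

Lemma tight_domC_open e : open (~` @tight_dom S e).
Proof.
have [ee|nee] := pselect (idem e); last first.
  have -> : tight_dom e = set0 by rewrite -subset0 => x /tight_dom_idem.
  by rewrite setC0; exact: openT.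
rewrite openE => x xe.
apply: filterS (tight_indicator_nbhs x (exist _ e ee)) => y /=.
by rewrite /tight_indicator /= [RHS]asboolF // => /asboolPn.
Qed.

Lemma tight_hausdorff : hausdorff_space (tight_space S).
Proof.
rewrite open_hausdorff => x y xy.
have [e [xye|yxe]] : exists e, (set_val x e /\ ~ set_val y e) \/
    (set_val y e /\ ~ set_val x e).
  apply: contrapT => /forallNP h; move/eqP: xy; apply; apply: tight_space_inj.
  rewrite eqEsubset; split=> e xe; apply: contrapT => ye; apply: (h e).
    by left.
  by right.
- exists (tight_dom e, ~` tight_dom e) => /=; rewrite ?inE //.
  by rewrite setICr; split=> //; [exact: tight_dom_open|exact: tight_domC_open].
- exists (~` tight_dom e, tight_dom e) => /=; rewrite ?inE; first by split; case: yxe.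
  by rewrite setICl; split=> //; [exact: tight_domC_open|exact: tight_dom_open].
Qed.

Lemma tight_domM e f : idem e -> idem f ->
  @tight_dom S (e * f) = tight_dom e `&` tight_dom f.
Proof.
move=> ee ff; rewrite eqEsubset; split=> x /=; last by case; exact: tightM.
move=> xef; split; apply: (tightS xef) => //; last by rewrite -mulgA ff.
by rewrite (idemC ee ff) -mulgA ee.
Qed.

Lemma tight_domS e f : idem f -> e * f = e ->
  @tight_dom S e `<=` tight_dom f.
Proof. by move=> ff ef x xe; apply: (tightS xe). Qed.

Lemma tight_dom0 : @tight_dom S szero = set0.
Proof.
by rewrite -subset0 => x x0; have [_ _ + _ _] := tight_filter x; apply.
Qed.

(** An ultrafilter [F] converges to the set [eta] of the idempotents whose cylinders it contains.
    This set is tight: if it missed a finite cover of its member f, then [F] would contain the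
    cylinder of f minus those of the cover, which is empty. *)
Lemma tight_dom_compact e : compact (@tight_dom S e).
Proof.
rewrite compact_ultra => F FU Fe.
pose eta := [set f | idem f /\ F (tight_dom f)].
have ee : idem e by have [y ye] := filter_ex Fe; exact: tight_idem ye.
have [x [xe Fx]] : exists x : tight_space S, F (tight_dom e) /\ set_val x = eta; last first.
  exists x; split.
    by rewrite /tight_dom /= Fx.
  apply: tight_cvg => [f|f ff]; first by rewrite Fx => -[].
  rewrite Fx => nf; have [Ff|//] := in_ultra_setVsetC (tight_dom f) FU.
  by case: nf.
have eta_filter : is_filter eta.
  split=> [f []//||[_]|f g [ff Ff] [gg Fg]|f g [ff Ff] gg fg].
  - by exists e.
  - by rewrite tight_dom0 => /filter_not_empty.
  - by split; [exact: idemM|rewrite tight_domM //; exact: filterI].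
  - by split=> //; apply: filterS Ff; exact: tight_domS.
have eta_tight : is_tight eta.
  move=> f [ff Ff] Z cZ; apply: contrapT => nZ.
  have [/finite_seqP[s ZE] Zf _] := cZ.
  have ZC z : Z z -> F (~` tight_dom z).
    move=> Zz; have [Fz|//] := in_ultra_setVsetC (tight_dom z) FU.
    by case: nZ; exists z; split=> //; split=> //; have [] := Zf z Zz.
  have {ZC} : F (tight_dom f `&` [set x | forall z, Z z -> ~ set_val x z]).
    apply: filterI => //; move: ZC; rewrite {}ZE; elim: s {Zf nZ cZ} => [|z s IH] ZC.
      by apply: filterS filterT => x _ z.
    have Fs : F [set x | forall z', [set` s] z' -> ~ set_val x z'].
      by apply: IH => z' zs; apply: ZC; rewrite /= inE zs orbT.
    have Fz : F (~` tight_dom z) by apply: ZC; rewrite /= mem_head.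
    apply: filterS (filterI Fz Fs) => x [xz xs] z' /=.
    by rewrite inE => /orP[/eqP->//|]; exact: xs.
  move=> /filter_ex[x [xf xZ]].
  by have [z [Zz xz]] := tight_tight xf cZ; exact: xZ xz.
by exists (exist _ eta (mem_set (conj eta_filter eta_tight))).
Qed.

(** The cylinders with finitely many others removed generate a filter that converges to [x] by
    [tight_cvg], hence contains every neighbourhood of [x]. *)
Lemma tight_nbhs x (W : set (tight_space S)) : nbhs x W ->
  exists e (Z : seq S), [/\ set_val x e, forall z, z \in Z -> idem z /\ ~ set_val x z
    & forall y, set_val y e -> (forall z, z \in Z -> ~ set_val y z) -> W y].
Proof.
pose F : set_system (tight_space S) := [set W | exists e (Z : seq S),
  [/\ set_val x e, forall z, z \in Z -> idem z /\ ~ set_val x z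
    & forall y, set_val y e -> (forall z, z \in Z -> ~ set_val y z) -> W y]].
have [_ [e0 xe0] _ _ _] := tight_filter x.
suff: F --> x by apply.
have FF : Filter F.
  split=> [|P Q [e [Z [xe xZ P_]]] [f [Z' [xf xZ' Q_]]]|P Q PQ [e [Z [xe xZ P_]]]].
  - by exists e0, [::]; split.
  - have ee := tight_idem xe; have ff := tight_idem xf.
    exists (e * f), (Z ++ Z'); split; first exact: tightM.
      by move=> z; rewrite mem_cat => /orP[/xZ|/xZ'].
    move=> y yef yZ.
    have [ye yf] : (tight_dom e `&` tight_dom f) y by rewrite -tight_domM.
    split.
      by apply: P_ => // z zZ; apply: yZ; rewrite mem_cat zZ.
    by apply: Q_ => // z zZ; apply: yZ; rewrite mem_cat zZ orbT.
  - by exists e, Z; split=> // y ye yZ; apply: PQ; exact: P_.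
apply: tight_cvg => [e xe|e ee xe].
  by exists e, [::]; split.
exists e0, [:: e]; split=> // [z|y _]; first by rewrite inE => /eqP->.
by apply; rewrite mem_head.
Qed.

Lemma tight_nbhs_compact x (W : set (tight_space S)) : nbhs x W ->
  exists K, [/\ compact K, open K, K x & K `<=` W].
Proof.
move=> /tight_nbhs[e [Z [xe xZ W_]]].
exists (tight_dom e `&` [set y | forall z, z \in Z -> ~ set_val y z]).
have cl : forall Z' : seq S, closed [set y : tight_space S | forall z, z \in Z' -> ~ set_val y z]
  /\ open [set y : tight_space S | forall z, z \in Z' -> ~ set_val y z].
  elim=> [|z Z' [IH1 IH2]].
    rewrite (_ : [set y | _] = setT); first by split; [exact: closedT|exact: openT].
    by rewrite eqEsubset; split.
  rewrite (_ : [set y | _] = ~` tight_dom z `&`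
      [set y | forall z, z \in Z' -> ~ set_val y z]).
    split; [apply: closedI => //|apply: openI => //]; last exact: tight_domC_open.
    by apply: open_closedC; exact: tight_dom_open.
  rewrite eqEsubset; split=> y /=.
    move=> h; split; first by apply: h; rewrite mem_head.
    by move=> z' z'Z; apply: h; rewrite inE z'Z orbT.
  by move=> [yz yZ] z'; rewrite inE => /orP[/eqP->//|]; exact: yZ.
have [clZ opZ] := cl Z; split.
- by apply: compact_closedI => //; exact: tight_dom_compact.
- by apply: openI => //; exact: tight_dom_open.
- by split=> // z /xZ[].
- by move=> y [ye yZ]; exact: W_.
Qed.

Lemma tight_locally_compact : locally_compact [set: tight_space S].
Proof.
move=> x _; have [K [Kc Ko Kx _]] := tight_nbhs_compact (filterT : nbhs x setT).
rewrite withinET; exists K; first exact: open_nbhs_nbhs.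
by split=> //; apply: compact_closed => //; exact: tight_hausdorff.
Qed.

Lemma act_open_preimage s (U : set (tight_space S)) : open U ->
  open [set x | exists xs : tight_dom (s^* * s) x, U (act xs)].
Proof.
move=> oU; rewrite openE => x [xs Ux].
have /tight_nbhs[e [Z [xe xZ UW]]] : nbhs (act xs) U by exact: open_nbhs_nbhs.
have [ee xse] := (actP xs e).1 xe.
have Zopen : forall Z' : seq S, (forall z, z \in Z' -> idem z /\ ~ set_val (act xs) z) ->
    nbhs x [set y | forall z, z \in Z' -> ~ set_val y (s^* * z * s)].
  elim=> [|z Z' IH] Z'P; first by apply: filterS filterT => y _ z.
  have [|zz xz] := Z'P z; first by rewrite mem_head.
  have nz : nbhs x (~` tight_dom (s^* * z * s)).
    apply: open_nbhs_nbhs; split; first exact: tight_domC_open.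
    by move=> xsz; apply: xz; apply/actP.
  have nZ : nbhs x [set y | forall z, z \in Z' -> ~ set_val y (s^* * z * s)].
    by apply: IH => z' z'Z; apply: Z'P; rewrite inE z'Z orbT.
  apply: filterS (filterI nz nZ) => y [yz yZ] z'.
  by rewrite inE => /orP[/eqP->//|]; exact: yZ.
have ns : nbhs x (tight_dom (s^* * s)) by apply: open_nbhs_nbhs; split=> //; exact: tight_dom_open.
have ne : nbhs x (tight_dom (s^* * e * s)).
  by apply: open_nbhs_nbhs; split=> //; exact: tight_dom_open.
apply: filterS (filterI ns (filterI ne (Zopen Z xZ))) => y [ys [ye yZ]].
exists ys; apply: UW; first by apply/actP.
by move=> z zZ /actP[_]; exact: yZ.
Qed.

End TightSpace.

(** * Topology of germs and continuity of the groupoid operations *)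

Section GermTopology.
Variable S : inverseSemigroupType.
Implicit Types (e f z s t : S) (x y : tight_space S) (g h : germ S).
Implicit Type U V : set (tight_space S).

Lemma germ_setP s U t x (xt : tight_dom (t^* * t) x) :
  germ_set s U (mkgerm xt) <->
  [/\ U x, tight_dom (s^* * s) x & exists2 f, set_val x f & t * f = s * f].
Proof.
split=> [[y [ys [Uy /mkgerm_eq[xy [f [ff xf tsf]]]]]]|[Ux xs [f xf tsf]]].
  by subst y; split=> //; exists f.
exists x, xs; split=> //; apply/mkgerm_eq; split=> //; exists f.
by split=> //; exact: tight_idem xf.
Qed.

Lemma germ_set_mk s U x (xs : tight_dom (s^* * s) x) : U x ->
  germ_set s U (mkgerm xs).
Proof. by move=> Ux; exists x, xs. Qed.

Lemma germ_set_open s U : open U -> U `<=` tight_dom (s^* * s) ->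
  open (germ_set s U).
Proof.
move=> oU Us; exists [set germ_set s U]; last first.
  by rewrite eqEsubset; split=> [g [_ -> //]|g gU]; exists (germ_set s U).
move=> _ ->; exists [fset germ_set s U]%fset.
  by move=> W; rewrite in_fset1 => /eqP->; apply/mem_set; exists s, U.
rewrite eqEsubset; split=> g; first by move=> /(_ (germ_set s U)); apply; rewrite /= in_fset1.
by move=> gU W; rewrite /= in_fset1 => /eqP->.
Qed.

(** One fixed [s] suffices: a subbasic set containing the germ is given by some t that agrees with
    [s] below an idempotent of [x], so near [x] it is described by [s] as well. *)
Lemma germ_nbhs s x (xs : tight_dom (s^* * s) x) (W : set (germ S)) :
  nbhs (mkgerm xs) W -> exists U, [/\ open U, U x, U `<=` tight_dom (s^* * s)
    & germ_set s U `<=` W].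
Proof.
pose F : set_system (germ S) := [set W | exists U,
  [/\ open U, U x, U `<=` tight_dom (s^* * s) & germ_set s U `<=` W]].
have FF : Filter F.
  split=> [|P Q [U [oU Ux Us UP]] [V [oV Vx Vs VQ]]|P Q PQ [U [oU Ux Us UP]]].
  - by exists (tight_dom (s^* * s)); split=> //; exact: tight_dom_open.
  - exists (U `&` V); split=> [|//|y []/Us //|_ [y [ys [[Uy Vy] ->]]]].
      exact: openI.
    by split; [apply: UP|apply: VQ]; exact: germ_set_mk.
  - by exists U; split=> //; exact: subset_trans PQ.
suff: F --> mkgerm xs by apply.
move=> A /=; rewrite nbhsE => -[_ [[B sB <-] [C BC Cg] sUBA]].
apply: filterS sUBA _; apply: (@filterS _ _ _ C).
  by move=> h Ch; exists C.
have [L Lsub LC] := sB _ BC; rewrite -LC.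
apply: filter_bigI => D DL.
have /set_mem[t [V [oV Vt DE]]] : D \in @germ_subbase S := Lsub _ DL.
have : D (mkgerm xs) by move: Cg; rewrite -LC; apply.
rewrite /= {}DE => /germ_setP[Vx xt [f xf stf]].
exists (V `&` tight_dom f `&` tight_dom (s^* * s)); split=> //.
- by apply: openI; [apply: openI => //|]; exact: tight_dom_open.
- move=> _ [y [ys [[[Vy yf] _] ->]]]; apply/germ_setP; split=> //; first exact: Vt.
  by exists f.
Qed.

Lemma germ_src_continuous : continuous (@germ_src S).
Proof.
move=> g W; have [s [x [xs ->]]] := germP g; rewrite germ_srcE nbhsE.
move=> [U [oU Ux] UW].
apply: (@filterS _ _ _ (germ_set s (U `&` tight_dom (s^* * s)))).
  by move=> _ [y [ys [[Uy _] ->]]]; rewrite /= germ_srcE; exact: UW.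
apply: open_nbhs_nbhs; split; last exact: germ_set_mk.
apply: germ_set_open; last by move=> y [].
by apply: openI => //; exact: tight_dom_open.
Qed.

Lemma germ_nbhs_set s x (xs : tight_dom (s^* * s) x) U :
  open U -> U x -> nbhs (mkgerm xs) (germ_set s (U `&` tight_dom (s^* * s))).
Proof.
move=> oU Ux; apply: open_nbhs_nbhs; split; last exact: germ_set_mk.
apply: germ_set_open; last by move=> y [].
by apply: openI => //; exact: tight_dom_open.
Qed.

Lemma germ_rng_continuous : continuous (@germ_rng S).
Proof.
move=> g W; have [s [x [xs ->]]] := germP g; rewrite germ_rngE nbhsE.
move=> [U [oU Ux] UW].
have oV := act_open_preimage s oU.
apply: filterS (germ_nbhs_set xs oV _) => [|/=]; last by exists xs.
move=> _ [y [ys [[[ys' Uy] _] ->]]]; rewrite /= germ_rngE; apply: UW.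
by rewrite (Prop_irrelevance ys ys').
Qed.

Lemma germ_id_continuous : continuous (@germ_id S).
Proof.
move=> x W; rewrite (germ_idE (tight_eltP x)).
move=> /germ_nbhs[U [oU Ux Ue UW]].
have nU : nbhs x U by exact: open_nbhs_nbhs.
apply: filterS (filterI nU _) => [y [Uy ye]|]; last first.
  apply: open_nbhs_nbhs; split; first exact: (tight_dom_open (tight_elt x)).
  exact: tight_eltP.
by rewrite /= (germ_idE ye); apply: UW; exact: germ_set_mk.
Qed.

Lemma germ_inv_continuous : continuous (@germ_inv S).
Proof.
move=> g W; have [s [x [xs ->]]] := germP g; rewrite germ_invE.
move=> /germ_nbhs[U [oU Ux Us UW]].
have oV := act_open_preimage s oU.
apply: filterS (germ_nbhs_set xs oV _) => [|/=]; last by exists xs.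
move=> _ [y [ys [[[ys' Uy] _] ->]]]; rewrite /= germ_invE; apply: UW.
by apply: germ_set_mk; rewrite (Prop_irrelevance ys ys').
Qed.

Lemma germ_mul_continuous : continuous (@gmul_pair (Gtight S)).
Proof.
move=> z W; rewrite /gmul_pair /=.
case: z => -[g h] gh /=; move: (set_mem _) => /= c.
have [s [t [x [xt [xs [gE hE]]]]]] := germ_composable c.
move: gE hE => /= gE hE; subst g h.
rewrite germ_mulE => /germ_nbhs[U [oU Ux Ust UW]].
have nh : nbhs (mkgerm xt) (germ_set t (U `&` tight_dom (t^* * t))).
  exact: germ_nbhs_set.
have ng : nbhs (mkgerm xs) (germ_set s (setT `&` tight_dom (s^* * s))).
  by apply: germ_nbhs_set => //; exact: openT.
have : nbhs (mkgerm xs, mkgerm xt) (germ_set s (setT `&` tight_dom (s^* * s)) `*`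
    germ_set t (U `&` tight_dom (t^* * t))) by exists (germ_set s (setT `&` tight_dom (s^* * s)), germ_set t (U `&` tight_dom (t^* * t))).
move=> nst.
pose z0 : set_type (@composable (Gtight S)) := exist _ (mkgerm xs, mkgerm xt) gh.
have nz : nbhs z0 [set z | (germ_set s (setT `&` tight_dom (s^* * s)) `*`
    germ_set t (U `&` tight_dom (t^* * t))) (set_val z)].
  exact: (@initial_continuous _ _ (@set_val _ (@composable (Gtight S))) z0 _ nst).
apply: filterS nz => -[[g h] gh'] /= [[y [ys [_ gE]]] [y' [yt [[Uy _] hE]]]].
move: gE hE => /= gE hE; subst g h; move: (set_mem _) => /= c'.
have yy := c'; rewrite /composable /= germ_srcE germ_rngE in yy; subst y.
by rewrite germ_mulE; apply: UW; exact: germ_set_mk.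
Qed.

End GermTopology.

Lemma ultra_fmap (T U : Type) (f : T -> U) (F : set_system T) :
  UltraFilter F -> UltraFilter (f @ F).
Proof.
move=> FU; split; first exact: fmap_proper_filter.
move=> G GF FG; rewrite eqEsubset; split=> [A GA|//].
have [//|FnA] := in_ultra_setVsetC (f @^-1` A) FU.
have GnA : G (~` A) by apply: FG; exact: FnA.
by have [z []] := filter_ex (filterI GA GnA).
Qed.

(** * Ampleness and the Hausdorff property *)

Section GermAmple.
Variable S : inverseSemigroupType.
Implicit Types (e f z s t : S) (x y : tight_space S) (g h : germ S).
Implicit Type U V K : set (tight_space S).

Lemma act_inj s x y (xs : tight_dom (s^* * s) x) (ys : tight_dom (s^* * s) y) :
  act xs = act ys -> x = y.
Proof.
move=> xy; rewrite -(act_inv xs) -(act_inv ys); apply: tight_space_inj.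
change (act_set s^* (set_val (act xs)) = act_set s^* (set_val (act ys))).
by rewrite xy.
Qed.

Lemma germ_set_compact s K : compact K -> K `<=` tight_dom (s^* * s) ->
  compact (germ_set s K).
Proof.
rewrite !compact_ultra => cK Ks F FU FK.
have [x [Kx Fx]] : K `&` [set p | @germ_src S @ F --> p] !=set0.
  apply: (cK (@germ_src S @ F) (ultra_fmap (@germ_src S) FU)).
  suff: F (@germ_src S @^-1` K) by [].
  apply: filterS FK => _ [y [ys [Ky ->]]].
  by rewrite /= germ_srcE.
have xs := Ks _ Kx; exists (mkgerm xs); split; first exact: germ_set_mk.
move=> W /germ_nbhs[U [oU Ux Us UW]].
have FUx : F (@germ_src S @^-1` U) by apply: Fx; exact: open_nbhs_nbhs.
apply: filterS (filterI FK FUx) => g [[y [ys [Ky ->]]]].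
rewrite /= germ_srcE => Uy; apply: UW; exact: germ_set_mk.
Qed.

Lemma germ_set_src_inj s U : set_inj (germ_set s U) (@germ_src S).
Proof.
move=> g h /set_mem[x [xs [_ ->]]] /set_mem[y [ys [_ ->]]].
by rewrite !germ_srcE => xy; subst y; exact: mkgerm_eqs.
Qed.

Lemma germ_set_rng_inj s U : set_inj (germ_set s U) (@germ_rng S).
Proof.
move=> g h /set_mem[x [xs [_ ->]]] /set_mem[y [ys [_ ->]]].
by rewrite !germ_rngE => /act_inj xy; subst y; exact: mkgerm_eqs.
Qed.

Lemma germ_set_bisection s K : compact K -> open K ->
  K `<=` tight_dom (s^* * s) -> @compact_open_bisection (Gtight S) (germ_set s K).
Proof.
move=> cK oK Ks; split.
- by split; [exact: germ_set_compact|exact: germ_set_open].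
- exact: germ_set_src_inj.
- exact: germ_set_rng_inj.
Qed.

Lemma germ_local_homeomorphism : local_homeomorphism (@gsrc (Gtight S)).
Proof.
move=> g; have [s [x [xs ->]]] := germP g.
exists (germ_set s (tight_dom (s^* * s))); split.
- by apply: germ_set_open => //; exact: tight_dom_open.
- exact: germ_set_mk.
- exact: germ_set_src_inj.
- by move=> h _; exact: germ_src_continuous.
- move=> V oV Vs; rewrite openE => _ [h Vh <-].
  have [y [ys [_ hE]]] := Vs _ Vh; subst h.
  have [U [oU Uy Us UV]] : exists U, [/\ open U, U y,
      U `<=` tight_dom (s^* * s) & germ_set s U `<=` V].
    by apply: (@germ_nbhs _ _ _ ys); exact: open_nbhs_nbhs.
  have nU : nbhs y U by exact: open_nbhs_nbhs.
  rewrite /interior /= germ_srcE; apply: filterS nU => z Uz.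
  exists (mkgerm (Us _ Uz)); last by rewrite germ_srcE.
  by apply: UV; exact: germ_set_mk.
Qed.

Lemma Gtight_ample : ample (Gtight S).
Proof.
split.
- split; last exact: germ_local_homeomorphism.
  split; [exact: germ_src_continuous|exact: germ_rng_continuous|
    exact: germ_id_continuous|exact: germ_inv_continuous|exact: germ_mul_continuous].
- exact: tight_hausdorff.
- exact: tight_locally_compact.
- move=> g W oW; have [s [x [xs ->]]] := germP g => Wg.
  have [U [oU Ux Us UW]] : exists U, [/\ open U, U x,
      U `<=` tight_dom (s^* * s) & germ_set s U `<=` W].
    by apply: (@germ_nbhs _ _ _ xs); exact: open_nbhs_nbhs.
  have [K [cK oK Kx KU]] := tight_nbhs_compact (open_nbhs_nbhs (conj oU Ux)).
  exists (germ_set s K); split.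
  + by apply: germ_set_bisection => //; exact: subset_trans Us.
  + exact: germ_set_mk.
  + apply: subset_trans UW => _ [y [ys [Ky ->]]].
    by apply: germ_set_mk; exact: KU.
Qed.

Definition Estar_unitary := forall s e, idem e -> e <> szero -> s * e = e -> idem s.

(** The element q = s t^* fixes the nonzero idempotent t f t^* and is therefore idempotent, hence
    also equal to t s^*. This makes s and t agree on their common domain. *)
Lemma Estar_unitary_compatible s t f : Estar_unitary -> idem f -> f <> szero ->
  f * (s^* * s) = f -> s * f = t * f -> s * (t^* * t) = t * (s^* * s).
Proof.
move=> SU ff f0 fs stf; have st := idemVs s; have tt := idemVs t.
have ft : f * (t^* * t) = f.
  have h r : f * (r^* * r) = (r * f)^* * (r * f).
    rewrite starM (idem_star ff).
    have -> : f * r^* * (r * f) = f * (r^* * r * f) by rewrite !mulgA.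
    by rewrite -(idemC ff (idemVs r)) [in RHS]mulgA ff.
  by rewrite h -stf -h.
set q := s * t^*; have qq : idem q.
  apply: (SU _ (t * f * t^*)); first exact: idem_conjV.
    move=> tf0; apply: f0.
    have <- : t^* * (t * f * t^*) * t = f.
      have -> : t^* * (t * f * t^*) * t = t^* * t * (f * (t^* * t)).
        by rewrite !mulgA.
      by rewrite ft (idemC tt ff).
    by rewrite tf0 muls0 mul0s.
  have -> : q * (t * f * t^*) = s * ((t^* * t) * f) * t^* by rewrite !mulgA.
  by rewrite (idemC tt ff) ft stf.
have qE : q = t * s^* by rewrite -(idem_star qq) starM starK.
set w := s * (t^* * t); have wE : w = q * t by rewrite /w mulgA.
have <- : t * (w^* * w) = w.
  rewrite wE starM (idem_star qq).
  have -> : t * (t^* * q * (q * t)) = (t * t^*) * (q * q) * t by rewrite !mulgA.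
  by rewrite qq (idemC (idemsV t) qq) -mulgA mulsVs.
have -> : w^* = t^* * t * s^* by rewrite /w starM (idem_star tt).
rewrite /w.
have -> : t * (t^* * t * s^* * (s * (t^* * t))) = (t * t^* * t) * ((s^* * s) * (t^* * t)).
  by rewrite !mulgA.
by rewrite mulsVs (idemC st tt) !mulgA mulsVs.
Qed.

(** Germs at distinct points are separated by their sources. For germs of s and t at one point, a
    common germ of their bisections over the common domain would make s and t agree on all of it,
    and the two germs would be equal. *)
Lemma Gtight_hausdorff : Estar_unitary -> hausdorff_space (garrow (Gtight S)).
Proof.
move=> SU; rewrite open_hausdorff => g h gh.
have [s [x [xs gE]]] := germP g; have [t [y [yt hE]]] := germP h.
have [xy|xy] := eqVneq x y; last first.
  have := @tight_hausdorff S; rewrite open_hausdorff => /(_ x y xy).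
  move=> [[A B] /= [xA yB] [oA oB /eqP AB]].
  exists (@germ_src S @^-1` A, @germ_src S @^-1` B) => /=.
    by rewrite gE hE !inE /= !germ_srcE; split; exact: set_mem.
  split.
  - by apply: open_comp => // ? _; exact: germ_src_continuous.
  - by apply: open_comp => // ? _; exact: germ_src_continuous.
  - by rewrite -preimage_setI AB preimage_set0.
subst y; pose D := tight_dom (s^* * s) `&` tight_dom (t^* * t).
have oD : open D by apply: openI; exact: tight_dom_open.
exists (germ_set s D, germ_set t D) => /=.
  by rewrite gE hE !inE; split; apply: germ_set_mk.
split; [by apply: germ_set_open => // z []|by apply: germ_set_open => // z []|].
apply/eqP; rewrite -subset0 => _ [[z [zs [[_ zt] ->]]] /germ_setP[_ _ [f zf stf]]].
have ff := tight_idem zf.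
have [f0 fz] : f * (s^* * s) <> szero /\ set_val z (f * (s^* * s)).
  have fz : set_val z (f * (s^* * s)) by exact: tightM.
  by split=> // f0; rewrite f0 in fz; have [_ _ + _ _] := tight_filter z; apply.
have e : s * (t^* * t) = t * (s^* * s).
  apply: (Estar_unitary_compatible SU _ f0).
  - exact: idemM (idemVs s).
  - by rewrite -mulgA (idemVs s).
  - by rewrite !mulgA stf.
move/eqP: gh; apply; rewrite gE hE; apply/mkgerm_eq; split=> //.
exists ((s^* * s) * (t^* * t)); split.
- exact: idemM (idemVs s) (idemVs t).
- exact: tightM.
- rewrite {2}(idemC (idemVs s) (idemVs t)) !mulgA !mulsVs.
  by rewrite -!mulgA.
Qed.

End GermAmple.

(** * Existence of tight filters *)

Section TightNonempty.
Variable S : inverseSemigroupType.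
Implicit Types (e f g z : S) (eta : set S).

(** A maximal filter is tight: if it missed a finite cover of its member f, each element of the
    cover would be orthogonal to some member, and the product of f with these members would be a
    nonzero idempotent below f orthogonal to the whole cover. *)
Lemma tight_dom_neq0 e : idem e -> e <> szero -> exists x, @tight_dom S e x.
Proof.
move=> ee e0.
pose P eta := (eta = set0) \/ (is_filter eta /\ eta e).
have [A [PA Amax]] : exists A, P A /\ forall B, A `<` B -> ~ P B.
  apply: Zorn_bigcup => F FP Ftot.
  have [[eta Feta eta_e]|none] := pselect (exists2 eta, F eta & is_filter eta /\ eta e);
    last first.
    left; rewrite -subset0 => s [eta Feta es].
    by have [e00|h] := FP _ Feta; [rewrite e00 in es|apply: none; exists eta].
  right; have FP' B s : F B -> B s -> is_filter B.
    by move=> FB Bs; have [B0|[]//] := FP _ FB; rewrite B0 in Bs.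
  split; last by exists eta => //; case: eta_e.
  split.
  - by move=> s [B FB Bs]; have [+ _ _ _ _] := FP' _ _ FB Bs; apply.
  - by exists e, eta => //; case: eta_e.
  - by move=> [B FB B0]; have [_ _ + _ _] := FP' _ _ FB B0; apply.
  - move=> f g [B FB Bf] [C FC Cg]; have [BC|CB] := Ftot _ _ FB FC.
      by exists C => //; have [_ _ _ + _] := FP' _ _ FC Cg; apply=> //; exact: BC.
    by exists B => //; have [_ _ _ + _] := FP' _ _ FB Bf; apply=> //; exact: CB.
  - move=> f g [B FB Bf] gg fg; exists B => //.
    by have [_ _ _ _ up] := FP' _ _ FB Bf; exact: up fg.
pose up e' := [set h | idem h /\ e' * h = e'].
have upF e' : idem e' -> e' <> szero -> is_filter (up e').
  move=> ee' e'0; split=> [h []//||[]|f g [ff ef] [gg eg]|f g [ff ef] gg fg].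
  - by exists e'; split.
  - by rewrite muls0 => _ h; apply: e'0.
  - by split; [exact: idemM|rewrite mulgA ef].
  - by split=> //; rewrite -ef -mulgA fg.
have [Afil Ae] : is_filter A /\ A e.
  case: PA => // A0; case: (Amax (up e)); last by right; split; [exact: upF|split].
  rewrite A0; split; first exact: sub0set.
  by move=> /(_ e); apply; split.
have [Aid An0 A0 AM AS] := Afil.
have Atight : is_tight A.
  move=> f Af Z [finZ Zf Zcov]; apply: contrapT => ZA.
  have nz z : Z z -> exists2 g, A g & g * z = szero.
    move=> Zz; apply: contrapT => ng; have [zz zf] := Zf _ Zz.
    have ngz g : A g -> g * z <> szero by move=> Ag gz; apply: ng; exists g.
    (* The filter generated by [A] and z; it is proper when no member of [A] is orthogonal to z, and
       then contradicts the maximality of [A]. *)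
    pose B := [set h | idem h /\ exists2 g, A g & g * z * h = g * z].
    apply: (Amax B).
      split=> [h Ah|BA].
        have hh := Aid _ Ah; split=> //; exists h => //.
        by rewrite -mulgA (idemC zz hh) mulgA hh.
      apply: ZA; exists z; split=> //; apply: BA; split=> //; exists f => //.
      by rewrite -mulgA zz.
    right; split; last first.
      split=> //; exists e => //; by rewrite -mulgA (idemC zz ee) mulgA ee.
    split=> [h []//||[_ [g Ag]]|h k [hh [g Ag gh]] [kk [g' Ag' gk]]|h k [hh [g Ag gh]] kk hk].
    - exists e; split=> //; exists e => //; by rewrite -mulgA (idemC zz ee) mulgA ee.
    - by rewrite muls0 => /esym; exact: ngz.
    - split; first exact: idemM.
      exists (g * g'); first exact: AM.
      have gg := Aid _ Ag; have gg' := Aid _ Ag'.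
      have -> : g * g' * z * (h * k) = g' * (g * z * h) * k.
        by rewrite (idemC gg gg') !mulgA.
      rewrite gh mulgA (idemC gg' gg) -!mulgA; congr (_ * _).
      by rewrite mulgA gk.
    - by split=> //; exists g => //; rewrite -gh -!mulgA hk.
  have [h Ah hZ] : exists2 h, A h & forall z, Z z -> h * z = szero.
    have /finite_seqP[s ZE] := finZ.
    have ns : forall z, z \in s -> exists2 g, A g & g * z = szero.
      by move=> z zs; apply: nz; rewrite ZE.
    have Zs : forall z, Z z -> z \in s by move=> z; rewrite ZE.
    suff [h Ah hs] : exists2 h, A h & forall z, z \in s -> h * z = szero.
      by exists h => // z /Zs /hs.
    elim: s ns {Zs ZE nz} => [|z s IH] ns; first by exists e.
    have [|h Ah hs] := IH; first by move=> z' z's; apply: ns; rewrite inE z's orbT.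
    have [|g Ag gz] := ns z; first by rewrite mem_head.
    have gg := Aid _ Ag; have hh := Aid _ Ah.
    exists (h * g) => [|z']; first exact: AM.
    rewrite inE => /orP[/eqP->|/hs h0]; first by rewrite -mulgA gz muls0.
    by rewrite (idemC hh gg) -mulgA h0 muls0.
  have hh := Aid _ Ah; have ff := Aid _ Af.
  have [||z Zz] := Zcov (h * f) (idemM hh ff).
  - by rewrite -mulgA ff.
  - by move=> hf0; apply: A0; rewrite -hf0; exact: AM.
  by apply; rewrite (idemC hh ff) -mulgA hZ // muls0.
by exists (exist _ A (mem_set (conj Afil Atight))).
Qed.

Lemma tight_dom_set0 e : idem e -> @tight_dom S e = set0 -> e = szero.
Proof.
move=> ee De; apply: contrapT => e0; have [x] := tight_dom_neq0 ee e0.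
by rewrite De.
Qed.

End TightNonempty.

(** * Words in the inverse semigroup *)

Section DataSemigroup.
Variable D : graphData.
Local Notation V := (gvert D).
Local Notation S := (SEC (data_adaptable D)).
Local Notation "0" := (szero : S) : group_scope.
Implicit Types (v w : V) (e f : gedge D) (i : nat) (b : bool).

Definition sv v : S := \pi_(SEC (data_adaptable D))%qT (TGen (GenV (v : vertex (data_graph D)))).
Definition se e : S := \pi_(SEC (data_adaptable D))%qT (TGen (GenE (e : edge (data_graph D)))).
Definition st b i v : S :=
  \pi_(SEC (data_adaptable D))%qT (TGen (GenT b i (v : vertex (data_graph D)))).

Definition kblocks v := size (grels v).

Lemma alpha_edge e : gfree (gsource e) -> gpos e = 0%N ->
  exists i : 'I_(dk (vcomp (gsource e))), dalpha i = e /\ i = gblock e :> nat.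
Proof.
move=> fe e0; have ek : (gblock e < dk (vcomp (gsource e)))%N.
  by rewrite /dk comp_vx_free //; exact: gblock_lt.
exists (Ordinal ek); split=> //; apply: gedge_eq => //.
by rewrite /gsource /= comp_vx_free.
Qed.

Lemma beta_edge e : gfree (gsource e) -> gpos e != 0%N ->
  exists (i : 'I_(dk (vcomp (gsource e)))) (t : 'I_(dg i)),
    dbeta t = e /\ i = gblock e :> nat.
Proof.
move=> fe e0; have ek : (gblock e < dk (vcomp (gsource e)))%N.
  by rewrite /dk comp_vx_free //; exact: gblock_lt.
have tk : ((gpos e).-1 < dg (Ordinal ek))%N.
  rewrite /dg /= comp_vx_free //; have := gpos_lt e.
  by case: (gpos e) e0 => // t _; case: (size _).
exists (Ordinal ek), (Ordinal tk); split=> //; apply: gedge_eq => //.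
  by rewrite /gsource /= comp_vx_free.
by rewrite /gpos /= prednK // lt0n.
Qed.

Lemma free_vcomp v : gfree v -> dfree (vcomp v).
Proof. by move=> fv; rewrite /dfree /= comp_vx_free. Qed.

Local Notation P x := (\pi_(SEC (data_adaptable D))%qT x).

Lemma piM x y : P x * P y = P (TMul x y).
Proof. exact: SEC_mulE. Qed.

Lemma piS x : (P x : S)^* = P (TStar x).
Proof. exact: SEC_starE. Qed.

Lemma pi_eq x y : srel (data_adaptable D) x y -> P x = P y.
Proof. by move=> /SEC_eq. Qed.

Lemma svv v : sv v * sv v = sv v.
Proof. by rewrite piM; apply/pi_eq/srel_R1_idem. Qed.

Lemma sv_orth v w : v <> w -> sv v * sv w = 0.
Proof. by move=> vw; rewrite piM; apply/pi_eq/srel_R1_orth. Qed.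

Lemma sv_star v : (sv v)^* = sv v.
Proof. by rewrite piS; apply/pi_eq/srel_R1_star. Qed.

Lemma sve e : sv (gsource e) * se e = se e.
Proof. by rewrite piM; apply/pi_eq/(srel_R2_src _ (e : edge (data_graph D))). Qed.

Lemma sev e : se e * sv (grange e) = se e.
Proof. by rewrite piM; apply/pi_eq/(srel_R2_rng _ (e : edge (data_graph D))). Qed.

Lemma gblock_sep e : @sep (data_graph D) (gsource e) (gblock_set (gsource e) (gblock e)).
Proof. by exists (gblock e) => //=; exact: gblock_lt. Qed.

Lemma see e : (se e)^* * se e = sv (grange e).
Proof.
by rewrite piS piM; apply/pi_eq/(srel_R2_same _ (gblock_sep e)).
Qed.

Lemma sef e f : gsource e = gsource f -> gblock e = gblock f -> e <> f ->
  (se e)^* * se f = 0.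
Proof.
move=> es eb nef; rewrite piS piM.
by apply/pi_eq/(srel_R2_diff _ (gblock_sep e)).
Qed.

Lemma salpha_comm e f : gfree (gsource e) -> gsource f = gsource e ->
  gpos e = 0%N -> gpos f = 0%N -> gblock e <> gblock f ->
  se e * se f = se f * se e /\ se e * (se f)^* = (se f)^* * se e.
Proof.
move=> fe fs e0 f0 ef; have [i [ie iE]] := alpha_edge fe e0.
have [j] : exists i : 'I_(dk (vcomp (gsource e))), dalpha i = f /\ i = gblock f :> nat.
  by rewrite -fs; apply: alpha_edge; rewrite ?fs.
move=> [jf jE]; have ij : i <> j by move=> h; apply: ef; rewrite -iE -jE h.
rewrite !piS !piM -ie -jf; split; apply/pi_eq.
  exact: (srel_R3 (A := data_adaptable D) (free_vcomp fe) ij).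
exact: (srel_R3_star (A := data_adaptable D) (free_vcomp fe) ij).
Qed.

Lemma sbeta_orth e f : gfree (gsource e) -> gsource f = gsource e ->
  gpos e != 0%N -> gpos f != 0%N -> e <> f -> (se e)^* * se f = 0.
Proof.
move=> fe fs e0 f0 ef; have [i [t [ie _]]] := beta_edge fe e0.
have [j [s [jf _]]] : exists (i : 'I_(dk (vcomp (gsource e)))) (t : 'I_(dg i)),
    dbeta t = f /\ i = gblock f :> nat.
  by rewrite -fs; apply: beta_edge; rewrite ?fs.
rewrite piS piM -ie -jf; apply/pi_eq.
apply: (@srel_R4 _ (data_adaptable D) (vcomp (gsource e)) (Tagged _ t) (Tagged _ s)
  (free_vcomp fe)).
by move=> h; apply: ef; rewrite -ie -jf; move: h => /(congr1 (fun u => dbeta (tagged u))).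
Qed.

Lemma salpha_beta e f : gfree (gsource e) -> gsource f = gsource e ->
  gpos e = 0%N -> gpos f != 0%N -> gblock e <> gblock f ->
  se e * se f = se f * st true (unbump (gblock f) (gblock e)) (grange f) /\
  (se e)^* * se f = se f * st false (unbump (gblock f) (gblock e)) (grange f).
Proof.
move=> fe fs e0 f0 ef; have [i [ie iE]] := alpha_edge fe e0.
have [j [s [jf jE]]] : exists (i : 'I_(dk (vcomp (gsource e)))) (t : 'I_(dg i)),
    dbeta t = f /\ i = gblock f :> nat.
  by rewrite -fs; apply: beta_edge; rewrite ?fs.
have ij : i <> j by move=> h; apply: ef; rewrite -iE -jE h.
rewrite !piS !piM -ie -jf; split; apply/pi_eq.
  exact: (srel_R8 (A := data_adaptable D) s (free_vcomp fe) ij).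
exact: (srel_R8_star (A := data_adaptable D) s (free_vcomp fe) ij).
Qed.

Lemma st_comm b c i j v : st b i v * st c j v = st c j v * st b i v.
Proof. by rewrite !piM; apply/pi_eq/srel_R5_comm. Qed.

Lemma st_inv b i v : st b i v * st (~~ b) i v = sv v.
Proof. by rewrite piM; apply/pi_eq/srel_R5_inv. Qed.

Lemma st_star b i v : (st b i v)^* = st (~~ b) i v.
Proof.
have h : (st true i v)^* = st false i v.
  by rewrite piS; apply/pi_eq/srel_R5_star.
by case: b => //=; rewrite -h starK.
Qed.

Lemma svt b i v : sv v * st b i v = st b i v.
Proof.
have l : sv v * st true i v = st true i v by rewrite piM; apply/pi_eq/srel_R5_left.
have r : st true i v * sv v = st true i v by rewrite piM; apply/pi_eq/srel_R5_right.
by case: b => //; have := congr1 (@star _) r; rewrite starM sv_star st_star.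
Qed.

Lemma stv b i v : st b i v * sv v = st b i v.
Proof. by have := congr1 (@star _) (svt (~~ b) i v); rewrite starM sv_star st_star negbK. Qed.

(* (R6), (R7), (R9): a t-generator is renumbered only by a beta-edge. *)
Definition tshift e i : nat :=
  if gfree (gsource e) && (gpos e != 0%N) then (i + kblocks (gsource e) - 1)%N else i.

Lemma ste_true_false e i :
  st true i (gsource e) * se e = se e * st true (tshift e i) (grange e) ->
  st false i (gsource e) * se e = se e * st false (tshift e i) (grange e).
Proof.
move=> h; have eE : se e = st true i (gsource e) *
    (se e * st false (tshift e i) (grange e)).
  by rewrite mulgA h -mulgA (st_inv true) sev.
by rewrite [in LHS]eE mulgA (st_inv false) mulgA sve.
Qed.

Lemma ste b i e : st b i (gsource e) * se e = se e * st b (tshift e i) (grange e).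
Proof.
case fe0: (gfree (gsource e) && (gpos e != 0%N)).
  rewrite /tshift fe0; case/andP: fe0 => fe e0.
  have [j [s [je _]]] := beta_edge fe e0.
  have : st b i (gsource e) * se (dbeta s) =
      se (dbeta s) * st b (i + dk (vcomp (gsource e)) - 1) (grange (dbeta s)).
    rewrite !piM; apply/pi_eq.
    exact: (@srel_R7 _ (data_adaptable D) (vcomp (gsource e)) (gsource e) j s b i
      (free_vcomp fe) (vcompP (gsource e))).
  by rewrite je /dk comp_vx_free.
have -> : tshift e i = i by rewrite /tshift fe0.
suff h : st true i (gsource e) * se e = se e * st true i (grange e).
  case: b => //; have := @ste_true_false e i; rewrite /tshift fe0; exact.
have [fe|re] := boolP (gfree (gsource e)); last first.
  rewrite !piM; apply/pi_eq.
  apply: (@srel_R6 _ (data_adaptable D) (vcomp (gsource e)) i e).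
    by rewrite /= /dfree /= (gfree_cls (comp_vx_cls _)); exact/negP.
  exact: vcompP.
have e0 : gpos e = 0%N by apply/eqP; move: fe0; rewrite fe /= => /negbFE.
have [j [je _]] := alpha_edge fe e0.
suff : st true i (gsource e) * se (dalpha j) = se (dalpha j) * st true i (gsource e).
  by rewrite je grange_loop.
rewrite !piM; apply/pi_eq.
exact: (@srel_R9 _ (data_adaptable D) (vcomp (gsource e)) (gsource e) j i
  (free_vcomp fe) (vcompP (gsource e))).
Qed.

End DataSemigroup.

(** * Words, least common multiples and the inverse law *)

Section DataWords.
Variable D : graphData.
Local Notation V := (gvert D).
Local Notation S := (SEC (data_adaptable D)).
Local Notation "0" := (szero : S) : group_scope.
Implicit Types (v w x y z : V) (e f : gedge D) (i : nat) (b : bool).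

Inductive pgen := PE of gedge D | PT of bool & nat & V.

Definition psrc g := match g with PE e => gsource e | PT _ _ v => v end.
Definition prng g := match g with PE e => grange e | PT _ _ v => v end.
Definition pval g : S := match g with PE e => se e | PT b i v => st b i v end.

Lemma svp g : sv (psrc g) * pval g = pval g.
Proof. by case: g => [e|b i v] /=; [exact: sve|exact: svt]. Qed.

Lemma spv g : pval g * sv (prng g) = pval g.
Proof. by case: g => [e|b i v] /=; [exact: sev|exact: stv]. Qed.

Lemma spp g : (pval g)^* * pval g = sv (prng g).
Proof.
case: g => [e|b i v] /=; first exact: see.
by rewrite st_star -{2}(negbK b) st_inv.
Qed.

Fixpoint wok v (l : seq pgen) w : Prop :=
  if l is g :: l' then psrc g = v /\ wok (prng g) l' w else v = w.

(** The start is an argument because the empty word at [v] stands for [sv v]. *)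
Fixpoint wval v (l : seq pgen) : S :=
  if l is g :: l' then pval g * wval (prng g) l' else sv v.

Lemma wok_cat v l x l' w : wok v l x -> wok x l' w -> wok v (l ++ l') w.
Proof. by elim: l v => [|g l IH] v /=; [move=> ->|move=> [gv /IH h] /h]. Qed.

Lemma svw v l w : wok v l w -> sv v * wval v l = wval v l.
Proof. by case: l => [|g l] /=; [rewrite svv|move=> [<- _]; rewrite mulgA svp]. Qed.

Lemma swv v l w : wok v l w -> wval v l * sv w = wval v l.
Proof.
by elim: l v => [|g l IH] v /=; [move=> ->; exact: svv|move=> [_ /IH h]; rewrite -mulgA h].
Qed.

Lemma sswv v l w : wok v l w -> (wval v l)^* * sv v = (wval v l)^*.
Proof. by move=> lw; rewrite -{2}(svw lw) starM sv_star. Qed.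

Lemma ssvw v l w : wok v l w -> sv w * (wval v l)^* = (wval v l)^*.
Proof. by move=> lw; rewrite -{2}(swv lw) starM sv_star. Qed.

Lemma sww v l w : wok v l w -> (wval v l)^* * wval v l = sv w.
Proof.
elim: l v => [|g l IH] v /=; first by move=> ->; rewrite sv_star svv.
move=> [_ lw]; rewrite starM -mulgA (mulgA _ (pval g)) spp (svw lw); exact: IH.
Qed.

Lemma wval_cat v l x l' w : wok v l x -> wok x l' w ->
  wval v (l ++ l') = wval v l * wval x l'.
Proof.
elim: l v => [|g l IH] v /=; first by move=> -> /svw.
by move=> [_ lx] l'w; rewrite -mulgA IH.
Qed.

(* Either [l] and [l'] have no common right multiple, or [m] and [m']
   complete them to the least one. *)
Definition wcompl v l x l' y : Prop := (wval v l)^* * wval v l' = 0 \/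
  exists (m m' : seq pgen) z, [/\ wok x m z, wok y m' z, (size m <= size l')%N,
    (size m' <= size l)%N & (wval v l)^* * wval v l' = wval x m * (wval y m')^* /\
    wval v l * wval x m = wval v l' * wval y m'].

Lemma star0 : (0)^* = 0.
Proof. by rewrite -{1}(muls0 0^*) starM starK muls0. Qed.

Lemma wcompl_sym v l x l' y : wcompl v l x l' y -> wcompl v l' y l x.
Proof.
have sE : (wval v l')^* * wval v l = ((wval v l)^* * wval v l')^*.
  by rewrite starM starK.
case=> [h|[u [w [z [ux wy su sw [h1 h2]]]]]]; first by left; rewrite sE h star0.
by right; exists w, u, z; split=> //; rewrite sE h1 starM starK h2.
Qed.

Lemma wval1 v g : wval v [:: g] = pval g.
Proof. exact: spv. Qed.

(** Two t's commute and a t slides past an edge. Distinct edges of one set are orthogonal. Edges of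
    different sets exist only at a free vertex: two loops commute, a loop passes a beta-edge by
    becoming a t, two beta-edges are orthogonal. Each completion has at most one letter. *)
Lemma pcompl g h : psrc g = psrc h ->
  wcompl (psrc g) [:: g] (prng g) [:: h] (prng h).
Proof.
have tt b i c j v : wcompl v [:: PT b i v] v [:: PT c j v] v.
  right; exists [:: PT c j v], [:: PT b i v], v; split=> //=.
  by rewrite !stv !st_star; split; exact: st_comm.
have te b i e : wcompl (gsource e) [:: PT b i (gsource e)] (gsource e)
    [:: PE e] (grange e).
  right; exists [:: PE e], [:: PT b (tshift e i) (grange e)], (grange e).
  by split=> //=; rewrite !stv !sev !st_star; split; exact: ste.
case: g h => [e|b i v] [f|c j w] /= ef.
- have [->|nef] := pselect (e = f).
    right; exists [::], [::], (grange f); split=> //=.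
    by rewrite !sev see sv_star svv.
  have [bef|nbef] := eqVneq (gblock e) (gblock f).
    by left; rewrite /= !sev sef.
  have fe : gfree (gsource e).
    apply: contraT => re; have [w [X [rE _ _]]] := greg_rel re.
    have := gblock_lt e; have := gblock_lt f; rewrite -ef rE !ltnS !leqn0.
    by move=> /eqP f0 /eqP e0; move: nbef; rewrite e0 f0.
  have {}nbef : gblock e <> gblock f by apply/eqP.
  have ab e' f' : gfree (gsource e') -> gsource e' = gsource f' -> gpos e' = 0%N ->
      gpos f' != 0%N -> gblock e' <> gblock f' ->
      wcompl (gsource e') [:: PE e'] (grange e') [:: PE f'] (grange f').
    move=> fe' ef' e0 f0 nb; right.
    have [h1 h2] := salpha_beta fe' (esym ef') e0 f0 nb.
    exists [:: PE f'], [:: PT true (unbump (gblock f') (gblock e')) (grange f')], (grange f').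
    split=> //=; first by rewrite grange_loop.
    by rewrite !sev stv st_star.
  have [e0|e0] := eqVneq (gpos e) 0%N; have [f0|f0] := eqVneq (gpos f) 0%N.
  + right; exists [:: PE f], [:: PE e], (gsource e).
    split=> //=; [by rewrite !grange_loop|by rewrite !grange_loop|].
    rewrite !sev; have [-> _] := salpha_comm fe (esym ef) e0 f0 nbef; split=> //.
    have [||_ <- //] := @salpha_comm D f e _ ef f0 e0; first by rewrite -ef.
    exact: nesym.
  + exact: ab.
  + by rewrite ef; apply: wcompl_sym; apply: ab => //; [rewrite -ef|exact: nesym].
  + by left; rewrite /= !sev sbeta_orth.
- by subst w; exact/wcompl_sym/te.
- by subst v; exact: te.
- by subst w; exact: tt.
Qed.

(** Completing the first letters by at most one letter each leaves three smaller problems, which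
    tile the rectangle with sides [l] and [l']. A completion is never longer than the opposite side,
    so the induction on the total length applies to all three. *)
Lemma wcompl_words v l x l' y : wok v l x -> wok v l' y -> wcompl v l x l' y.
Proof.
have [n] := ubnP (size l + size l'); elim: n v l x l' y => // n IH v l x l' y.
case: l => [_ /= <- l'y|g l].
  right; exists l', [::], y; split=> //=.
  by rewrite !sv_star (svw l'y) (swv l'y).
case: l' => [_ lx /= <-|h l'].
  right; exists [::], (g :: l), x; split=> //.
  by rewrite [wval v [::]]/(sv v) [wval x [::]]/(sv x) (svw lx) (swv lx) (sswv lx)
    (ssvw lx).
move=> ln /= [gv lx] [hv l'y].
have {}ln : ((size l + size l').+1 < n)%N by move: ln; rewrite /= addSn addnS.
have gh : psrc g = psrc h by rewrite gv hv.
have := pcompl gh; rewrite /wcompl !wval1.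
case=> [gh0|[u0 [w0 [z0 [u0k w0k su0 sw0 [gh1 gh2]]]]]].
  left; rewrite starM -mulgA (mulgA _ (pval h)) gh0 mul0s muls0 //.
have mid : (wval v (g :: l))^* * wval v (h :: l') =
    ((wval (prng g) l)^* * wval (prng g) u0) * ((wval (prng h) w0)^* * wval (prng h) l').
  by rewrite /= starM -mulgA (mulgA _ (pval h)) gh1 !mulgA.
have [|e1|[u1 [w1 [z1 [u1k w1k su1 sw1 [e1 f1]]]]]] := IH _ l _ u0 _ _ lx u0k.
- by move: ln su0 => /=; lia.
- by left; rewrite mid e1 mul0s.
have [|e2|[u2 [w2 [z2 [u2k w2k su2 sw2 [e2 f2]]]]]] := IH _ w0 _ l' _ _ w0k l'y.
- by move: ln sw0 => /=; lia.
- by left; rewrite mid e2 muls0.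
have [|e3|[u3 [w3 [z3 [u3k w3k su3 sw3 [e3 f3]]]]]] := IH _ w1 _ u2 _ _ w1k u2k.
- by move: ln su2 sw1 => /=; lia.
- left; rewrite mid e1 e2 -!mulgA (mulgA _ (wval _ u2)) e3.
  by rewrite mul0s muls0.
right; exists (u1 ++ u3), (w2 ++ w3), z3; split.
- exact: wok_cat u1k u3k.
- exact: wok_cat w2k w3k.
- by rewrite size_cat; move: su0 su1 su2 su3 => /=; lia.
- by rewrite size_cat; move: sw0 sw1 sw2 sw3 => /=; lia.
rewrite (wval_cat u1k u3k) (wval_cat w2k w3k); split.
  by rewrite mid e1 e2 -!mulgA (mulgA _ (wval _ u2)) e3 starM !mulgA.
rewrite /= -!mulgA (mulgA _ (wval x u1)) f1 -(mulgA _ _ (wval _ u3)) f3.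
by rewrite !mulgA gh2 -!mulgA (mulgA _ (wval _ u2)) f2 !mulgA.
Qed.

Lemma sec_wordP (s : S) : s = 0 \/
  exists v l w l' x, [/\ wok v l x, wok w l' x & s = wval v l * (wval w l')^*].
Proof.
elim/quotW: s; elim=> [|[v|e|b i v]|a IHa c IHc|a IHa].
- by left.
- right; exists v, [::], v, [::], v; split=> //=.
  by rewrite sv_star svv.
- right; exists (gsource e), [:: PE e], (grange e), [::], (grange e); split=> //=.
  by rewrite sv_star !sev.
- right; exists v, [:: PT b i v], v, [::], v; split=> //=.
  by rewrite sv_star !stv.
- have -> : \pi_(SEC (data_adaptable D))%qT (TMul a c) =
    \pi_(SEC (data_adaptable D))%qT a * \pi_(SEC (data_adaptable D))%qT c :> S.
    by rewrite piM.
  case: IHa => [->|[v [l [w [l' [x [lx l'x ->]]]]]]]; first by left; rewrite mul0s.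
  case: IHc => [->|[v' [m [w' [m' [x' [mx m'x ->]]]]]]]; first by left; rewrite muls0.
  have [wv|wv] := pselect (w = v'); last first.
    left; rewrite -(svw l'x) -(svw mx) starM sv_star -!mulgA (mulgA (sv w)).
    by rewrite sv_orth // mul0s !muls0.
  subst v'; case: (wcompl_words l'x mx) => [h|[u [u' [z [uk u'k _ _ [h _]]]]]].
    by left; rewrite -!mulgA (mulgA _ (wval w m)) h mul0s muls0.
  right; exists v, (l ++ u), w', (m' ++ u'), z; split.
  - exact: wok_cat lx uk.
  - exact: wok_cat m'x u'k.
  - rewrite (wval_cat lx uk) (wval_cat m'x u'k) -!mulgA (mulgA _ (wval w m)) h.
    by rewrite starM !mulgA.
- have -> : \pi_(SEC (data_adaptable D))%qT (TStar a) =
    (\pi_(SEC (data_adaptable D))%qT a : S)^* by rewrite piS.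
  case: IHa => [->|[v [l [w [l' [x [lx l'x ->]]]]]]].
    by left; exact: star0.
  right; exists w, l', v, l, x; split=> //.
  by rewrite starM starK.
Qed.

Lemma sec_proj (s : S) : s * s^* = 0 \/ exists v l x, wok v l x /\
  s * s^* = wval v l * (wval v l)^*.
Proof.
case: (sec_wordP s) => [->|[v [l [w [l' [x [lx l'x ->]]]]]]].
  by left; rewrite mul0s.
right; exists v, l, x; split=> //.
by rewrite starM starK -!mulgA (mulgA _ (wval w l')) (sww l'x) (ssvw lx).
Qed.

Lemma sec_regular (s : S) : s * s^* * s = s.
Proof.
case: (sec_wordP s) => [->|[v [l [w [l' [x [lx l'x ->]]]]]]].
  by rewrite !mul0s.
rewrite starM starK -!mulgA (mulgA _ (wval w l')) (sww l'x).
rewrite (mulgA (wval v l)) (swv lx) (mulgA _ (wval v l)) (sww lx) mulgA.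
by rewrite (swv lx).
Qed.

(** The product of the two projections is zero or the projection of the least common multiple; it is
    self-adjoint in both cases, so the factors commute. *)
Lemma sec_proj_comm v l x w l' y : wok v l x -> wok w l' y ->
  (wval v l * (wval v l)^*) * (wval w l' * (wval w l')^*) =
  (wval w l' * (wval w l')^*) * (wval v l * (wval v l)^*).
Proof.
move=> lx l'y; have [vw|vw] := pselect (v = w); last first.
  rewrite -(svw lx) -(svw l'y) !starM !sv_star -!mulgA.
  by rewrite !(mulgA (sv v) (sv w)) !(mulgA (sv w) (sv v)) !sv_orth // ?mul0s ?muls0 //; exact: nesym.
subst w; set p := wval v l * _; set q := wval v l' * _.
have ps : p^* = p by rewrite starM starK.
have qs : q^* = q by rewrite starM starK.
suff e : (p * q)^* = p * q by rewrite -e starM ps qs.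
have pq : p * q = wval v l * ((wval v l)^* * wval v l') * (wval v l')^*.
  by rewrite /p /q !mulgA.
case: (wcompl_words lx l'y) => [h|[u [u' [z [uk u'k _ _ [h1 h2]]]]]].
  by rewrite pq h muls0 mul0s star0.
have -> : p * q = (wval v l * wval x u) * (wval v l * wval x u)^*.
  by rewrite pq h1 h2 starM -h2 !mulgA.
by rewrite starM starK.
Qed.

(* Idempotents of a *-semigroup with [s s^* s = s] are products of two
   projections; so they commute as soon as the projections do. *)
Theorem sec_inverse : inverse_law S.
Proof.
pose proj (p : S) := p * p = p /\ p^* = p.
have projC (s t : S) : (s * s^*) * (t * t^*) = (t * t^*) * (s * s^*).
  case: (sec_proj s) => [->|[v [l [x [lx ->]]]]]; first by rewrite mul0s muls0.
  case: (sec_proj t) => [->|[w [l' [y [l'y ->]]]]]; first by rewrite mul0s muls0.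
  exact: sec_proj_comm lx l'y.
have reg' (s : S) : s^* * s * s^* = s^* by have := sec_regular s^*; rewrite starK.
have idem_proj (e : S) : e * e = e -> e^* = e.
  move=> ee; have e'e' : e^* * e^* = e^* by rewrite -starM ee.
  have eE : e = (e * e^*) * (e^* * e).
    by rewrite -mulgA (mulgA e^*) e'e' mulgA sec_regular.
  have := projC e e^*; rewrite starK -eE => eE'.
  by rewrite eE' starM !starM !starK -eE'.
have idemC (e f : S) : e * e = e -> f * f = f -> e * f = f * e.
  move=> ee ff; have := projC e f; rewrite (idem_proj _ ee) (idem_proj _ ff).
  by rewrite ee ff.
move=> s; split; [exact: sec_regular|exact: reg'|move=> t sts tst].
have st : (s * t) * (s * t) = s * t by rewrite mulgA sts.
have ts : (t * s) * (t * s) = t * s by rewrite mulgA tst.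
have ss : (s * s^*) * (s * s^*) = s * s^* by rewrite mulgA sec_regular.
have s's : (s^* * s) * (s^* * s) = s^* * s by rewrite mulgA reg'.
have e1 : t * s = s^* * s.
  have -> : t * s = (t * s) * (s^* * s) by rewrite -mulgA (mulgA s) sec_regular.
  by rewrite (idemC _ _ ts s's) -mulgA (mulgA s) sts.
have e2 : s * t = s * s^*.
  have -> : s * t = (s * s^*) * (s * t) by rewrite mulgA sec_regular.
  by rewrite (idemC _ _ ss st) mulgA sts.
by rewrite -tst e1 -mulgA e2 mulgA reg'.
Qed.

End DataWords.

(** * Action on normal forms *)

Section DataModel.
Variable D : graphData.
Local Notation V := (gvert D).
Local Notation S := (SEC (data_adaptable D)).
Local Notation "0" := (szero : S) : group_scope.
Implicit Types (v w x y z : V) (e f : gedge D) (i : nat) (b : bool).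

(* The semigroup acts on its normal forms: a point is a path of steps
   [alpha_(gblock e)^n e], followed at its end by a monomial in the alpha's
   and one in the t's. *)
Record mpoint := MPoint {
  mpath : seq (gedge D * nat);
  mend : V;
  mexp : nat -> nat;
  mtau : nat -> int
}.
Implicit Types (p q : mpoint) (s : seq (gedge D * nat)).

Definition mstart p : V :=
  if mpath p is (e, _) :: _ then gsource e else mend p.

Definition tdelta b i (j : nat) : int :=
  (if b then (j == i)%:Z else - (j == i)%:Z)%R.

Definition tadd_at b i p : mpoint :=
  MPoint (mpath p) (mend p) (mexp p) (fun j => mtau p j + tdelta b i j)%R.

(** All t's are kept at the end of the path; this is the index with which a t entering at the front
    arrives there. *)
Fixpoint tindex s i : nat :=
  if s is (e, _) :: s' then tindex s' (tshift e i) else i.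

Definition tadd b i p := tadd_at b (tindex (mpath p) i) p.

Definition mcons e n p := MPoint ((e, n) :: mpath p) (mend p) (mexp p) (mtau p).

Definition mtail p := MPoint (behead (mpath p)) (mend p) (mexp p) (mtau p).

(** The action of the loop of block [i]: a first step of the same block absorbs it into its
    exponent, and past a step of another block it becomes a t, as in [srel_R8]. *)
Definition mbump i p : mpoint :=
  match mpath p with
  | [::] => MPoint [::] (mend p) (fun j => mexp p j + (j == i))%N (mtau p)
  | (e, n) :: s => if gblock e == i then mcons e n.+1 (mtail p)
                   else mcons e n (tadd true (unbump (gblock e) i) (mtail p))
  end.

Definition is_alpha e := gfree (gsource e) && (gpos e == 0%N).

Definition pfun (g : pgen D) p : mpoint :=
  match g with
  | PE e => if is_alpha e then mbump (gblock e) p else mcons e 0 p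
  | PT b i _ => tadd b i p
  end.

Definition mrel := mpoint -> mpoint -> Prop.

(** With relations in place of partial functions the star is the converse, defined for all terms
    alike. Products compose from right to left. *)
Fixpoint meval (t : sterm (data_graph D)) : mrel :=
  match t with
  | TZero => fun _ _ => False
  | TGen (GenV v) => fun p q => mstart p = v /\ q = p
  | TGen (GenE e) => fun p q => mstart p = grange e /\ q = pfun (PE e) p
  | TGen (GenT b i v) => fun p q => mstart p = v /\ q = tadd b i p
  | TMul a c => fun p q => exists2 r, meval c p r & meval a r q
  | TStar a => fun p q => meval a q p
  end.

Lemma mpoint_eq p q : mpath p = mpath q -> mend p = mend q -> mexp p =1 mexp q ->
  mtau p =1 mtau q -> p = q.
Proof.
by case: p q => [s v a t] [s' v' a' t'] /= -> -> /funext -> /funext ->.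
Qed.

Lemma tadd_atC b c i j p : tadd_at b i (tadd_at c j p) = tadd_at c j (tadd_at b i p).
Proof. by apply: mpoint_eq => //= k; rewrite addrAC. Qed.

Lemma taddC b c i j p : tadd b i (tadd c j p) = tadd c j (tadd b i p).
Proof. exact: tadd_atC. Qed.

Lemma taddK b i p : tadd b i (tadd (~~ b) i p) = p.
Proof.
apply: mpoint_eq => //= k; rewrite -addrA /tdelta /=.
by case: b => /=; rewrite ?addNr ?addrN addr0.
Qed.

Lemma mstart_tadd b i p : mstart (tadd b i p) = mstart p. Proof. by []. Qed.

Lemma tadd_cons b i e n p :
  tadd b i (mcons e n p) = mcons e n (tadd b (tshift e i) p).
Proof. by []. Qed.

Lemma mstart_bump i p : mstart (mbump i p) = mstart p.
Proof.
by case: p => [[|[e n] s] v a t]; rewrite /mbump //=; case: ifP.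
Qed.

Lemma tadd_bump b i j p : gfree (mstart p) -> tadd b i (mbump j p) = mbump j (tadd b i p).
Proof.
case: p => [[|[e n] s] v a t] _; first exact: mpoint_eq.
rewrite /mbump /=; case: ifP => _; first exact: mpoint_eq.
by apply: mpoint_eq => //= k; rewrite addrAC.
Qed.

Lemma mbumpC i j p : mbump i (mbump j p) = mbump j (mbump i p).
Proof.
case: p => [[|[e n] s] v a t].
  by apply: mpoint_eq => //= k; rewrite addnAC.
case Ei: (gblock e == i); case Ej: (gblock e == j);
  rewrite /mbump /= ?Ei ?Ej /= ?Ei ?Ej //=.
by apply: mpoint_eq => //= k; rewrite addrAC.
Qed.

Lemma mbump_inj i : injective (mbump i).
Proof.
case=> [[|[e n] s] v a t] [[|[e' n'] s'] v' a' t']; rewrite /mbump /=.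
- case=> <- aE <-; apply: mpoint_eq => //= k.
  by have /(congr1 (@^~ k)) /addIn := aE.
- by case: ifP.
- by case: ifP.
- case: eqP => ei; case: eqP => e'i; case.
  + by move=> -> -> -> -> -> ->.
  + by move=> ee; rewrite ee in ei.
  + by move=> ee; rewrite ee in ei.
  + move=> <- -> <- <- <- tE; apply: mpoint_eq => //= k.
    by have /(congr1 (@^~ k)) /addIr := tE.
Qed.

(** Soundness of [srel_R3_star] rests on this: the ranges of two different loops meet only in the
    range of their product. *)
Lemma mbump_pullback i j p q : i <> j -> mbump i p = mbump j q ->
  exists2 r, p = mbump j r & q = mbump i r.
Proof.
move=> ij; case: p q => [[|[e n] s] v a t] [[|[e' n'] s'] v' a' t']; rewrite /mbump /=.
- case=> <- aE <-; have ak k : (a k + (k == i) = a' k + (k == j))%N.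
    by have /(congr1 (@^~ k)) := aE.
  exists (MPoint [::] v (fun k => a k - (k == j))%N t); apply: mpoint_eq => //= k.
    by have := ak k; case: (eqVneq k j) => [->|]; case: eqP => //; lia.
  by have := ak k; case: (eqVneq k j) => [->|]; case: eqP => //; lia.
- by case: ifP.
- by case: ifP.
- case: eqP => ei; case: eqP => e'j; case.
  + by move=> ee; case: ij; rewrite -ei -e'j ee.
  + move=> <- <- <- <- <- tE.
    exists (MPoint ((e, n) :: s) v a t') => /=.
      rewrite /= ei; case: eqP => // _; apply: mpoint_eq => //= k.
      by have /(congr1 (@^~ k)) /= := tE; rewrite ei.
    by rewrite /= ei eqxx.
  + move=> ee nn <- <- <- tE; subst e' n.
    exists (MPoint ((e, n') :: s) v a t) => /=.
      by rewrite /= e'j eqxx.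
    rewrite /= e'j; case: eqP => [ji|_]; first by case: ij.
    apply: mpoint_eq => //= k.
    by have /(congr1 (@^~ k)) /= := tE; rewrite e'j.
  + move=> ee <- <- <- <- tE; subst e'.
    (* Both loops act as t's here, so the common preimage is found by applying an inverse t. *)
    exists (tadd_at false (tindex s (unbump (gblock e) j)) (MPoint ((e, n) :: s) v a t)) => /=.
      case: eqP => // _; apply: mpoint_eq => //= k.
      by rewrite -addrA /tdelta addNr addr0.
    case: eqP => // _; apply: mpoint_eq => //= k.
    have /(congr1 (@^~ k)) /= := tE; rewrite /tadd_at /= => tk.
    by rewrite addrAC tk -addrA /tdelta addrN addr0.
Qed.

Lemma is_alpha_dalpha (p : component (data_graph D)) (i : 'I_(dk p)) : dfree p ->
  is_alpha (dalpha i).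
Proof. by move=> fp; rewrite /is_alpha /= andbT. Qed.

Lemma meval_sound t t' : srel (data_adaptable D) t t' -> meval t = meval t'.
Proof.
have mE (r r' : mrel) : (forall p q, r p q <-> r' p q) -> r = r'.
  by move=> h; apply/funext => p; apply/funext => q; apply/propext.
have start_se e p : mstart p = grange e -> mstart (pfun (PE e) p) = gsource e.
  rewrite /=; case: ifP => // /andP[_ /eqP e0].
  by rewrite mstart_bump grange_loop.
have pfun_inj e : injective (pfun (PE e)).
  move=> p q /=; case: ifP => _; first exact: mbump_inj.
  by case: p q => [s v a u] [s' v' a' u'] [-> -> -> ->].
(* A point in the range of a loop whose first step belongs to the set of that loop has a positive
   exponent there, while prepending any other edge of the set gives a first step with exponent 0. *)
have disj e f p q : gsource e = gsource f -> gblock e = gblock f -> e <> f ->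
    pfun (PE e) p = pfun (PE f) q -> False.
  move=> es eb ef /=; rewrite /is_alpha es.
  have ab e' f' p' q' : gblock e' = gblock f' -> mbump (gblock e') p' = mcons f' 0 q' -> False.
    case: p' => [[|[e1 n] s] v a tt] eb'; rewrite /mbump //=.
    by case: eqP => // h; case=> h' *; apply: h; rewrite eb' h'.
  case: (gfree (gsource f)) => /=; last by case=> /ef.
  case: eqP => e0; case: eqP => f0.
  - by move=> _; apply: ef; apply: gedge_eq; rewrite ?e0 ?f0.
  - exact: ab.
  - by move=> /esym; apply: ab.
  - by case=> /ef.
have alphaR (c : component (data_graph D)) (i : 'I_(dk c)) p q : dfree c ->
    mstart p = grange (dalpha i) /\ q = pfun (PE (dalpha i)) p <->
    mstart p = comp_vx c /\ q = mbump i p.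
  by move=> fc; rewrite /= is_alpha_dalpha // grange_loop.
have betaR (c : component (data_graph D)) (i : 'I_(dk c)) (u : 'I_(dg i)) p q :
    dfree c -> mstart p = grange (dbeta u) /\ q = pfun (PE (dbeta u)) p <->
    mstart p = grange (dbeta u) /\ q = mcons (dbeta u) 0 p.
  by move=> fc; rewrite /= /is_alpha andbF.
elim=> {t t'}.
- by [].
- by move=> ? ? _ ->.
- by move=> ? ? ? _ -> _ ->.
- by move=> ? ? ? ? _ h _ h'; rewrite /= h h'.
- by move=> ? ? _ h /=; rewrite h.
- move=> x y z; apply: mE => p q; split=> /=.
    by move=> [r [r' h1 h2] h3]; exists r' => //; exists r.
  by move=> [r h1 [r' h2 h3]]; exists r' => //; exists r.
- by move=> x; apply: mE => p q; split=> [[]|].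
- by move=> x; apply: mE => p q; split=> [[]|].
- by [].
- by move=> x y; apply: mE => p q; split=> /= -[r h1 h2]; exists r.
- move=> v; apply: mE => p q; split=> /=; first by move=> [r [pv ->] [_ ->]].
  by move=> [pv ->]; exists p.
- move=> v w vw; apply: mE => p q; split=> //= -[r [pw ->] [pv _]].
  by apply: vw; rewrite -pw -pv.
- by move=> v; apply: mE => p q; split=> /= -[pv ->].
- move=> e; apply: mE => p q; split=> /=; first by move=> [r h [_ ->]].
  by move=> h; exists q => //; split=> //; case: h => h ->; exact: (start_se e p h).
- move=> e; apply: mE => p q; split=> /=; first by move=> [r [_ ->]].
  by move=> h; exists p => //; case: h.
- move=> v X e [i iv <-] [ev ei]; apply: mE => p q; split=> /=.
    by move=> [r [pe ->] [qe /pfun_inj ->]].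
  by move=> [pe ->]; exists (pfun (PE e) p).
- move=> v X e f [i iv <-] [ev ei] [fv fi] ef; apply: mE => p q; split=> //=.
  move=> [r [pe ->] [qe /esym h]]; apply: (disj e f) h => //; congruence.
- move=> c i j fc ij; apply: mE => p q; split=> -[r /(alphaR _ _ _ _ fc)[pc ->] /(alphaR _ _ _ _ fc)[_ ->]].
    by exists (mbump i p); apply/(alphaR _ _ _ _ fc); rewrite ?mstart_bump // mbumpC.
  by exists (mbump j p); apply/(alphaR _ _ _ _ fc); rewrite ?mstart_bump // mbumpC.
- move=> c i j fc ij; apply: mE => p q; split=> -[r].
    move=> /(alphaR _ _ _ _ fc)[rc ->] /(alphaR _ _ _ _ fc)[_ ->]; exists (mbump i (mbump j r)).
      by apply/(alphaR _ _ _ _ fc); rewrite mstart_bump.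
    by apply/(alphaR _ _ _ _ fc); rewrite mstart_bump mbumpC.
  move=> /(alphaR _ _ _ _ fc)[pc ->] /(alphaR _ _ _ _ fc)[_ h].
  have [|r' pr qr] := mbump_pullback _ h; first by move=> /val_inj.
  have rc : mstart r' = comp_vx c by rewrite -pc pr mstart_bump.
  by exists r'; apply/(alphaR _ _ _ _ fc).
- move=> c u w fc uw; apply: mE => p q; split=> // -[r] /(betaR _ _ _ _ _ fc)[_ ->] /(betaR _ _ _ _ _ fc)[_ h].
  have {h} : dbeta (tagged w) = dbeta (tagged u).
    exact: (congr1 (fun m => (head (dbeta (tagged w), 0%N) (mpath m)).1) h).
  case: u w uw => [i t] [j t'] /= uw h.
  have ij : j = i by apply: val_inj; exact: (congr1 (@gblock D) h).
  subst j; apply: uw; congr existT; apply: val_inj.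
  by have := congr1 (@gpos D) h; rewrite /gpos /= => -[].
- move=> b c i j v; apply: mE => p q; split=> /= -[r [pv ->] [_ ->]].
    by exists (tadd b i p); rewrite // taddC.
  by exists (tadd c j p); rewrite // taddC.
- move=> i v; apply: mE => p q; split=> /=; first by move=> [r [pv ->] [_ ->]].
  by move=> [pv ->]; exists (tadd true i p).
- move=> i v; apply: mE => p q; split=> /=; first by move=> [r [pv ->] [_ ->]].
  by move=> [pv ->]; exists p.
- move=> b i v; apply: mE => p q; split=> /=.
    by move=> [r [pv ->] [_ ->]]; rewrite taddK.
  by move=> [pv ->]; exists (tadd (~~ b) i p); rewrite ?taddK.
- move=> i v; apply: mE => p q; split=> /= -[pv ->].
    by rewrite mstart_tadd in pv *; rewrite (taddK false).
  by rewrite mstart_tadd (taddK true).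
- move=> c i e fc /comp_vertsE ec.
  have re : gfree (gsource e) = false.
    by apply/negP; rewrite (gfree_cls (w := comp_vx c)).
  have te : tshift e i = i by rewrite /tshift re.
  apply: mE => p q; split=> /= -[r]; rewrite /is_alpha re /= => -[pv ->] [_ ->].
    exists (tadd true i p); first by [].
    by rewrite tadd_cons te; split.
  exists (mcons e 0 p) => //; by rewrite tadd_cons te.
- move=> c v j s b i fc /(free_comp fc) vc; apply: mE => p q.
  have tE : tshift (dbeta s) i = (i + dk c - 1)%N.
    by rewrite /tshift [gsource _]/(comp_vx c) [gfree _]fc.
  split=> -[r].
    move=> /(betaR _ _ _ _ _ fc)[pc ->] [_ ->]; exists (tadd b (i + dk c - 1)%N p) => //.
    by apply/(betaR _ _ _ _ _ fc); rewrite -tE.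
  move=> [pc ->] /(betaR _ _ _ _ _ fc)[_ ->]; exists (mcons (dbeta s) 0 p).
    exact/(betaR _ _ _ _ _ fc).
  by split; [rewrite vc|rewrite tadd_cons tE].
- move=> c i j s fc ij; have ji : gblock (dbeta s) == i = false.
    by apply/eqP => h; apply: ij; apply: val_inj; exact: esym h.
  have bE p : mbump i (mcons (dbeta s) 0 p) = mcons (dbeta s) 0 (tadd true (unbump j i) p).
    by rewrite /mbump /= ji; case: p.
  apply: mE => p q; split=> -[r].
    move=> /(betaR _ _ _ _ _ fc)[pc ->] /(alphaR _ _ _ _ fc)[_ ->]; rewrite bE.
    by exists (tadd true (unbump j i) p) => //; apply/(betaR _ _ _ _ _ fc).
  move=> [pc ->] /(betaR _ _ _ _ _ fc)[_ ->]; exists (mcons (dbeta s) 0 p); first exact/(betaR _ _ _ _ _ fc).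
  by apply/(alphaR _ _ _ _ fc); rewrite bE.
- move=> c i j s fc ij; have ji : gblock (dbeta s) == i = false.
    by apply/eqP => h; apply: ij; apply: val_inj; exact: esym h.
  have bE p : mbump i (mcons (dbeta s) 0 (tadd false (unbump j i) p)) = mcons (dbeta s) 0 p.
    by rewrite /mbump /= ji -[RHS]/(mcons (dbeta s) 0 p) -{2}(taddK true (unbump j i) p).
  apply: mE => p q; split=> -[r].
    move=> /(betaR _ _ _ _ _ fc)[pc ->] /(alphaR _ _ _ _ fc)[_]; rewrite -bE => /mbump_inj <-.
    by exists (tadd false (unbump j i) p) => //; apply/(betaR _ _ _ _ _ fc).
  move=> [pc ->] /(betaR _ _ _ _ _ fc)[_ ->]; exists (mcons (dbeta s) 0 p); first exact/(betaR _ _ _ _ _ fc).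
  by apply/(alphaR _ _ _ _ fc); rewrite bE.
- move=> c v j i fc /(free_comp fc) vc; subst v; apply: mE => p q; split=> -[r].
    move=> /(alphaR _ _ _ _ fc)[pc ->] [_ ->]; exists (tadd true i p) => //.
    by apply/(alphaR _ _ _ _ fc); rewrite tadd_bump // pc.
  move=> [pc ->] /(alphaR _ _ _ _ fc)[_ ->]; exists (mbump j p); first exact/(alphaR _ _ _ _ fc).
  by split; [rewrite mstart_bump|rewrite tadd_bump // pc].
- move=> c v j i fc /(free_comp fc) vc; subst v; apply: mE => p q; split=> -[r].
    move=> /(alphaR _ _ _ _ fc)[rc ->] [_ ->]; exists (tadd true i (mbump j r)).
      by split=> //; rewrite mstart_bump.
    by apply/(alphaR _ _ _ _ fc); rewrite tadd_bump // rc.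
  move=> [pc ->] /(alphaR _ _ _ _ fc)[qc h]; exists (tadd false i q).
    apply/(alphaR _ _ _ _ fc); split=> //.
    by rewrite -tadd_bump ?qc // -h (taddK false).
  by split; [rewrite mstart_tadd|rewrite (taddK true)].
Qed.

End DataModel.

(** * Faithfulness of the action and right cancellation of words *)

Section DataUnitary.
Variable D : graphData.
Local Notation V := (gvert D).
Local Notation S := (SEC (data_adaptable D)).
Local Notation "0" := (szero : S) : group_scope.
Implicit Types (v w x y z : V) (e f : gedge D) (i : nat) (b : bool).
Implicit Types (p q : mpoint D) (g : pgen D) (l : seq (pgen D)).

Definition mact (s : S) : mrel D := meval (repr s).

Lemma mact_pi t : mact (\pi_(SEC (data_adaptable D))%qT t) = meval t.
Proof. exact/meval_sound/SEC_repr. Qed.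

Lemma mactM (s t : S) p q : mact (s * t) p q <-> exists2 r, mact t p r & mact s r q.
Proof. by rewrite [s * t]/(SEC_mul s t) mact_pi. Qed.

Lemma mactS (s : S) p q : mact s^* p q <-> mact s q p.
Proof. by rewrite [s^*]/(SEC_star s) mact_pi. Qed.

Lemma mact0 p q : ~ mact 0 p q.
Proof. by rewrite [0]/(SEC_zero _) mact_pi. Qed.

Lemma mact_sv v p q : mact (sv v) p q <-> mstart p = v /\ q = p.
Proof. by rewrite mact_pi. Qed.

Lemma mact_pval g p q : mact (pval g) p q <-> mstart p = prng g /\ q = pfun g p.
Proof. by case: g => [e|b i v]; rewrite /pval mact_pi. Qed.

Lemma mstart_pfun g p : mstart p = prng g -> mstart (pfun g p) = psrc g.
Proof.
case: g => [e|b i v] //=; case: ifP => // /andP[_ /eqP e0].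
by rewrite mstart_bump grange_loop.
Qed.

Definition wfun l p := foldr (@pfun D) p l.

Lemma mstart_wfun v l x p : wok v l x -> mstart p = x -> mstart (wfun l p) = v.
Proof.
elim: l v => [|g l IH] v /=; first by move=> ->.
by move=> [<- lx] px; apply: mstart_pfun; exact: IH.
Qed.

Lemma mact_wval v l x p q : wok v l x ->
  mact (wval v l) p q <-> mstart p = x /\ q = wfun l p.
Proof.
elim: l v q => [|g l IH] v q /=; first by move=> ->; exact: mact_sv.
move=> [_ lx]; rewrite mactM; split.
  by move=> [r /(IH _ _ lx)[px ->] /mact_pval[_ ->]].
move=> [px ->]; exists (wfun l p); first exact/(IH _ _ lx).
by apply/mact_pval; split=> //; exact: mstart_wfun px.
Qed.

Definition mbase v : mpoint D := MPoint [::] v (fun=> 0%N) (fun=> 0%R).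

Lemma sv_neq0 v : sv v <> 0.
Proof.
move=> v0; have : mact (sv v) (mbase v) (mbase v) by apply/mact_sv.
by rewrite v0 => /mact0.
Qed.

Lemma wval_neq0 v l x : wok v l x -> wval v l <> 0.
Proof. by move=> lx l0; apply: (@sv_neq0 x); rewrite -(sww lx) l0 muls0. Qed.

Definition nalpha v : nat := if gfree v then kblocks v else 0%N.

(** The map [mstep_end] may discard exponents at indices that belong to no loop of the end vertex;
    asking them to vanish makes [pright] injective. *)
Definition mgood p := forall m, (nalpha (mend p) <= m)%N -> mexp p m = 0%N.

Lemma mend_pfun g p : mend (pfun g p) = mend p.
Proof.
case: g => [e|b i v] //=; case: ifP => // _.
by case: p => [[|[f n] s] v a t]; rewrite /mbump //=; case: ifP.
Qed.

Lemma mend_wfun l p : mend (wfun l p) = mend p.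
Proof. by elim: l => //= g l IH; rewrite mend_pfun. Qed.

Lemma mgood_pfun g p : mstart p = prng g -> mgood p -> mgood (pfun g p).
Proof.
case: g => [e|b i v] //=; case: ifP => // /andP[fe /eqP e0].
case: p => [[|[f n] s] v a t]; rewrite /mbump /mgood /=; last by case: ifP.
rewrite /mstart /= grange_loop // => -> h m km; rewrite h //.
case: eqP => // me; move: km; rewrite /nalpha fe me leqNgt.
by rewrite gblock_lt.
Qed.

Lemma mgood_wfun v l x p : wok v l x -> mstart p = x -> mgood p -> mgood (wfun l p).
Proof.
elim: l v => [|g l IH] v //= [_ lx] px pg.
by apply: mgood_pfun; [exact: mstart_wfun px|exact: (IH _ lx)].
Qed.

Definition mexp_end i p := MPoint (mpath p) (mend p)
  (fun j => mexp p j + (j == i))%N (mtau p).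

(** Right multiplication by an edge other than an alpha. At a free vertex the loop exponent of its
    own block is stored with the step, the other loop exponents become t-exponents with the first
    indices as in [srel_R8], and the old t's move up as in [srel_R7]. At a regular vertex the t's
    are unchanged. *)
Definition mstep_end e p := MPoint (rcons (mpath p) (e, mexp p (gblock e)))
  (grange e) (fun=> 0%N) (fun m =>
    if gfree (gsource e) then
      if (m < (kblocks (gsource e)).-1)%N then Posz (mexp p (bump (gblock e) m))
      else mtau p (m - (kblocks (gsource e)).-1)%N
    else mtau p m).

(* Right multiplication by [g]; unlike [pfun g] it acts at the end. *)
Definition pright g p : mpoint D :=
  match g with
  | PE e => if is_alpha e then mexp_end (gblock e) p else mstep_end e p
  | PT b i _ => tadd_at b i p
  end.

Lemma pright_base g : pright g (mbase (psrc g)) = pfun g (mbase (prng g)).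
Proof.
case: g => [e|b i v] //=; case: ifP => [/andP[_ /eqP e0]|_].
  by rewrite grange_loop.
by apply: mpoint_eq => //= m; case: ifP => //; case: ifP.
Qed.

Lemma tindex_rcons s e n i : @tindex D (rcons s (e, n)) i = tshift e (@tindex D s i).
Proof. by elim: s i => //= -[f m] s IH i. Qed.

Lemma kblocks_gt0 e : (0 < kblocks (gsource e))%N.
Proof. by apply: leq_trans (gblock_lt e). Qed.

Lemma mstep_end_tadd e b j p : ~~ is_alpha e ->
  tadd_at b (tshift e j) (mstep_end e p) = mstep_end e (tadd_at b j p).
Proof.
rewrite /is_alpha /tshift => ne; have k0 := kblocks_gt0 e.
apply: mpoint_eq => //= m; case: ifP ne => //= fe ->; rewrite /tdelta.
case: ltnP => mk.
  have -> : (m == j + kblocks (gsource e) - 1)%N = false by apply/eqP; lia.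
  by case: b; rewrite ?oppr0 addr0.
have -> // : (m == j + kblocks (gsource e) - 1)%N = (m - (kblocks (gsource e)).-1 == j)%N.
by apply/eqP/eqP; lia.
Qed.

(** Associativity in the model. The two ends interact most when the path is empty: a loop of a block
    other than that of [e] must then become the same t on both routes. *)
Lemma pfun_pright g h p : mend p = psrc h -> mstart p = prng g ->
  pfun g (pright h p) = pright h (pfun g p).
Proof.
move=> ph pg; case: h ph => [e|c j w] /= ph; last first.
  case: g pg => [f|b i v] /= pg; last exact: tadd_atC.
  case: ifP => //; case: p ph pg => [[|[e n] s] v a t] _ _ _; rewrite /mbump //=.
  case: ifP => // _; apply: mpoint_eq => //= m; exact: addrAC.
case: ifP => [_|/negbT ne].
  case: g pg => [f|b i v] //= pg; case: ifP => //.
  case: p ph pg => [[|[e' n] s] v a t] _ _ _; rewrite /mbump //=.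
    by apply: mpoint_eq => //= m; exact: addnAC.
  by case: ifP.
case: g pg => [f|b i v] /= pg; last first.
  by rewrite /tadd {1}/mstep_end /= tindex_rcons mstep_end_tadd.
case: ifP => // /andP[ff /eqP f0].
case: p ph pg => [[|[e' n] s] v a t] ph pg; rewrite /mbump /=; last first.
  case: ifP => _; first by [].
  rewrite /tadd /= tindex_rcons.
  have tE := mstep_end_tadd true (tindex s (unbump (gblock e') (gblock f)))
     (MPoint s v a t) ne.
  by apply: mpoint_eq => //= m; exact: (congr1 (fun r => mtau r m) tE).
move: ph pg; rewrite /mstart /= => ve; subst v; rewrite grange_loop // => ef.
have fe : gfree (gsource e) by rewrite ef.
have k0 := kblocks_gt0 e; have := gblock_lt f; rewrite -ef -/(kblocks _) => fk.
have ek : (gblock e < kblocks (gsource e))%N := gblock_lt e.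
case: eqP => bef.
  rewrite /mstep_end /= -bef eqxx addn1; apply: mpoint_eq => //= m.
  by rewrite fe; case: ifP => // _; rewrite eq_sym (negPf (neq_bump _ _)) addn0.
rewrite /mstep_end /tadd /tadd_at /mcons /=.
have -> : (gblock e == gblock f) = false by apply/eqP.
rewrite addn0; apply: mpoint_eq => //= m; rewrite fe.
case: ltnP => mk.
  rewrite /tdelta PoszD; congr (_ + _)%R.
  have -> // : (m == unbump (gblock e) (gblock f)) = (bump (gblock e) m == gblock f).
  apply/eqP/eqP => [->|<-]; last by rewrite bumpK.
  by rewrite unbumpK //= inE; apply/eqP => h; apply: bef.
rewrite /tdelta; have -> : (m == unbump (gblock e) (gblock f)) = false.
  by apply/eqP; move: mk bef; rewrite /unbump; case: ltnP; lia.
by rewrite addr0.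
Qed.

Lemma pright_inj h p q : mend p = psrc h -> mend q = psrc h -> mgood p -> mgood q ->
  pright h p = pright h q -> p = q.
Proof.
case: p q => [s v a t] [s' v' a' t'] /=; case: h => [e|c j w] /=; last first.
  move=> -> -> _ _ [-> aE tE]; apply: mpoint_eq => //= m.
    by have := congr1 (@^~ m) aE.
  by have /(congr1 (@^~ m)) /addIr := tE.
move=> -> -> pg qg; case: ifP => [_ [-> aE ->]|_].
  by apply: mpoint_eq => //= m; have /(congr1 (@^~ m)) /addIn := aE.
move=> h; have /rcons_inj[ss ae] := congr1 (@mpath D) h.
have tE m := congr1 (fun r => mtau r m) h; move: tE => /= tE.
have k0 := kblocks_gt0 e; have ek : (gblock e < kblocks (gsource e))%N := gblock_lt e.
subst s'; apply: mpoint_eq => //= m.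
  have [km|mk] := leqP (nalpha (gsource e)) m.
    by rewrite (pg m km : a m = 0%N) (qg m km : a' m = 0%N).
  move: mk; rewrite /nalpha; case: ifP => // fe mk.
  have [->//|me] := eqVneq m (gblock e).
  have := tE (unbump (gblock e) m); rewrite fe unbumpK //.
  have -> : (unbump (gblock e) m < (kblocks (gsource e)).-1)%N.
    by move: mk me ek; rewrite /unbump; case: ltnP; lia.
  by case.
case fe: (gfree (gsource e)); last by have := tE m; rewrite fe.
have := tE (m + (kblocks (gsource e)).-1)%N; rewrite fe addnK.
by case: ltnP => //; lia.
Qed.

Lemma wfun_pright v l h : wok v l (psrc h) ->
  wfun l (pright h (mbase (psrc h))) = pright h (wfun l (mbase (psrc h))).
Proof.
elim: l v => //= g l IH v [_ lx]; rewrite (IH _ lx).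
by apply: pfun_pright; [rewrite mend_wfun|exact: (mstart_wfun (p := mbase _) lx)].
Qed.

(** By [pright_base] a letter next to the base point acts as a right multiplication, which commutes
    with the rest of the word and is injective; so the letters of [u] cancel one after the other. *)
Lemma wfun_rcancel v l l' x u z : wok v l x -> wok v l' x -> wok x u z ->
  wfun (l ++ u) (mbase z) = wfun (l' ++ u) (mbase z) ->
  wfun l (mbase x) = wfun l' (mbase x).
Proof.
elim: u l l' x => [|g u IH] l l' x lx l'x /=.
  by move=> ->; rewrite !cats0.
move=> [gx uz]; rewrite -!cat_rcons => /IH h.
have rg m : wok v m x -> wok v (rcons m g) (prng g).
  by move=> mx; rewrite -cats1; apply: wok_cat mx _; split.
have := h _ (rg _ lx) (rg _ l'x) uz.
rewrite -!cats1 /wfun !foldr_cat /= -pright_base -!/(wfun _ _).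
subst x; rewrite (wfun_pright lx) (wfun_pright l'x).
apply: pright_inj; rewrite ?mend_wfun //.
  exact: (mgood_wfun (p := mbase _) lx).
exact: (mgood_wfun (p := mbase _) l'x).
Qed.

Definition is_unit g : bool := if g is PT _ _ _ then true else false.

Definition tsum l j : int := foldr (fun g n => 
  ((if g is PT b i _ then tdelta b i j else 0) + n)%R) 0%R l.

Lemma unit_word x l z : all is_unit l -> wok x l z -> z = x.
Proof. by elim: l x => //= -[//|b i v] l IH x /= ul [-> /(IH _ ul)]. Qed.

Lemma wok_cat_unit l l' x z : all is_unit l -> wok x (l ++ l') z ->
  wok x l x /\ wok x l' z.
Proof.
by elim: l x => [|[//|b i v] l IH] x //= ul [-> /(IH _ ul)[]].
Qed.

Lemma wfun_unit l p : all is_unit l -> mpath p = [::] ->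
  mpath (wfun l p) = [::] /\ forall j, mtau (wfun l p) j = (mtau p j + tsum l j)%R.
Proof.
move=> + p0; elim: l => [|[//|b i v] l IH] /=; first by split=> // j; rewrite addr0.
move=> /IH[-> tE]; split=> // j; rewrite tE -addrA [(tsum _ _ + _)%R]addrC.
by [].
Qed.

Lemma st_unit_comm b i x l : all is_unit l -> wok x l x ->
  st b i x * wval x l = wval x l * st b i x.
Proof.
elim: l => [|[//|c j v] l IH] /=; first by rewrite svt stv.
by move=> ul [-> lx]; rewrite mulgA st_comm -mulgA IH // mulgA.
Qed.

Lemma tsum_cat l l' j : tsum (l ++ l') j = (tsum l j + tsum l' j)%R.
Proof. by elim: l => [|g l IH] /=; rewrite ?add0r // IH addrA. Qed.

Lemma unit_split b i x l : all is_unit l -> wok x l x ->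
  (exists l1 l2, l = l1 ++ PT (~~ b) i x :: l2) \/
  (if b then 0 <= tsum l i else tsum l i <= 0)%R.
Proof.
elim: l => [|[//|c j v] l IH] /=; first by right; case: b.
move=> ul [vx lx]; subst v; have {IH}[[l1 [l2 ->]]|h] := IH ul lx.
  by left; exists (PT c j x :: l1), l2.
have [[-> ->]|cj] := pselect (c = ~~ b /\ j = i); first by left; exists [::], l.
right; rewrite /tdelta; case: eqP => ij.
  have {cj} -> : c = b.
    apply: contra_notP cj => cb; split=> //.
    by case: (c) (b) cb => [] [] // [].
  by case: b h => h; lia.
by case: c b {cj} h => -[] h; lia.
Qed.

(** The first letter has its inverse further on, as otherwise [unit_split] would give the remaining
    exponent sum the same sign; since the t's commute, the two cancel. *)
Lemma unit_word_eq0 l x : all is_unit l -> wok x l x -> tsum l =1 (fun=> 0%R) ->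
  wval x l = sv x.
Proof.
have [n] := ubnP (size l); elim: n l => // n IH [//|[//|b i v] l] /= ln ul [vx lx] l0.
subst v; have [[l1 [l2 lE]]|h] := unit_split b i ul lx; last first.
  by have /= := l0 i; rewrite /tdelta eqxx; case: b h {l0} => h; lia.
have ul12 : all is_unit l1 /\ all is_unit l2.
  by move: ul; rewrite lE all_cat => /andP[-> /=].
case: ul12 => ul1 ul2; have [l1x [_ l2x]] : wok x l1 x /\ wok x (PT (~~ b) i x :: l2) x.
  by apply: wok_cat_unit ul1 _; rewrite -lE.
rewrite lE (wval_cat l1x (l' := _ :: _) (w := x)) /=; last by split.
rewrite mulgA (st_unit_comm b i ul1 l1x) -mulgA (mulgA (st b i x)) st_inv (svw l2x).
rewrite -(wval_cat l1x l2x); apply: IH => [||//|j].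
- by move: ln; rewrite lE !size_cat /=; lia.
- by rewrite all_cat ul1.
- exact: wok_cat l1x l2x.
- have /= := l0 j; rewrite lE !tsum_cat /= /tdelta => <-.
  by clear; case: b => /=; lia.
Qed.

Lemma unit_word_eq l l' x : all is_unit l -> wok x l x -> all is_unit l' ->
  wok x l' x -> tsum l =1 tsum l' -> wval x l = wval x l'.
Proof.
elim: l l' => [|[//|b i v] l IH] l' /=.
  by move=> _ _ ul' l'x h; rewrite unit_word_eq0 // => j; rewrite -h.
move=> ul [vx lx] ul' l'x h; subst v.
rewrite (IH (PT (~~ b) i x :: l')) //=; first by rewrite mulgA st_inv (svw l'x).
by move=> j; have /= <- := h j; rewrite /tdelta; clear; case: b => /=; lia.
Qed.

Lemma unit_word_unitary l x : all is_unit l -> wok x l x ->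
  wval x l * (wval x l)^* = sv x.
Proof.
elim: l => [|[//|b i v] l IH] /=; first by rewrite sv_star svv.
move=> ul [-> lx]; rewrite starM -!mulgA (mulgA (wval x l)) IH // st_star.
by rewrite mulgA stv st_inv.
Qed.

Lemma wfun_base m c x : wfun m c = mbase x -> all is_unit m /\ mpath c = [::].
Proof.
suff h : mpath (wfun m c) = [::] -> (forall j, mexp (wfun m c) j = 0%N) ->
    all is_unit m /\ [/\ mpath c = [::] & forall j, mexp c j = 0%N].
  by move=> e; have [||] := h; rewrite ?e // => ? [].
elim: m => [|[e|b i v] m IH] /=; first by split.
  case: ifP => //; case: (wfun m c) => [[|[f n] s] v a t]; rewrite /mbump //=.
    by move=> _ _ /(_ (gblock e)); rewrite eqxx addn1.
  by case: ifP.
exact: IH.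
Qed.

(** If the words agree on the base point, l^* l' fixes it. So a common multiple l m = l' m' exists
    in which m and m' consist of t's with equal exponents; these are invertible and can be
    removed. *)
Lemma wval_faithful v l l' x : wok v l x -> wok v l' x ->
  wfun l (mbase x) = wfun l' (mbase x) -> wval v l = wval v l'.
Proof.
move=> lx l'x E; have xx : mact ((wval v l)^* * wval v l') (mbase x) (mbase x).
  apply/mactM; exists (wfun l' (mbase x)); first exact/(mact_wval _ _ l'x).
  by apply/mactS/(mact_wval _ _ lx); rewrite E.
case: (wcompl_words lx l'x) => [h|[m [m' [z [mz m'z _ _ [h h2]]]]]].
  by move: xx; rewrite h => /mact0.
move: xx; rewrite h => /mactM[c /mactS/(mact_wval _ _ m'z)[_ bm'] /(mact_wval _ _ mz)[_ bm]].
have [um c0] := wfun_base (esym bm); have [um' _] := wfun_base (esym bm').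
have zx := unit_word um mz; subst z.
have mm' : wval x m = wval x m'.
  apply: unit_word_eq => // j; apply: (@addrI _ (mtau c j)).
  have [_ <-] := wfun_unit um c0; have [_ <-] := wfun_unit um' c0.
  by rewrite -bm -bm'.
have mu := unit_word_unitary um mz.
by rewrite -(swv lx) -(swv l'x) -mu !mulgA h2 mm'.
Qed.

Lemma wval_rcancel v l w l' x u z : wok v l x -> wok w l' x -> wok x u z ->
  wval v l * wval x u = wval w l' * wval x u -> wval v l = wval w l'.
Proof.
move=> lx l'x uz E; have [vw|vw] := pselect (v = w); last first.
  exfalso; apply: (wval_neq0 (wok_cat lx uz)); rewrite (wval_cat lx uz).
  rewrite -(svw lx) -mulgA E -(svw l'x) !mulgA sv_orth // !mul0s //.
subst w; apply: (wval_faithful lx l'x); apply: (wfun_rcancel lx l'x uz).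
have luz := wok_cat lx uz; have l'uz := wok_cat l'x uz.
have : mact (wval v (l ++ u)) (mbase z) (wfun (l ++ u) (mbase z)).
  exact/(mact_wval _ _ luz).
rewrite (wval_cat lx uz) E -(wval_cat l'x uz).
by move=> /(mact_wval _ _ l'uz)[].
Qed.

End DataUnitary.

Section DataInverse.
Variable D : graphData.
Local Notation S := (SEC_inverse (@sec_inverse D)).

(** Write s = l l'^* and e = m m^*, so that s m = m. A common multiple l' u = m u' gives l u = s m
    u' = m u' = l' u, and right cancellation yields l = l'. *)
Lemma sec_Estar_unitary : @Estar_unitary S.
Proof.
move=> s e ee e0 se.
have e'e : e * e^* = e by rewrite (idem_star ee).
case: (sec_wordP s) => [s0|[v [l [w [l' [x [lx l'x sE]]]]]]].
  by case: e0; rewrite -se s0 mul0s.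
case: (sec_proj e) => [h|[v' [m [y [my eE]]]]]; first by case: e0; rewrite -e'e h.
have {}eE : e = wval v' m * (wval v' m)^* by rewrite -eE e'e.
have sm : s * wval v' m = wval v' m.
  rewrite -[in LHS](swv my) -(sww my) (mulgA _ _ (wval v' m)) -eE mulgA se eE.
  by rewrite -mulgA (sww my) (swv my).
have [wv|wv] := pselect (w = v'); last first.
  exfalso; apply: (wval_neq0 my); rewrite -sm sE -(svw my) -(sswv l'x).
  by rewrite -!mulgA (mulgA (sv w)) sv_orth // mul0s !muls0.
subst v'; case: (wcompl_words l'x my) => [h|[u [u' [z [uz u'z _ _ [h1 h2]]]]]].
  by exfalso; apply: (wval_neq0 my); rewrite -sm sE -mulgA h muls0.
have E : wval v l * wval x u = wval w l' * wval x u.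
  rewrite h2 -[in RHS]sm sE -!mulgA (mulgA _ (wval w m)) h1.
  by rewrite -(mulgA _ _ (wval y u')) (sww u'z) (swv uz).
have ll := wval_rcancel lx l'x uz E.
suff -> : s = wval v l * (wval v l)^* by exact: idemsV.
by rewrite sE ll.
Qed.

End DataInverse.

(** * Covers of a vertex *)

Section WordCovers.
Variable D : graphData.
Local Notation V := (gvert D).
Local Notation S := (SEC (data_adaptable D)).
Local Notation "0" := (szero : S) : group_scope.
Implicit Types (v w x y z : V) (e f : gedge D) (i : nat) (b : bool).
Implicit Types (g : pgen D) (l m : seq (pgen D)).

Definition eproj e : S := se e * (se e)^*.
Definition wproj v l : S := wval v l * (wval v l)^*.

Lemma eproj_idem e : eproj e * eproj e = eproj e.
Proof. by rewrite /eproj mulgA -(mulgA (se e)) see sev. Qed.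

Lemma eproj_se e : eproj e * se e = se e.
Proof. by rewrite /eproj -mulgA see sev. Qed.

Lemma eproj_st b i e : eproj e * st b i (gsource e) = st b i (gsource e) * eproj e.
Proof.
have h : (se e)^* * st b i (gsource e) = st b (tshift e i) (grange e) * (se e)^*.
  by have := congr1 (@star _) (ste (~~ b) i e); rewrite !starM !st_star negbK.
by rewrite /eproj -mulgA h !mulgA ste.
Qed.

Lemma eproj_alpha e f : gfree (gsource e) -> gsource f = gsource e -> gpos f = 0%N ->
  gblock e <> gblock f -> eproj e * se f = se f * eproj e.
Proof.
move=> fe fs f0 ef; rewrite /eproj; have [e0|e0] := eqVneq (gpos e) 0%N.
  have [h1 h2] := salpha_comm fe fs e0 f0 ef.
  have [||_ h3] := @salpha_comm D f e _ (esym fs) f0 e0; first by rewrite fs.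
    exact: nesym.
  by rewrite -mulgA -h3 !mulgA h1.
have [||h1 h2] := @salpha_beta D f e _ (esym fs) f0 e0; first by rewrite fs.
  exact: nesym.
have h3 : (se e)^* * se f = st true (unbump (gblock e) (gblock f)) (grange e) * (se e)^*.
  by have := congr1 (@star _) h2; rewrite !starM starK st_star.
by rewrite -mulgA h3 !mulgA h1.
Qed.

(** The t's before the first edge commute with the projection of an edge at [v] by [eproj_st], so
    they do not move the word out of its cylinder. *)
Lemma word_head v l x : wok v l x -> all (@is_unit D) l \/
  exists e, gsource e = v /\ eproj e * wval v l = wval v l.
Proof.
elim: l v => [|[e|b i w] l IH] v /=; first by left.
  by move=> [<- _]; right; exists e; rewrite mulgA eproj_se.
move=> [<- /IH[ul|[e [ew el]]]]; [by left|right; exists e; split=> //].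
by rewrite mulgA -ew eproj_st -mulgA ew el.
Qed.

Definition pure_gen g := if g is PE e then is_alpha e else true.
Definition pure l := all pure_gen l.

Lemma pure_end v l x : pure l -> wok v l x -> x = v.
Proof.
elim: l v => [|[e|b i w] l IH] v //=.
  move=> /andP[/andP[_ /eqP e0] pl] [<- lx]; rewrite -(grange_loop e0); exact: IH lx.
by move=> pl [<- /(IH _ pl)].
Qed.

Lemma pure_gen_comm v g h : pure_gen g -> pure_gen h -> psrc g = v -> psrc h = v ->
  pval g * pval h = pval h * pval g.
Proof.
have te b i e : is_alpha e -> st b i (gsource e) * se e = se e * st b i (gsource e).
  by move=> /andP[_ /eqP e0]; rewrite ste /tshift e0 andbF grange_loop.
case: g h => [e|b i w] [f|c j u] /= pg ph; last first.
- by move=> -> ->; exact: st_comm.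
- by move=> -> fv; rewrite -fv te.
- by move=> ev ->; rewrite -ev te.
move=> ev fv; case/andP: pg ph => fe /eqP e0 /andP[_ /eqP f0].
have [ef|/eqP ef] := eqVneq (gblock e) (gblock f).
  by have -> : e = f by apply: gedge_eq; rewrite ?ev ?fv ?e0 ?f0.
have fs : gsource f = gsource e by rewrite ev fv.
by have [] := salpha_comm fe fs e0 f0 ef.
Qed.

Lemma pure_comm1 v g l : pure_gen g -> psrc g = v -> prng g = v -> pure l -> wok v l v ->
  pval g * wval v l = wval v l * pval g.
Proof.
move=> pg gv gr; elim: l => [|h l IH] /=.
  by move=> _ _; rewrite -{2}gv svp -{1}gr spv.
move=> /andP[ph pl] [hv lv].
have hr : prng h = v.
  by apply: (@pure_end v [:: h] (prng h)) => //=; rewrite /pure /= ph.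
rewrite hr in lv *; rewrite mulgA (pure_gen_comm pg ph gv hv) -mulgA IH //.
by rewrite mulgA.
Qed.

Lemma pure_comm v l m : pure l -> wok v l v -> pure m -> wok v m v ->
  wval v l * wval v m = wval v m * wval v l.
Proof.
move=> + + pm mv; elim: l => [|g l IH] /=; first by rewrite (svw mv) (swv mv).
move=> /andP[pg pl] [gv lv].
have gr : prng g = v.
  by apply: (@pure_end v [:: g] (prng g)) => //=; rewrite /pure /= pg.
rewrite gr in lv *; rewrite -mulgA (IH pl lv) mulgA (pure_comm1 pg gv gr pm mv).
by rewrite mulgA.
Qed.

(** Pure words commute, so a vanishing l^* m would give m = l^* l m = l^* m l = 0. *)
Lemma pure_meet v l m : pure l -> wok v l v -> pure m -> wok v m v ->
  wproj v l * wval v m <> 0.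
Proof.
move=> pl lv pm mv h; apply: (wval_neq0 mv).
have e : (wval v l)^* * wval v m = 0.
  have := congr1 (fun s => (wval v l)^* * s) h.
  rewrite muls0 /wproj -!mulgA (mulgA (wval v l)^* (wval v l)) (sww lv).
  by rewrite mulgA (ssvw lv).
by rewrite -(svw mv) -(sww lv) -mulgA (pure_comm pl lv pm mv) mulgA e mul0s.
Qed.

(* The projections of the pure words at a free vertex [v] form a filter base
   (the point at infinity of [v]) which any other word avoids. *)
Lemma word_free v l x : gfree v -> wok v l x -> pure l \/
  ((exists m, [/\ pure m, wok v m v & wproj v m * wval v l = 0]) /\
   forall i, (i < kblocks v)%N ->
     exists e, [/\ gsource e = v, gblock e = i & eproj e * wval v l = wval v l]).
Proof.
move=> fv; elim: l => [|g l IH] /=; first by left.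
move=> [gv lx]; have [pg|npg] := boolP (pure_gen g); last first.
  right; case: g gv lx npg => [e|//] /= gv lx npg; subst v.
  have e0 : gpos e != 0%N by move: npg; rewrite /is_alpha fv.
  pose a i (ik : (i < kblocks (gsource e))%N) : gedge D := Gedge (edge_pred0 ik).
  (* The loop in the set of [e] is orthogonal to [e]. The loop of any other set acts on [e] as an
     invertible t, so its cylinder contains that of [e]. *)
  split=> [|i ik].
    exists [:: PE (a _ (gblock_lt e))]; split.
    - by rewrite /pure /= /is_alpha /= fv.
    - by split=> //=; exact: grange_loop.
    rewrite /wproj wval1 /= -mulgA (mulgA (se _)^* (se e)) sef ?mul0s ?muls0 //.
    by move=> h; move: e0; rewrite -h.
  have [ie|/eqP ie] := eqVneq i (gblock e).
    by exists e; split=> //; rewrite mulgA eproj_se.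
  exists (a i ik); split=> //; rewrite mulgA; congr (_ * _).
  have [h1 h2] := @salpha_beta D (a i ik) e fv erefl erefl e0 ie.
  by rewrite /eproj -mulgA h2 mulgA h1 -mulgA st_inv sev.
have gr : prng g = v.
  by apply: (@pure_end v [:: g] (prng g)) => //=; rewrite /pure /= pg.
rewrite gr in lx *; case: (IH lx) => [pl|[[m [pm mv ml]] le]]; first by left; apply/andP.
right; split=> [|i ik]; first exists (g :: m).
  split; [by rewrite /pure /= pg|by split; rewrite ?gr|].
  have gE : sv v * wval v l = wval v l by exact: svw lx.
  rewrite /wproj /= gr starM.
  have -> : pval g * wval v m * ((wval v m)^* * (pval g)^*) * (pval g * wval v l) =
    pval g * (wval v m * (wval v m)^* * (((pval g)^* * pval g) * wval v l)) by rewrite !mulgA.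
  by rewrite spp gr gE -/(wproj v m) ml muls0.
have [e [ev ei el]] := le i ik; case: g gv gr pg => [f|b j w] /= gv gr pg.
  case/andP: pg => ff /eqP f0; have [fi|fi] := pselect (gblock f = i).
    by exists f; split=> //; rewrite mulgA eproj_se.
  exists e; split=> //; rewrite mulgA eproj_alpha ?ev //; first by rewrite -mulgA el.
  by move=> h; apply: fi; rewrite -h.
by exists e; split=> //; rewrite mulgA gv -ev eproj_st -mulgA ev el.
Qed.

End WordCovers.

(** * Cylinders and the vertex of an idempotent *)

Section CylinderDecompositions.
Variable D : graphData.
Local Notation V := (gvert D).
Local Notation S := (SEC_inverse (@sec_inverse D)).
Local Notation "0" := (szero : S) : group_scope.
Implicit Types (v w x y : V) (e : gedge D) (i : nat) (l : seq (pgen D)).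
Implicit Types (f g h z q : S) (p : tight_space S) (s : seq S).

Lemma idem_word z : idem z -> z = 0 \/
  exists v l x, wok v l x /\ z = wproj v l.
Proof.
move=> zz; have e : z * z^* = z by rewrite (idem_star zz).
case: (sec_proj z) => [h|[v [l [x [lx h]]]]]; first by left; rewrite -e h.
by right; exists v, l, x; rewrite -[LHS]e h.
Qed.

Definition is_vert z v := exists q, q * q^* = z /\ q^* * q = sv v.

Lemma idem_wproj v l : idem (wproj v l : S).
Proof. exact: (idemsV (wval v l : S)). Qed.

Lemma idem_sv v : idem (sv v : S).
Proof. exact: svv. Qed.

Lemma is_vert_ex z : idem z -> z <> 0 -> exists v, is_vert z v.
Proof.
move=> zz z0; case: (idem_word zz) => // -[v [l [x [lx ->]]]].
by exists x, (wval v l); split=> //; exact: sww lx.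
Qed.

(** The idempotent [sv w] fixes the base point at [w], and a word whose range contains a base point
    consists of t's, so it ends where it starts. *)
Lemma wproj_vertex v l x w : wok v l x -> wproj v l = sv w -> x = w.
Proof.
move=> lx e; have : mact (sv w) (mbase w) (mbase w) by apply/mact_sv.
rewrite -e => /mactM[r /mactS/(mact_wval _ _ lx)[_ /esym/wfun_base[ul _]] _].
rewrite (unit_word ul lx); apply: contrapT => vw; apply: (@sv_neq0 D w).
have wE : wproj v l = sv v * wproj v l by rewrite /wproj mulgA (svw lx).
by rewrite -e wE e sv_orth.
Qed.

Lemma is_vert_uniq z v w : is_vert z v -> is_vert z w -> v = w.
Proof.
move=> [q1 [e1 f1]] [q2 [e2 f2]]; set q := q2^* * q1.
have qq : q * q^* = sv w.
  have -> : q * q^* = q2^* * (q1 * q1^*) * q2 by rewrite /q starM starK !mulgA.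
  by rewrite e1 -e2 !mulgA mulVsV f2.
have q'q : q^* * q = sv v.
  have -> : q^* * q = q1^* * (q2 * q2^*) * q1 by rewrite /q starM starK !mulgA.
  by rewrite e2 -e1 !mulgA mulVsV f1.
case: (sec_wordP (q : SEC (data_adaptable D))) => [q0|[a [l [b [l' [x [lx l'x qE]]]]]]].
  by case: (@sv_neq0 D w); rewrite -qq q0 mul0s.
have h1 : wproj a l = sv w.
  rewrite -qq qE starM starK -!mulgA (mulgA _ (wval b l')) (sww l'x) (ssvw lx) //.
have h2 : wproj b l' = sv v.
  rewrite -q'q qE starM starK -!mulgA (mulgA _ (wval a l)) (sww lx) (ssvw l'x) //.
by rewrite -(wproj_vertex lx h1) -(wproj_vertex l'x h2).
Qed.

Lemma is_vert_sv v : is_vert (sv v) v.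
Proof. by exists (sv v); rewrite sv_star svv. Qed.

Lemma is_vert_conj q z v : q^* * q * z = z -> is_vert z v -> is_vert (q * z * q^*) v.
Proof.
move=> qz [r [rE r'E]]; exists (q * r); rewrite starM; split.
  by rewrite -rE !mulgA.
rewrite -r'E -!mulgA; congr (_ * _); rewrite !mulgA.
have -> : r = z * r by rewrite -rE mulsVs.
by rewrite mulgA qz.
Qed.

Lemma is_vert_neq0 z v : is_vert z v -> z <> 0.
Proof.
move=> [q [qE q'E]] z0; apply: (@sv_neq0 D v).
by rewrite -q'E -[q](mulsVs q) qE z0 mul0s muls0.
Qed.

Lemma sv_kblocks_reg v i : ~~ gfree v -> (i < kblocks v)%N -> i = 0%N.
Proof.
by move=> rv; have [w [X [rE _ _]]] := greg_rel rv; rewrite /kblocks rE ltnS leqn0 => /eqP.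
Qed.

Lemma block_edges v i : (i < kblocks v)%N -> exists E : seq (gedge D),
  [/\ uniq E, forall e, e \in E <-> gsource e = v /\ gblock e = i
    & map (@grange D) E = grow v i].
Proof.
move=> ik; have ep (t : 'I_(size (grow v i))) : edge_pred (v, i, t : nat).
  by rewrite /edge_pred /= [(_ < _)%N]ik /=.
exists [seq Gedge (ep t) | t <- enum 'I_(size (grow v i))]; split.
- rewrite map_inj_uniq ?enum_uniq // => t t' /(congr1 (@gpos D)); exact: val_inj.
- move=> e; split=> [/mapP[t _ ->] //|[ev ei]].
  have tl : (gpos e < size (grow v i))%N by rewrite -ev -ei; exact: gpos_lt.
  by apply/mapP; exists (Ordinal tl); rewrite ?mem_enum //; apply: gedge_eq.
- rewrite -map_comp -[RHS]take_size -(map_nth_iota0 v (leqnn _)) -val_enum_ord -map_comp.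
  exact: eq_map.
Qed.

Lemma eproj_sv e : sv (gsource e) * eproj e = eproj e.
Proof. by rewrite /eproj mulgA sve. Qed.

Lemma eproj_svr e : eproj e * sv (gsource e) = eproj e.
Proof.
have := congr1 (@star _) (eproj_sv e).
by rewrite starM sv_star /eproj starM starK.
Qed.

Lemma idem_eproj e : idem (eproj e : S).
Proof. exact: eproj_idem. Qed.

Lemma eproj_neq0 e : eproj e <> szero.
Proof.
move=> h; apply: (@sv_neq0 D (grange e)); rewrite -see -[se e in X in _ * X]eproj_se.
by rewrite h mul0s muls0.
Qed.

Lemma eproj_orth e e' : gsource e = gsource e' -> gblock e = gblock e' -> e <> e' ->
  eproj e * eproj e' = szero.
Proof.
by move=> es eb ee; rewrite /eproj -mulgA (mulgA _ (se e')) sef // mul0s muls0.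
Qed.

Lemma wproj_vert v l x w : wok v l x -> wproj v l <> szero ->
  wproj v l * sv w = wproj v l -> v = w.
Proof.
move=> lx l0 h; apply: contrapT => vw; apply: l0; rewrite -h /wproj -(sswv lx).
by rewrite -!mulgA sv_orth // !muls0.
Qed.

(** This makes the edges of one set a finite cover in the sense of tight filters. At a free vertex a
    pure word meets the loop of the set and any other word lies below one of its edges. At a regular
    vertex a word of t's has the whole vertex as its projection. *)
Lemma block_cover v i f : (i < kblocks v)%N -> idem f -> f * sv v = f -> f <> 0 ->
  exists e, [/\ gsource e = v, gblock e = i & f * eproj e <> 0].
Proof.
move=> ik ff fv f0; case: (idem_word ff) => // -[w [l [x [lx fE]]]]; subst f.
have wv := wproj_vert lx f0 fv; subst w.
suff [e [ev ei el]] : exists e, [/\ gsource e = v, gblock e = i & eproj e * wval v l <> szero].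
  exists e; split=> // h; apply: el.
  have {}h : eproj e * wproj v l = szero.
    by have := idemC ff (idem_eproj e); rewrite h => <-.
  have := congr1 (fun u : SEC (data_adaptable D) => u * wval v l) h.
  rewrite mul0s /wproj -!mulgA (sww lx).
  by rewrite (swv lx).
have e0 e : eproj e * wval v l = wval v l -> eproj e * wval v l <> szero.
  by move=> -> ; exact: wval_neq0 lx.
have [fv'|rv] := boolP (gfree v).
  case: (word_free fv' lx) => [pl|[_ /(_ i ik)[e [ev ei el]]]]; last first.
    by exists e; split=> //; exact: e0.
  exists (Gedge (edge_pred0 ik)); split=> //.
  have xv := pure_end pl lx; subst x.
  have := @pure_meet D v [:: PE (Gedge (edge_pred0 ik))] l.
  rewrite /wproj wval1 /=; apply=> //.
    by rewrite /pure /= /is_alpha /= fv'.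
  by split=> //; exact: grange_loop.
have i0 := sv_kblocks_reg rv ik; subst i.
case: (word_head lx) => [ul|[e [ev el]]].
  exists (Gedge (edge_pred0 ik)); split=> // h; apply: (@eproj_neq0 (Gedge (edge_pred0 ik))).
  have := congr1 (fun u : SEC (data_adaptable D) => u * (wval v l)^*) h; rewrite mul0s -mulgA.
  have xv := unit_word ul lx; subst x.
  rewrite (unit_word_unitary ul lx) => <-.
  by rewrite (eproj_svr (Gedge (edge_pred0 ik))).
exists e; split=> //; last exact: e0.
by apply: (@sv_kblocks_reg v) => //; rewrite -ev; exact: gblock_lt.
Qed.

(** Counted with multiplicity, so that equality of [cnt s] with the indicator of a set says both
    that the cylinders are disjoint and that the set is their union. *)
Definition cnt s p : nat := count (fun z => `[< tight_dom z p >]) s.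

Lemma cnt_cat s s' p : cnt (s ++ s') p = (cnt s p + cnt s' p)%N.
Proof. exact: count_cat. Qed.

Lemma cnt_gt0 s p : (0 < cnt s p)%N -> exists2 z, z \in s & tight_dom z p.
Proof. by rewrite -has_count => /hasP[z zs /asboolP]; exists z. Qed.

(** Tightness of [p] and [block_cover] put [p] into at least one of the cylinders, orthogonality of
    the edges into at most one. *)
Lemma block_cnt v i E p : (i < kblocks v)%N -> uniq E ->
  (forall e, e \in E <-> gsource e = v /\ gblock e = i) ->
  cnt [seq eproj e | e <- E] p = `[< tight_dom (sv v : S) p >].
Proof.
move=> ik uE EP; rewrite /cnt count_map.
have [pv|npv] := asboolP (tight_dom (sv v : S) p); last first.
  apply/eqP; rewrite -leqn0 leqNgt -has_count; apply/hasP => -[e /EP[ev _] /asboolP pe].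
  apply: npv; apply: (tightS pe); first exact: idem_sv.
  by rewrite -ev; exact: eproj_svr.
have cov : finite_cover (sv v : S) [set` [seq (eproj e : S) | e <- E]].
  split; first exact: finite_seq.
    move=> _ /= /mapP[e /EP[ev _] ->]; split; first exact: idem_eproj.
    by rewrite -(idemC (idem_sv v) (idem_eproj e)) -ev; exact: eproj_sv.
  move=> f ff fv f0; have [e [ev ei fe]] := block_cover ik ff fv f0.
  by exists (eproj e) => //=; apply: map_f; apply/EP.
have [z [/= /mapP[e eE ->] pe]] := tight_tight pv cov.
have [ev ei] := (EP e).1 eE.
rewrite (@eq_in_count _ _ (pred1 e)); first by rewrite (count_uniq_mem _ uE) eE.
move=> e' /EP[e'v e'i] /=; apply/asboolP/eqP => [pe'|-> //].
apply: contrapT => ne; have [_ _ p0 _ _] := tight_filter p; apply: p0.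
have <- : eproj e * eproj e' = szero by apply: eproj_orth; rewrite ?ev ?ei //; exact: nesym.
exact: tightM.
Qed.

End CylinderDecompositions.

(** * Finite disjoint decompositions into cylinders *)

Section CylinderMeasure.
Variable D : graphData.
Local Notation V := (gvert D).
Local Notation S := (SEC_inverse (@sec_inverse D)).
Local Notation "0" := (szero : S) : group_scope.
Implicit Types (v w x y : V) (e : gedge D) (i : nat) (l : seq (pgen D)).
Implicit Types (f g h z q : S) (p : tight_space S) (s : seq S).

Lemma cnt_conj q s p (pq : tight_dom ((q^*)^* * q^*) p) :
  (forall h, h \in s -> idem h) ->
  cnt [seq q * h * q^* | h <- s] p = cnt s (act pq).
Proof.
move=> sI; rewrite /cnt count_map; apply: eq_in_count => h hs /=.
apply: asbool_equiv_eq; split; last by case=> _; rewrite starK.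
by move=> ph; apply/actP; rewrite starK; split=> //; exact: sI.
Qed.

Lemma cnt_conj0 q s p : ~ tight_dom ((q^*)^* * q^*) p ->
  cnt [seq q * h * q^* | h <- s] p = 0%N.
Proof.
move=> np; apply/eqP; rewrite -leqn0 leqNgt; apply/negP => /cnt_gt0[_ /mapP[h _ ->] ph].
apply: np; apply: (tightS ph); first exact: idemVs.
by rewrite starK -!mulgA (mulgA q^*) mulVsV.
Qed.

Lemma tight_dom_act q p (pq : tight_dom ((q^*)^* * q^*) p) : tight_dom (q^* * q) (act pq).
Proof.
apply/actP; split; first exact: idemVs.
rewrite starK; apply: (tightS pq); first by have := idem_conjV q (idemVs q).
by rewrite starK !mulgA mulsVs -!mulgA (mulgA q^*) mulVsV.
Qed.

Lemma cnt_conj_compl q s f :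
  (forall h, h \in s -> idem h) -> idem f ->
  (forall p, (cnt s p + `[< tight_dom f p >])%N = `[< tight_dom (q^* * q)%g p >]) ->
  forall p, (cnt [seq (q * h * q^*)%g | h <- s] p + `[< tight_dom (q * f * q^*)%g p >])%N =
    `[< tight_dom (q * q^*)%g p >].
Proof.
move=> sI ff sc p; have [pq|npq] := pselect (tight_dom ((q^*)^* * q^*) p); last first.
  have npq' : ~ tight_dom (q * q^*)%g p by move: npq; rewrite starK.
  rewrite (cnt_conj0 _ npq) (asboolF npq') asboolF // => ph; apply: npq'.
  apply: (tightS ph); first exact: idemsV.
  by rewrite -!mulgA (mulgA q^*) mulVsV.
have pq' : tight_dom (q * q^*)%g p by move: pq; rewrite starK.
rewrite (cnt_conj pq) // (asboolT pq').
have := sc (act pq); rewrite (asboolT (tight_dom_act pq)) => <-.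
congr (_ + nat_of_bool _)%N; apply: asbool_equiv_eq; split.
  by move=> ph; apply/actP; rewrite starK; split.
by case=> _; rewrite starK.
Qed.

(** Outside the cylinder of a path lie the other edges in the set of its first edge, and the
    translate of what lies outside the cylinder of its tail. A leading t contributes nothing. *)
Lemma word_compl v l x : wok v l x -> exists s,
  (forall g, g \in s -> idem g /\ g * sv v = g) /\
  forall p, (cnt s p + `[< tight_dom (wproj v l : S) p >])%N = `[< tight_dom (sv v : S) p >].
Proof.
elim: l v => [|g l IH] v /=.
  move=> _; exists [::]; split=> // p; rewrite add0n /wproj /= sv_star svv //.
move=> [gv /IH[s' [s'I s'c]]]; subst v; set q : S := pval g.
have qq : q^* * q = sv (prng g) by exact: spp.
have [s2 [s2I s2c]] : exists s2, (forall h, h \in s2 -> idem h /\ h * sv (psrc g) = h) /\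
    forall p, (cnt s2 p + `[< tight_dom (q * q^*)%g p >])%N = `[< tight_dom (sv (psrc g) : S) p >].
  rewrite /q; case: g {IH s' s'I s'c q qq} => [e|b i v] /=; last first.
    exists [::]; split=> // p; rewrite add0n.
    by rewrite (_ : st b i v * _ = sv v :> S) //= st_star st_inv.
  have [E [uE EP _]] := block_edges (gblock_lt e).
  have eE : e \in E by apply/EP.
  exists [seq (eproj e' : S) | e' <- rem e E]; split.
    move=> _ /mapP[e' e'E ->]; split; first exact: idem_eproj.
    by have [<- _] := (EP e').1 (mem_rem e'E); exact: eproj_svr.
  move=> p; rewrite -(block_cnt p (gblock_lt e) uE EP).
  by rewrite /cnt !count_map (permP (perm_to_rem eE)) /= addnC.
exists ([seq q * h * q^* | h <- s'] ++ s2); split=> [h|p].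
  rewrite mem_cat => /orP[/mapP[h' /s'I[hh _] ->]|/s2I//].
  split; first exact: idem_conjV.
  by rewrite -!mulgA; congr (_ * (_ * _)); have := congr1 (@star _) (svp g); rewrite starM sv_star.
rewrite -(s2c p) cnt_cat; have wE : wproj (psrc g) (g :: l) = q * wproj (prng g) l * q^* :> S.
  by rewrite /wproj /= starM /q !mulgA.
rewrite wE addnAC [RHS]addnC; congr (_ + _)%N.
apply: cnt_conj_compl => [h /s'I[]//||p']; first exact: idem_wproj.
by rewrite s'c qq.
Qed.

Lemma tight_dom00 p : `[< tight_dom (0 : S) p >] = false.
Proof. by rewrite asboolF // tight_dom0. Qed.

(** This is [word_compl] transported to z along an equivalence q with a vertex. *)
Lemma idem_compl f z : idem z -> idem f -> f * z = f -> exists s,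
  (forall g, g \in s -> idem g /\ g * z = g) /\
  forall p, (cnt s p + `[< tight_dom f p >])%N = `[< tight_dom z p >].
Proof.
move=> zz ff fz; have [f0|f0] := pselect (f = 0).
  exists [:: z]; split=> [g|p]; first by rewrite inE => /eqP->.
  by rewrite f0 tight_dom00 /cnt /= !addn0.
have z0 : z <> 0 by move=> z0; apply: f0; rewrite -fz z0 muls0.
have [x [q [qE q'E]]] := is_vert_ex zz z0.
have fE : q * (q^* * f * q) * q^* = f.
  have -> : q * (q^* * f * q) * q^* = (q * q^*) * f * (q * q^*) by rewrite !mulgA.
  by rewrite qE -mulgA fz (idemC zz ff).
have f'I : idem (q^* * f * q) by exact: idem_conj.
case: (idem_word f'I) => [h|[v [l [y [ly fl]]]]].
  by case: f0; rewrite -fE h muls0 mul0s.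
have l0 : wproj v l <> szero.
  by rewrite -fl => h; apply: f0; rewrite -fE h muls0 mul0s.
have vx : v = x.
  by apply: (wproj_vert ly l0); rewrite -fl -q'E -!mulgA (mulgA q) mulsVs.
subst v; have [s [sI sc]] := word_compl ly.
exists [seq q * h * q^* | h <- s]; split=> [_ /mapP[h /sI[hh _] ->]|p].
  by split; [exact: idem_conjV|rewrite -qE -!mulgA (mulgA q^*) mulVsV].
rewrite -qE -[in LHS]fE; apply: cnt_conj_compl => [h /sI[]//|//|p'].
by rewrite q'E fl sc.
Qed.

Definition dec (Q : S -> Prop) (A : set (tight_space S)) s : Prop :=
  (forall z, z \in s -> idem z /\ Q z) /\ forall p, cnt s p = `[< A p >].

Definition hereditary (Q : S -> Prop) :=
  forall f z, idem f -> f * z = f -> Q z -> Q f.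

Lemma cnt_diff1 (Q : S -> Prop) s z : hereditary Q -> idem z ->
  (forall a, a \in s -> idem a /\ Q a) ->
  exists s', (forall a, a \in s' -> idem a /\ Q a) /\
    forall p, cnt s' p = if `[< tight_dom z p >] then 0%N else cnt s p.
Proof.
move=> Qh zz; elim: s => [|a s IH] sI.
  by exists [::]; split=> // p; rewrite if_same.
have [|s' [s'I s'c]] := IH; first by move=> b bs; apply: sI; rewrite inE bs orbT.
have [aa Qa] := sI a (mem_head _ _).
have [|c [cI cc]] := idem_compl aa (idemM aa zz) _.
  by rewrite -mulgA (idemC zz aa) mulgA aa.
exists (c ++ s'); split=> [b|p].
  rewrite mem_cat => /orP[/cI[bb ba]|/s'I//].
  by split=> //; exact: Qh ba Qa.
have := cc p; rewrite cnt_cat s'c tight_domM // asbool_and /=.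
by case: `[< tight_dom z p >]; rewrite ?andbT ?andbF ?addn0 /cnt /=; case: asboolP => //; lia.
Qed.

Lemma cnt_diff (Q : S -> Prop) s t : hereditary Q ->
  (forall a, a \in s -> idem a /\ Q a) -> (forall a, a \in t -> idem a /\ Q a) ->
  exists s', (forall a, a \in s' -> idem a /\ Q a) /\
    forall p, cnt s' p = if (0 < cnt t p)%N then 0%N else cnt s p.
Proof.
move=> Qh sI; elim: t => [|z t IH] tI; first by exists s.
have [|s' [s'I s'c]] := IH; first by move=> b bs; apply: tI; rewrite inE bs orbT.
have [zz _] := tI z (mem_head _ _).
have [s2 [s2I s2c]] := cnt_diff1 Qh zz s'I.
exists s2; split=> // p; rewrite s2c s'c /cnt /=.
by case: `[< tight_dom z p >].
Qed.

Lemma dec_union (Q : S -> Prop) A B s t : hereditary Q -> dec Q A s -> dec Q B t ->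
  exists u, dec Q (A `|` B) u.
Proof.
move=> Qh [sI sc] [tI tc]; have [s' [s'I s'c]] := cnt_diff Qh sI tI.
exists (s' ++ t); split=> [z|p]; first by rewrite mem_cat => /orP[/s'I|/tI].
rewrite cnt_cat s'c tc sc asbool_or.
by case: `[< A p >]; case: `[< B p >].
Qed.

(** A finite subcover is made disjoint with [cnt_diff], which replaces each difference by smaller
    cylinders; [hereditary] keeps [Q] true on these. *)
Lemma dec_compact (Q : S -> Prop) A : hereditary Q -> compact A ->
  (forall p, A p -> exists z, [/\ idem z, Q z, tight_dom z p & tight_dom z `<=` A]) ->
  exists s, dec Q A s.
Proof.
move=> Qh cA bA; have [[p0 _]|A0] := pselect (A !=set0); last first.
  by exists [::]; split=> // p; rewrite asboolF // => Ap; apply: A0; exists p.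
(* [compact_cover] is only available on pointed spaces. *)
pose T : ptopologicalType := HB.pack (tight_space S) (isPointed.Build (tight_space S) p0).
have {}cA : @cover_compact T A by rewrite -compact_cover.
have [||F FQ AF] := cA S [set z | [/\ idem z, Q z & tight_dom z `<=` A]] (@tight_dom S).
- by move=> z _; exact: tight_dom_open.
- by move=> p /bA[z [zz Qz pz zA]]; exists z.
have {AF} AE : A = [set p | exists2 z, z \in (F : seq S) & tight_dom z p].
  rewrite eqEsubset; split=> p; first by move=> /AF[z zF pz]; exists z.
  by move=> [z zF pz]; have /set_mem[_ _] := FQ z zF; apply.
have FQ' z : z \in (F : seq S) -> idem z /\ Q z by move=> /FQ/set_mem[].
rewrite {}AE {bA cA FQ A}; elim: (F : seq S) FQ' => [|z s IH] sI.
  by exists [::]; split=> // p; rewrite asboolF // => -[].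
have [|t tdec] := IH; first by move=> b bs; apply: sI; rewrite inE bs orbT.
have [zz Qz] := sI z (mem_head _ _).
have zdec : dec Q (tight_dom z) [:: z].
  by split=> [b|p]; [rewrite inE => /eqP->|rewrite /cnt /= addn0].
have [u udec] := dec_union Qh zdec tdec; exists u.
suff -> : [set p | exists2 a, a \in z :: s & tight_dom a p] =
    tight_dom z `|` [set p | exists2 a, a \in s & tight_dom a p] by [].
rewrite eqEsubset; split=> p /=.
  by move=> [a]; rewrite inE => /orP[/eqP->|as_] pa; [left|right; exists a].
by move=> [pz|[a as_ pa]]; [exists z; rewrite ?mem_head|exists a; rewrite // inE as_ orbT].
Qed.

(** A basic neighbourhood is a cylinder with finitely many others removed. By [idem_compl] what
    remains after one removal is a union of cylinders, so each removal is replaced by passing to the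
    piece that contains [p]. *)
Lemma tight_basis p (A : set (tight_space S)) : nbhs p A ->
  exists z, [/\ idem z, tight_dom z p & tight_dom z `<=` A].
Proof.
move=> /tight_nbhs[e [Z [pe pZ PA]]]; have ee := tight_idem pe.
suff [z [zz pz ze zZ]] : exists z, [/\ idem z, tight_dom z p, z * e = z
    & forall h, h \in Z -> z * h = 0].
  exists z; split=> // y yz; apply: PA; first exact: (tightS yz).
  move=> h /zZ zh yh; have [_ _ y0 _ _] := tight_filter y; apply: y0.
  by rewrite -zh; exact: tightM.
elim: Z pZ {PA} => [|h Z IH] pZ; first by exists e.
have [|z [zz pz ze zZ]] := IH; first by move=> b bs; apply: pZ; rewrite inE bs orbT.
have [hh ph] := pZ h (mem_head _ _).
have [|c [cI cc]] := idem_compl zz (idemM zz hh) _.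
  by rewrite -mulgA (idemC hh zz) mulgA zz.
have [g gc pg] : exists2 g, g \in c & tight_dom g p.
  apply: cnt_gt0; have := cc p; rewrite (asboolT pz) [X in (_ + nat_of_bool X)%N]asboolF.
    by rewrite addn0 => ->.
  by rewrite tight_domM // => -[].
have [gg gz] := cI g gc; exists g; split=> //; first by rewrite -gz -mulgA ze.
move=> k; rewrite inE => /orP[/eqP->|/zZ zk]; last by rewrite -gz -mulgA zk muls0.
apply: tight_dom_set0; first exact: idemM.
rewrite -subset0 tight_domM // => y [yg yh].
have yz : tight_dom z y by exact: (tightS yg).
have := cc y; rewrite (asboolT yz) [X in (_ + nat_of_bool X)%N]asboolT ?tight_domM //.
suff : (0 < cnt c y)%N by lia.
by rewrite -has_count; apply/hasP; exists g => //; exact/asboolP.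
Qed.

End CylinderMeasure.

(** * Additivity of the weight *)

Section VertexWeight.
Variable D : graphData.
Local Notation V := (gvert D).
Local Notation S := (SEC_inverse (@sec_inverse D)).
Local Notation "0" := (szero : S) : group_scope.
Implicit Types (v w x y : V) (e : gedge D) (i : nat) (l : seq (pgen D)).
Implicit Types (f g h z q : S) (p : tight_space S) (s : seq S).

Lemma cnt_conj_dom q s : (forall h, h \in s -> idem h) ->
  (forall p, cnt s p = `[< tight_dom (q^* * q)%g p >]) ->
  forall p, cnt [seq (q * h * q^*)%g | h <- s] p = `[< tight_dom (q * q^*)%g p >].
Proof.
move=> sI sc p; have i0 : idem 0 by exact: muls0.
have := @cnt_conj_compl D q s 0 sI i0 _ p.
rewrite muls0 mul0s !tight_dom00 addn0; apply=> p'.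
by rewrite tight_dom00 addn0.
Qed.

Lemma cnt_disjoint s z1 z2 : (forall z, z \in s -> idem z) ->
  (forall p, (cnt s p <= 1)%N) -> z1 \in s -> z2 \in s -> z1 <> z2 -> z1 * z2 = 0.
Proof.
move=> sI s1 z1s z2s z12; have i1 := sI _ z1s; have i2 := sI _ z2s.
apply: tight_dom_set0; first exact: idemM.
rewrite -subset0 tight_domM // => p [p1 p2]; have := s1 p.
suff : (1 < cnt s p)%N by lia.
rewrite /cnt (permP (perm_to_rem z1s)) /= (asboolT p1) add1n ltnS -has_count.
apply/hasP; exists z2; last exact/asboolP.
have : z2 \in z1 :: rem z1 s by rewrite -(perm_mem (perm_to_rem z1s)).
by rewrite inE => /orP[/eqP/esym|].
Qed.

(* A pure path meets every pure path, so if no member of the cover were pure,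
   a pure path could be shrunk to avoid all of them. *)
Lemma cover_pure v s : gfree v ->
  (forall z, z \in s -> exists l x, [/\ wok v l x & z = wproj v l]) ->
  (forall p, cnt s p = `[< tight_dom (sv v : S) p >]) ->
  exists l, [/\ wok v l v, pure l & (wproj v l : S) \in s].
Proof.
move=> fv sw sc; apply: contrapT => np.
have [m [mv pm ms]] : exists m, [/\ wok v m v, pure m &
    forall z, z \in s -> wproj v m * z = 0].
  have nps z : z \in s -> exists m, [/\ wok v m v, pure m & wproj v m * z = 0].
    move=> zs; have [l [x [lx zE]]] := sw _ zs; subst z.
    case: (word_free fv lx) => [pl|[[m [pm mv m0]] _]].
      by case: np; exists l; have xv := pure_end pl lx; subst x.
    by exists m; split=> //; rewrite mulgA m0 mul0s.
  elim: s nps {sw sc np} => [|z s IH] nps; first by exists [::].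
  have [|m [mv pm ms]] := IH; first by move=> b bs; apply: nps; rewrite inE bs orbT.
  have [m1 [m1v pm1 m1z]] := nps z (mem_head _ _).
  exists (m ++ m1); split; [exact: wok_cat mv m1v|by rewrite /pure all_cat; apply/andP|].
  have E1 : wproj v (m ++ m1) * wproj v m = wproj v (m ++ m1).
    have h : (wval v m : S)^* * (wval v m * (wval v m)^*) = (wval v m)^*.
      by rewrite mulgA mulVsV.
    by rewrite /wproj (wval_cat mv m1v) !starM -!mulgA h.
  have E2 : wproj v (m ++ m1) * wproj v m1 = wproj v (m ++ m1).
    have h : (wval v m1 : S)^* * (wval v m1 * (wval v m1)^*) = (wval v m1)^*.
      by rewrite mulgA mulVsV.
    by rewrite /wproj (wval_cat mv m1v) (pure_comm pm mv pm1 m1v) !starM -!mulgA h.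
  move=> h; rewrite inE => /orP[/eqP->|/ms h0].
    by rewrite -E2 -mulgA m1z muls0.
  by rewrite -E1 -mulgA h0 muls0.
have m0 : (wproj v m : S) <> 0.
  move=> h; apply: (wval_neq0 mv).
  by rewrite -[wval v m](mulsVs (wval v m : S)) -/(wproj v m) h mul0s.
have [p pm'] := tight_dom_neq0 (idem_wproj v m) m0.
have pv : tight_dom (sv v : S) p.
  apply: (tightS pm'); first exact: idem_sv.
  by rewrite /wproj -mulgA (sswv mv).
have [z zs pz] : exists2 z, z \in s & tight_dom z p.
  by apply: cnt_gt0; rewrite sc asboolT.
have [_ _ p0 _ _] := tight_filter p; apply: p0.
by rewrite -(ms z zs); exact: tightM.
Qed.

(** At a free vertex the pure member given by [cover_pure] is the only one, by [pure_meet]. The set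
    containing its first loop works: [word_free] provides an edge of this set for every other
    member. *)
Lemma cover_block v s : (forall z, z \in s -> [/\ idem z, z <> 0 & z * sv v = z]) ->
  (forall p, cnt s p = `[< tight_dom (sv v : S) p >]) ->
  (sv v : S) \in s \/ exists2 i, (i < kblocks v)%N &
    forall z, z \in s -> exists e, [/\ gsource e = v, gblock e = i & z * eproj e = z].
Proof.
move=> sI sc; have [vs|vs] := boolP ((sv v : S) \in s); [by left|right].
have sw z : z \in s -> exists l x, [/\ wok v l x & z = wproj v l].
  move=> zs; have [zz z0 zv] := sI _ zs.
  case: (idem_word zz) => // -[w [l [x [lx zE]]]]; subst z.
  by have wv := wproj_vert lx z0 zv; subst w; exists l, x.
have eS e l : eproj e * wval v l = wval v l -> (wproj v l : S) * eproj e = wproj v l.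
  by move=> el; rewrite -(idemC (idem_eproj e) (idem_wproj v l)) /wproj mulgA el.
have sh l x : wok v l x -> (wproj v l : S) \in s ->
    exists e, gsource e = v /\ eproj e * wval v l = wval v l.
  move=> lx ls; case: (word_head lx) => // ul.
  have xv := unit_word ul lx; subst x; case/negP: vs.
  by rewrite -(unit_word_unitary ul lx).
have [fv|rv] := boolP (gfree v); last first.
  exists 0%N; first by have [w [X [rE _ _]]] := greg_rel rv; rewrite /kblocks rE.
  move=> z zs; have [l [x [lx zE]]] := sw _ zs; subst z.
  have [e [ev el]] := sh _ _ lx zs; exists e; split=> //; last exact: eS.
  by apply: (@sv_kblocks_reg D v) => //; rewrite -ev; exact: gblock_lt.
have [l1 [l1v pl1 l1s]] := cover_pure fv sw sc.
have [e1 [e1v e1l]] := sh _ _ l1v l1s; exists (gblock e1).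
  by rewrite -e1v; exact: gblock_lt.
move=> z zs; have [->|zl] := pselect (z = wproj v l1).
  by exists e1; split=> //; exact: eS.
have [l [x [lx zE]]] := sw _ zs; subst z.
have l1l : (wproj v l1 : S) * wproj v l = 0.
  apply: cnt_disjoint l1s zs (nesym zl) => [z /sI[]//|p].
  by rewrite sc; case: `[< _ >].
case: (word_free fv lx) => [pl|[_ /(_ (gblock e1))]].
  have xv := pure_end pl lx; subst x; case: (pure_meet pl1 l1v pl lx).
  by rewrite -[wval v l](mulsVs (wval v l : S)) mulgA l1l mul0s.
have e1k : (gblock e1 < kblocks v)%N by rewrite -e1v; exact: gblock_lt.
by move=> /(_ e1k)[e [ev ei el]]; exists e; split=> //; exact: eS.
Qed.

Variables (M : nmodType) (val : V -> M).
Hypothesis valsat : grels_sat val.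

(** The default is the weight of the zero idempotent, which is equivalent to no vertex. *)
Definition weight z : M :=
  if pselect (exists v, is_vert z v) is left h then val (sval (cid h)) else 0%R.

Lemma weight_vert z v : is_vert z v -> weight z = val v.
Proof.
rewrite /weight => zv; case: pselect => [h|[]]; last by exists v.
by congr val; apply: is_vert_uniq (svalP (cid h)) zv.
Qed.

Lemma weight0 : weight 0 = 0%R.
Proof.
rewrite /weight; case: pselect => // h; exfalso; have [v zv] := h.
exact: is_vert_neq0 zv erefl.
Qed.

Lemma weight_conj q z : idem z -> q^* * q * z = z -> weight (q * z * q^*) = weight z.
Proof.
move=> zz qz; have [->|z0] := pselect (z = 0); first by rewrite muls0 mul0s.
have [v zv] := is_vert_ex zz z0.
by rewrite (weight_vert zv); apply: weight_vert; exact: is_vert_conj.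
Qed.

(** Conjugation by an edge e of the set given by [cover_block] turns the members below e into a
    decomposition of its range; the relation at [v] for this set adds up the results. *)
Lemma weight_sv v s : (forall z, z \in s -> [/\ idem z, z <> 0 & z * sv v = z]) ->
  (forall p, cnt s p = `[< tight_dom (sv v : S) p >]) ->
  val v = (\sum_(z <- s) weight z)%R.
Proof.
have [n] := ubnP (size s); elim: n s v => // n IH s v sn sI sc.
have sI' z : z \in s -> idem z by case/sI.
have s1 p : (cnt s p <= 1)%N by rewrite sc; case: `[< _ >].
case: (cover_block sI sc) => [vs|[i ik sE]].
  rewrite (perm_big _ (perm_to_rem vs)) big_cons /= (weight_vert (is_vert_sv v)).
  case rE: (rem _ s) => [|z t]; first by rewrite big_nil GRing.addr0.
  have zs : z \in s by apply: (mem_rem (x := sv v : S)); rewrite rE mem_head.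
  have [zz z0 zv] := sI _ zs; have [p pz] := tight_dom_neq0 zz z0.
  have pv : tight_dom (sv v : S) p by apply: (tightS pz) => //; exact: idem_sv.
  have := s1 p; rewrite /cnt (permP (perm_to_rem vs)) rE /= (asboolT pv) (asboolT pz).
  by [].
have [E [uE EP EG]] := block_edges ik.
pose P e z := z * eproj e == z.
have Pin e z p : P e z -> tight_dom z p -> tight_dom (eproj e : S) p.
  by move=> /eqP ez pz; apply: (tightS pz) => //; exact: idem_eproj.
have Euniq e e' p : e \in E -> e' \in E -> tight_dom (eproj e : S) p ->
    tight_dom (eproj e' : S) p -> e = e'.
  move=> /EP[ev ei] /EP[e'v e'i] pe pe'; apply: contrapT => ne.
  have [_ _ p0 _ _] := tight_filter p; apply: p0.
  have <- : eproj e * eproj e' = szero by apply: eproj_orth; rewrite ?ev ?ei.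
  exact: tightM.
have ev p e : e \in E -> tight_dom (eproj e : S) p -> tight_dom (sv v : S) p.
  move=> /EP[ev _] pe; apply: (tightS pe); first exact: idem_sv.
  by rewrite -ev; exact: eproj_svr.
have exP z : z \in s -> exists2 e, e \in E & P e z.
  by move=> /sE[e [e1 e2 ez]]; exists e; [exact/EP|apply/eqP].
(* A nonzero member contains a point, so it lies below exactly one edge of the set. *)
have -> : (\sum_(z <- s) weight z = \sum_(e <- E) \sum_(z <- s | P e z) weight z)%R.
  rewrite (exchange_big_dep xpredT) //= big_seq [RHS]big_seq; apply: eq_bigr => z zs.
  have [e eE ez] := exP z zs; have [zz z0 _] := sI _ zs.
  have [p pz] := tight_dom_neq0 zz z0.
  rewrite big_seq_cond (eq_bigl (fun e' => (e' \in E) && (e' == e))); last first.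
    move=> e'; have [e'E|//] := boolP (e' \in E); apply/idP/eqP => [e'z|-> //].
    exact: (Euniq _ _ p e'E eE (Pin _ _ _ e'z pz) (Pin _ _ _ ez pz)).
  by rewrite -big_seq_cond -big_filter filter_pred1_uniq // big_seq1.
rewrite (@valsat v (grow v i)); last by rewrite /grow mem_nth.
rewrite -EG big_map big_seq [RHS]big_seq; apply: eq_bigr => e eE.
rewrite -big_filter; set t := [seq z <- s | P e z].
have ts z : z \in t -> P e z /\ z \in s by rewrite mem_filter => /andP.
have tc p : cnt t p = `[< tight_dom (eproj e : S) p >].
  rewrite /cnt count_filter; have [pe|npe] := asboolP (tight_dom (eproj e : S) p).
    have := sc p; rewrite (asboolT (ev _ _ eE pe)) => <-.
    apply: eq_in_count => z zs /=; case: asboolP => //= pz.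
    have [e' e'E e'z] := exP z zs.
    by rewrite (Euniq _ _ p eE e'E pe (Pin _ _ _ e'z pz)).
  apply/eqP; rewrite -leqn0 leqNgt -has_count; apply/hasP => -[z zs /andP[/asboolP pz ez]].
  exact: npe (Pin _ _ _ ez pz).
(* A set of the separation has at least two edges. The cylinder of another edge [e'] contains a
   point, and the member of [s] containing this point is not below [e]. *)
have tn : (size t < n)%N.
  rewrite ltnS in sn; apply: leq_trans sn.
  rewrite size_filter ltn_neqAle count_size andbT -all_count; apply/negP => /allP al.
  have [e' e'E ee'] : exists2 e', e' \in E & e' <> e.
    have : (1 < size E)%N.
      by rewrite -(size_map (@grange D)) EG; exact: grow_size.
    case: (E) uE => [//|a [//|b E']] /= /andP[ab _] _.
    have [ae|ae] := eqVneq a e; last by exists a; rewrite ?mem_head //; apply/eqP.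
    exists b; first by rewrite !inE eqxx orbT.
    by move=> be; move: ab; rewrite ae be mem_head.
  have [p pe'] := tight_dom_neq0 (idem_eproj e') (@eproj_neq0 D e').
  have [z zs pz] : exists2 z, z \in s & tight_dom z p.
    by apply: cnt_gt0; rewrite sc asboolT //; exact: ev pe'.
  exact: ee' (Euniq _ _ p e'E eE pe' (Pin _ _ _ (al z zs) pz)).
have ee : ((se e)^*)^* * (se e)^* = eproj e by rewrite starK.
have eI z : z \in t -> eproj e * z = z.
  by move=> /ts[/eqP ez /sI' zz]; rewrite (idemC (idem_eproj e) zz).
rewrite (IH [seq (se e : S)^* * z * ((se e)^*)^* | z <- t] (grange e)).
- rewrite big_map big_seq [RHS]big_seq; apply: eq_bigr => z zt.
  have [_ /sI' zz] := ts _ zt.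
  by apply: (@weight_conj (se e)^*) => //; rewrite ee; exact: eI.
- by rewrite size_map.
- move=> _ /mapP[z zt ->]; have [_ zs] := ts _ zt; have [zz z0 _] := sI _ zs.
  split; first by exact: (@idem_conjV S (se e)^*).
    move=> h; apply: z0; rewrite -(eI z zt) (idemC (idem_eproj e) zz) -(eI z zt).
    have -> : eproj e * z * eproj e = se e * ((se e)^* * z * ((se e)^*)^*) * (se e)^* :> S.
      by rewrite starK /eproj !mulgA.
    by rewrite h muls0 mul0s.
  by rewrite starK -mulgA sev.
- move=> p; rewrite cnt_conj_dom => [|z /ts[_ /sI']//|p'].
    by rewrite starK see.
  by rewrite tc ee.
Qed.

Lemma weight_add z s : idem z -> (forall h, h \in s -> idem h /\ h * z = h) ->
  (forall p, cnt s p = `[< tight_dom z p >]) -> weight z = (\sum_(h <- s) weight h)%R.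
Proof.
move=> zz sI sc; rewrite (bigID (fun h : S => h == 0)) /=.
rewrite [X in (X + _)%R]big1 ?GRing.add0r; last first.
  by move=> h /eqP->; exact: weight0.
rewrite -big_filter; set t := [seq h <- s | _].
have ts h : h \in t -> [/\ idem h, h <> 0 & h * z = h].
  by rewrite mem_filter => /andP[/eqP w0 /sI[ww wz]].
have tc p : cnt t p = `[< tight_dom z p >].
  rewrite -sc /cnt count_filter; apply: eq_in_count => h ws /=.
  by case: asboolP => //= pw; apply/eqP => w0; rewrite w0 tight_dom0 in pw.
have [z0|z0] := pselect (z = 0).
  rewrite z0 weight0; case tE: (t) => [|h t']; first by rewrite big_nil.
  have [|_ w0 wz] := ts h; first by rewrite tE mem_head.
  by case: w0; rewrite -wz z0 muls0.
have [v zv] := is_vert_ex zz z0; rewrite (weight_vert zv); case: zv => q [qE q'E].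
have wE h : h \in t -> q * q^* * h = h.
  by move=> /ts[ww _ wz]; rewrite qE (idemC zz ww).
rewrite (@weight_sv v [seq q^* * h * (q^*)^* | h <- t]).
- rewrite big_map big_seq [RHS]big_seq; apply: eq_bigr => h wt.
  have [ww _ _] := ts _ wt; apply: weight_conj => //; rewrite starK; exact: wE.
- move=> _ /mapP[h wt ->]; have [ww w0 wz] := ts _ wt; split; first exact: (@idem_conjV S q^*).
    move=> e0; apply: w0; rewrite -wz -qE -(wE h wt).
    have -> : q * q^* * h * (q * q^*) = q * (q^* * h * q^*^*) * q^* by rewrite starK !mulgA.
    by rewrite e0 muls0 mul0s.
  by rewrite -q'E starK -!mulgA (mulgA q) mulsVs.
- move=> p; rewrite cnt_conj_dom => [|h /ts[]//|p'].
    by rewrite starK q'E.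
  by rewrite starK qE tc.
Qed.

End VertexWeight.

(** * The type semigroup *)

Section UnitSpaceMeasure.
Variable D : graphData.
Local Notation V := (gvert D).
Local Notation S := (SEC_inverse (@sec_inverse D)).
Local Notation "0" := (szero : S) : group_scope.
Implicit Types (v w x y : V) (e : gedge D).
Implicit Types (f g h z q : S) (p : tight_space S) (s t : seq S).
Implicit Types (Q : S -> Prop) (A B : set (tight_space S)) (W : set (germ S)).

Lemma dec_mem Q A s z p : dec Q A s -> z \in s -> tight_dom z p -> A p.
Proof.
move=> [_ sc] zs pz; have := sc p; case: asboolP => // _ c0.
have : (0 < cnt s p)%N by rewrite -has_count; apply/hasP; exists z => //; exact/asboolP.
by rewrite c0.
Qed.

Lemma dec_weaken Q A s : dec Q A s -> dec xpredT A s.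
Proof. by move=> [sI sc]; split=> // z /sI[]. Qed.

Lemma compact_open_dec Q A : hereditary Q -> Defs.compact_open A ->
  (forall p, A p -> exists z, [/\ idem z, Q z & tight_dom z p]) ->
  exists s, dec Q A s.
Proof.
move=> Qh [cA oA] AQ; apply: dec_compact => // p Ap.
have [h [hh ph hA]] : exists h, [/\ idem h, tight_dom h p & tight_dom h `<=` A].
  by apply: tight_basis; exact: open_nbhs_nbhs.
have [z [zz Qz pz]] := AQ p Ap; exists (h * z); split.
- exact: idemM.
- by apply: Qh Qz; [exact: idemM|rewrite -mulgA zz].
- exact: tightM.
- by rewrite tight_domM // => r [/hA].
Qed.

Variables (M : nmodType) (val : V -> M).
Hypothesis valsat : grels_sat val.
Local Notation weight := (weight val).

(** By [weight_add] both sums equal the sum over the common refinement, whose members are the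
    products z h. *)
Lemma dec_weight_uniq Q Q' A s t : dec Q A s -> dec Q' A t ->
  (\sum_(z <- s) weight z = \sum_(z <- t) weight z)%R.
Proof.
have half Q1 Q2 s1 s2 : dec Q1 A s1 -> dec Q2 A s2 ->
    (\sum_(z <- s1) weight z = \sum_(z <- s1) \sum_(h <- s2) weight (z * h)%g)%R.
  move=> d1 d2; rewrite big_seq [RHS]big_seq; apply: eq_bigr => z zs.
  have [zz _] := d1.1 z zs; rewrite -(big_map (fun h => z * h) xpredT).
  apply: (weight_add valsat) => // [_ /mapP[h hs ->]|p].
    have [hh _] := d2.1 h hs; split; first exact: idemM.
    by rewrite -mulgA (idemC hh zz) mulgA zz.
  have [pz|npz] := asboolP (tight_dom z p).
    transitivity (cnt s2 p); last by rewrite d2.2 asboolT //; exact: dec_mem d1 zs pz.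
    rewrite /cnt count_map; apply: eq_in_count => h hs /=.
    have [hh _] := d2.1 h hs; apply: asbool_equiv_eq; rewrite tight_domM //.
    by split=> [[]|].
  apply/eqP; rewrite -leqn0 leqNgt; apply/negP => /cnt_gt0[_ /mapP[h hs ->]].
  by have [hh _] := d2.1 h hs; rewrite tight_domM // => -[].
move=> d1 d2; rewrite (half _ _ _ _ d1 d2) (half _ _ _ _ d2 d1) exchange_big /=.
rewrite big_seq [RHS]big_seq; apply: eq_bigr => h hs.
rewrite big_seq [RHS]big_seq; apply: eq_bigr => z zs; congr weight.
by have [zz _] := d1.1 z zs; have [hh _] := d2.1 h hs; exact: idemC.
Qed.

Definition measure A : M :=
  if pselect (exists s, dec xpredT A s) is left h
  then (\sum_(z <- sval (cid h)) weight z)%R else 0%R.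

Lemma measureE Q A s : dec Q A s -> measure A = (\sum_(z <- s) weight z)%R.
Proof.
move=> sA; rewrite /measure; case: pselect => [h|[]]; last first.
  by exists s; exact: dec_weaken sA.
exact: dec_weight_uniq (svalP (cid h)) sA.
Qed.

Lemma compact_open_decT A : Defs.compact_open A -> exists s, dec xpredT A s.
Proof.
move=> cA; apply: compact_open_dec => // p _.
by have h := tight_eltP p; exists (tight_elt p); split=> //; exact: tight_idem h.
Qed.

Lemma measure_dom z : idem z -> measure (tight_dom z) = weight z.
Proof.
move=> zz; rewrite (@measureE xpredT _ [:: z]) ?big_seq1 //.
by split=> [b|p]; [rewrite inE => /eqP->|rewrite /cnt /= addn0].
Qed.

Lemma measure_disjoint A B : Defs.compact_open A -> Defs.compact_open B ->
  A `&` B = set0 -> measure (A `|` B) = (measure A + measure B)%R.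
Proof.
move=> /compact_open_decT[s sA] /compact_open_decT[t tB] AB.
rewrite (measureE sA) (measureE tB) -big_cat; apply: (@measureE xpredT).
split=> [z|p]; first by rewrite mem_cat => /orP[/sA.1|/tB.1].
rewrite cnt_cat sA.2 tB.2 asbool_or.
have : ~ (A p /\ B p) by move=> ABp; have : (A `&` B) p by []; rewrite AB.
by case: (asboolP (A p)); case: (asboolP (B p)) => // Bp Ap [].
Qed.

Lemma tight_dom_conj q z p : idem z -> q^* * q * z = z ->
  tight_dom (q * z * q^*) p <->
  exists p' (qp : tight_dom (q^* * q) p'), tight_dom z p' /\ act qp = p.
Proof.
move=> zz qz; have zE : q^* * (q * z * q^*) * q = z.
  by rewrite !mulgA qz -mulgA (idemC zz (idemVs q)) qz.
split=> [pz|[p' [qp [zp' <-]]]]; last first.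
  by apply/actP; split; [exact: idem_conjV|rewrite zE].
have qp : tight_dom ((q^*)^* * q^*) p.
  apply: (tightS pz); first exact: idemVs.
  by rewrite starK -!mulgA (mulgA q^*) mulVsV.
exists (act qp), (tight_dom_act qp); split.
  by apply/actP; rewrite starK.
apply: tight_space_inj; rewrite eqEsubset; split=> h.
  move=> [hh [_]]; rewrite starK => ph; apply: (tightS ph) => //.
  have -> : q * (q^* * h * q) * q^* = (q * q^*) * h * (q * q^*) by rewrite !mulgA.
  move: (idemsV q); move: (q * q^*) => a aa.
  by rewrite -!mulgA (idemC aa hh) (mulgA h h) hh.
move=> ph; have hh := tight_idem ph; split=> //; split; first exact: idem_conj.
have qp' : set_val p (q * q^*) by move: qp; rewrite starK.
rewrite starK; have -> : q * (q^* * h * q) * q^* = (q * q^*) * h * (q * q^*).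
  by rewrite !mulgA.
by apply: tightM => //; exact: tightM.
Qed.

(** By compactness the source splits into cylinders z over which [W] consists of germs of a single
    q. The translates q z q^* decompose the range because the range map is injective on [W], and
    conjugation preserves weights. *)
Lemma measure_bisection W : @compact_open_bisection (Gtight S) W ->
  measure (@germ_src S @` W) = measure (@germ_rng S @` W).
Proof.
move=> [[cW oW] Ws Wr].
pose Q z := idem z /\ exists q, z * (q^* * q) = z /\ germ_set q (tight_dom z) `<=` W.
have Qh : hereditary Q.
  move=> f z ff fz [zz [q [zq zW]]]; split=> //; exists q; split.
    by rewrite -fz -mulgA zq.
  by move=> _ [p [qp [pf ->]]]; apply: zW; exists p, qp; split=> //; exact: tightS pf _ _.
have [s sA] : exists s, dec Q (@germ_src S @` W) s.
  apply: dec_compact => //.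
    by apply: continuous_compact cW; apply: continuous_subspaceT; exact: germ_src_continuous.
  move=> _ [g Wg <-]; have [q [p [qp gE]]] := germP g; subst g; rewrite germ_srcE.
  have [|U [oU Up Uq UW]] := @germ_nbhs _ _ _ qp W; first exact: open_nbhs_nbhs.
  have [|h [hh ph hU]] := @tight_basis D p U; first exact: open_nbhs_nbhs.
  exists (h * (q^* * q)); have qq := idemVs q; split.
  - exact: idemM.
  - split; first exact: idemM.
    exists q; split; first by rewrite -mulgA qq.
    move=> _ [r [rq [rh ->]]]; apply: UW; exists r, rq; split=> //; apply: hU.
    by move: rh; rewrite tight_domM // => -[].
  - exact: tightM.
  - rewrite tight_domM // => r [/hU Ur rq]; exists (mkgerm rq); last by rewrite germ_srcE.
    by apply: UW; exists r, rq.
have [phi phiP] : {phi : S -> S & forall z, z \in s ->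
    z * ((phi z)^* * phi z) = z /\ germ_set (phi z) (tight_dom z) `<=` W}.
  apply: (@choice _ _ (fun z q => z \in s ->
    z * (q^* * q) = z /\ germ_set q (tight_dom z) `<=` W)) => z.
  have [zs|_] := boolP (z \in s); last by exists z.
  by have [_ [_ [q qP]]] := sA.1 z zs; exists q.
have phiz z : z \in s -> (phi z)^* * phi z * z = z.
  by move=> zs; have [zz _] := sA.1 z zs; rewrite (idemC (idemVs (phi z)) zz); case: (phiP z zs).
have inW z p (qp : tight_dom ((phi z)^* * phi z) p) : z \in s -> tight_dom z p -> W (mkgerm qp).
  by move=> zs pz; apply: (phiP z zs).2; exists p, qp.
pose t := [seq phi z * z * (phi z)^* | z <- s].
have tA : dec xpredT (@germ_rng S @` W) t.
  split=> [_ /mapP[z zs ->]|p].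
    by split=> //; apply: idem_conjV; have [] := sA.1 z zs.
  have [[g Wg <-]|np] := asboolP ((@germ_rng S @` W) p); last first.
    apply/eqP; rewrite -leqn0 leqNgt; apply/negP => /cnt_gt0[_ /mapP[z zs ->]].
    have [zz _] := sA.1 z zs.
    move=> /(tight_dom_conj _ zz (phiz z zs))[p' [qp [zp' pE]]]; apply: np.
    by exists (mkgerm qp); [exact: inW|rewrite germ_rngE].
  transitivity (cnt s (germ_src g)); last by rewrite sA.2 asboolT //; exists g.
  rewrite /cnt count_map; apply: eq_in_count => z zs /=; have [zz _] := sA.1 z zs.
  apply: asbool_equiv_eq; split=> [/(tight_dom_conj _ zz (phiz z zs))|zg].
    move=> [p' [qp [zp' pE]]].
    have <- : mkgerm qp = g; last by rewrite germ_srcE.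
    by apply: Wr; rewrite ?inE //=; [exact: inW|rewrite germ_rngE].
  apply/(tight_dom_conj _ zz (phiz z zs)).
  have qp : tight_dom ((phi z)^* * phi z) (germ_src g).
    by apply: (tightS zg); [exact: idemVs|case: (phiP z zs)].
  exists (germ_src g), qp; split=> //; rewrite -germ_rngE; congr germ_rng.
  by apply: Ws; rewrite ?inE //=; [exact: inW|rewrite germ_srcE].
rewrite (measureE sA) (measureE tA) big_map big_seq [RHS]big_seq; apply: eq_bigr => z zs.
by have [zz _] := sA.1 z zs; apply/esym/weight_conj => //; exact: phiz.
Qed.

End UnitSpaceMeasure.

Local Open Scope quotient_scope.

(** * The isomorphism with the type semigroup *)

Section TypeSemigroupOfData.
Variable D : graphData.
Local Notation V := (gvert D).
Local Notation S := (SEC_inverse (@sec_inverse D)).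
Local Notation G := (Gtight S).
Local Notation "0" := (szero : S) : group_scope.
Implicit Types (v w x y : V) (e : gedge D).
Implicit Types (f g h z q : S) (p : tight_space S) (s t : seq S) (a b : seq (cosets_unit G)).

Definition cylinder z : cosets_unit G :=
  exist _ (tight_dom z) (mem_set (conj (@tight_dom_compact S z) (@tight_dom_open S z))).

Lemma Typ_pi_cat a b : \pi_(Typ G) (a ++ b) = (\pi_(Typ G) a + \pi_(Typ G) b)%R.
Proof. by rewrite -Typ_addE. Qed.

Lemma Typ_pi_sum (I : Type) (l : seq I) (F : I -> cosets_unit G) :
  (\sum_(i <- l) \pi_(Typ G) [:: F i] = \pi_(Typ G) [seq F i | i <- l])%R.
Proof.
elim: l => [|i l IH]; first by rewrite big_nil.
by rewrite big_cons IH -Typ_pi_cat.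
Qed.

Definition typ_cls z : Typ G := \pi_(Typ G) [:: cylinder z].

(** Cylinders are split off one at a time; what remains is compact open since cylinders are
    clopen. *)
Lemma typ_cls_dec Q (A : cosets_unit G) s : dec Q (set_val A) s ->
  \pi_(Typ G) [:: A] = (\sum_(z <- s) typ_cls z)%R.
Proof.
elim: s A => [|z s IH] A [sI sc].
  rewrite big_nil; apply/Typ_eq/typ_empty; rewrite -subset0 => p Ap.
  by have := sc p; rewrite asboolT.
have [cA oA] : Defs.compact_open (set_val A) by exact: set_mem (valP A).
have cB : Defs.compact_open (set_val A `&` ~` tight_dom z).
  split; last by apply: openI => //; exact: tight_domC_open.
  by apply: compact_closedI => //; apply: open_closedC; exact: tight_dom_open.
pose B : cosets_unit G := exist _ (set_val A `&` ~` tight_dom z) (mem_set cB).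
have zA p : tight_dom z p -> set_val A p.
  by move=> pz; have := sc p; rewrite /cnt /= (asboolT pz); case: asboolP.
rewrite big_cons -(IH B); last first.
  split=> [h hs|p]; first by apply: sI; rewrite inE hs orbT.
  have := sc p; rewrite /cnt /= asbool_and asbool_neg.
  by case: `[< tight_dom z p >]; case: `[< set_val A p >] => //=; lia.
rewrite -Typ_pi_cat; apply/Typ_eq/typ_disjoint => /=.
  by rewrite -subset0 => p [pz [_]].
rewrite eqEsubset; split=> p; last by move=> [/zA|[]].
by move=> Ap; have [|] := pselect (tight_dom z p); [left|right].
Qed.

Lemma typ_cls0 : typ_cls 0 = 0%R.
Proof. by apply/Typ_eq/typ_empty; exact: (@tight_dom0 S). Qed.

(** The germs of q over its whole domain form a compact open bisection between the two cylinders. *)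
Lemma typ_cls_vert z v : is_vert z v -> typ_cls z = typ_cls (sv v).
Proof.
move=> [q [<- <-]]; apply/esym/Typ_eq.
apply: (@typ_bisection G (germ_set q (tight_dom (q^* * q)))) => /=.
- apply: germ_set_bisection => //; [exact: tight_dom_compact|exact: tight_dom_open].
- rewrite eqEsubset; split=> p.
    by move=> pq; exists (mkgerm pq); [exact: germ_set_mk|exact: germ_srcE].
  by move=> [_ [p' [qp [_ ->]]] <-]; rewrite germ_srcE.
- have qq := idemVs q; rewrite eqEsubset; split=> p.
    have -> : q * q^* = q * (q^* * q) * q^* by rewrite !mulgA mulsVs.
    move=> /(tight_dom_conj _ qq qq)[p' [qp [_ <-]]].
    by exists (mkgerm qp); [exact: germ_set_mk|exact: germ_rngE].
  move=> [_ [p' [qp [_ ->]]] <-]; rewrite germ_rngE.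
  have -> : q * q^* = q * (q^* * q) * q^* by rewrite !mulgA mulsVs.
  by apply/(tight_dom_conj _ qq qq); exists p', qp.
Qed.

Lemma typ_cls_sat : @grels_sat D (Typ G) (fun v => typ_cls (sv v)).
Proof.
move=> v X /(nthP [::])[i ik <-].
have [E [uE EP EG]] := block_edges (ik : (i < kblocks v)%N).
have d : dec xpredT (set_val (cylinder (sv v))) [seq (eproj e : S) | e <- E].
  split=> [_ /mapP[e _ ->]|p]; first by split=> //; exact: idem_eproj.
  exact: (block_cnt p ik uE EP).
rewrite {1}/typ_cls (typ_cls_dec d) -/(grow v i) -EG !big_map; apply: eq_bigr => e _.
by apply: typ_cls_vert; exists (se e); split=> //; exact: see.
Qed.

Variables (M : nmodType) (val : V -> M).
Hypothesis valsat : grels_sat val.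
Hypothesis val_gen : forall m, exists l, m = (\sum_(v <- l) val v)%R.
Hypothesis val_complete : forall (T : nmodType) (c : V -> T), grels_sat c ->
  forall l l', (\sum_(v <- l) val v = \sum_(v <- l') val v)%R ->
    (\sum_(v <- l) c v = \sum_(v <- l') c v)%R.

Definition typ_measure a : M := (\sum_(A <- a) measure val (set_val A))%R.

Lemma typ_measure_rel a b : typ_rel a b -> typ_measure a = typ_measure b.
Proof.
rewrite /typ_measure; elim=> {a b} [//|//|a b c _ -> _ ->//
  |a a' b b' _ ha _ hb|a b|A A0|W A B hW AW BW|A B C AB CE].
- by rewrite !big_cat /= ha hb.
- by rewrite !big_cat /= GRing.addrC.
- rewrite big_seq1 big_nil A0 (@measureE D _ _ valsat xpredT _ [::]) ?big_nil //.
  by split=> // p; rewrite asboolF.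
- by rewrite !big_seq1 AW BW; exact: measure_bisection.
- rewrite big_seq1 big_cons big_seq1 CE; apply: measure_disjoint => //.
    exact: set_mem (valP A).
  exact: set_mem (valP B).
Qed.

(** Defined through a chosen expression of [m]; [val_complete], applied to the classes of the
    vertices, removes the dependence on the choice. *)
Definition to_typ (m : M) : Typ G := (\sum_(v <- sval (cid (val_gen m))) typ_cls (sv v))%R.

Lemma to_typE l : to_typ (\sum_(v <- l) val v)%R = (\sum_(v <- l) typ_cls (sv v))%R.
Proof.
apply: val_complete; first exact: typ_cls_sat.
exact/esym/(svalP (cid (val_gen (\sum_(v <- l) val v)%R))).
Qed.

Lemma to_typ_additive : GRing.nmod_morphism to_typ.
Proof.
split; first by have := to_typE [::]; rewrite !big_nil.
move=> m n; have [l ->] := val_gen m; have [l' ->] := val_gen n.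
by rewrite -big_cat !to_typE big_cat.
Qed.

Lemma to_typ_weight z : idem z -> to_typ (weight val z) = typ_cls z.
Proof.
move=> zz; have [->|z0] := pselect (z = 0).
  by rewrite weight0 typ_cls0; case: to_typ_additive.
have [v zv] := is_vert_ex zz z0; rewrite (weight_vert _ zv) (typ_cls_vert zv).
by have := to_typE [:: v]; rewrite !big_seq1.
Qed.

(** The inverse measures a representative. One composite is checked on values of vertices, the other
    on single compact open sets, which split into cylinders. *)
Lemma data_typ_iso : monoid_iso M (Typ G).
Proof.
pose f : {additive M -> Typ G} :=
  HB.pack to_typ (GRing.isNmodMorphism.Build M (Typ G) to_typ to_typ_additive).
exists f; exists (fun u : Typ G => typ_measure (repr u)) => [m|].
  have [l ->] := val_gen m; rewrite [f _]to_typE Typ_pi_sum.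
  transitivity (typ_measure [seq cylinder (sv v) | v <- l]).
    by apply: typ_measure_rel; apply/Typ_eq; rewrite reprK.
  rewrite /typ_measure big_map; apply: eq_bigr => v _.
  by rewrite (measure_dom valsat) ?(weight_vert _ (is_vert_sv v)) //; exact: idem_sv.
elim/quotW=> a; transitivity (f (typ_measure a)).
  by congr (f _); apply: typ_measure_rel; apply/Typ_eq; rewrite reprK.
rewrite /typ_measure raddf_sum -[in RHS](map_id a) -Typ_pi_sum.
apply: eq_bigr => A _.
have [s sA] := compact_open_decT (set_mem (valP A) : Defs.compact_open (set_val A)).
rewrite (measureE valsat sA) raddf_sum (typ_cls_dec sA) big_seq [RHS]big_seq.
by apply: eq_bigr => z zs; apply: to_typ_weight; case: (sA.1 z zs).
Qed.

End TypeSemigroupOfData.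

Theorem corollary7p6 (M : nmodType)
    (fgM : monoid_fg M) (conicalM : monoid_conical M)
    (refinementM : monoid_refinement M) :
  (exists (E : sepGraph) (A : adaptable E) (h : inverse_law (SEC A)),
     ample (Gtight (SEC_inverse h)) /\
     monoid_iso M (Typ (Gtight (SEC_inverse h)))) /\
  (exists G : groupoid, ample_hausdorff G /\ monoid_iso M (Typ G)).
Proof.
have [D [val [valsat val_gen val_complete]]] :=
  monoid_graph_presentation fgM conicalM refinementM.
have iso := data_typ_iso valsat val_gen val_complete.
split; first by exists (data_graph D), (data_adaptable D), (@sec_inverse D);
  split=> //; exact: Gtight_ample.
exists (Gtight (SEC_inverse (@sec_inverse D))); split=> //.
split; [exact: Gtight_ample|exact/Gtight_hausdorff/sec_Estar_unitary].
Qed.
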